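(* Let $F$ be a fractal in $\mathbb R$ with lacunary spectral triple $(\mathcal A,\mathcal H_\ell,D_\ell)$. (i) For any singular traceability exponent $s$ for $|D_\ell|^{-1}$ and any singular trace $\tau_\omega$ with $\tau_\omega(|D_\ell|^{-s})=1$, the associated Hausdorff–Besicovitch functional gives rise to a probability measure on $F$: there is a Borel probability measure $\mu$ on $F$ with $\tau_\omega(f|D_\ell|^{-s})=\int_Ff\,d\mu$ for all $f\in C(F)$. (ii) If $F$ has zero Lebesgue measure, then $d(\mathcal A,\mathcal H_\ell,D_\ell)=\overline{d_B}(F)$. Therefore, if $\overline{d_B}(F)\neq0$, the number $\overline{d_B}(F)$ is a singular traceability exponent for $|D_\ell|^{-1}$ and there is a corresponding probability measure on $F$ as in (i).
   Context: A fractal in $\mathbb R$ is a nonempty compact, totally disconnected subset $F\subset\mathbb R$ without isolated points. Let $[a,b]$ be the least closed interval containing $F$; $[a,b]\setminus F$ is the disjoint union of open intervals (lacunae) $I_n=(a_n,b_n)$, $n\ge1$. Lacunary spectral triple: for a bounded interval $I$ let $\mathcal H(I)=\ell^2(\partial I)$ and $D(I)=\frac1{|I|}\begin{pmatrix}0&1\\1&0\end{pmatrix}$. Then $\mathcal H_\ell=\bigoplus_n\mathcal H(I_n)$, $D_\ell=\bigoplus_nD(I_n)$, $C(F)$ acts on $\mathcal H_\ell$ by pointwise multiplication on $\{a_n,b_n\}$, and $\mathcal A=\mathrm{Lip}(F)$. Upper box dimension: $\overline{d_B}(F)=\limsup_{\varepsilon\to0^+}\frac{\log N_\varepsilon(F)}{-\log\varepsilon}$,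 where $N_\varepsilon(F)$ is the least number of closed balls of radius $\varepsilon$ covering $F$. A singular trace on $\mathcal B(\mathcal H_\ell)$ is a positive tracial weight $\tau:\mathcal B(\mathcal H_\ell)_+\to[0,\infty]$ vanishing on finite rank projections, extended linearly to its domain. $s>0$ is a singular traceability exponent for $|D_\ell|^{-1}$ if there is a singular trace finite and nonzero on $|D_\ell|^{-s}$ (which may be normalized to be $1$ there); the functional $a\mapsto\tau_\omega(a|D_\ell|^{-s})$ is then called a Hausdorff–Besicovitch functional. For a compact operator $a$, $\mu_a(x)=\mu_n(a)$ on $[n,n+1)$, where $\mu_n(a)$, $n\ge0$, are the eigenvalues of $|a|$ in non-increasing order with multiplicity. $\mathcal L^{1,\infty}$ (resp. $\mathcal L^{1,\infty}_0$) is the set of compact $a$ with $\frac1{\log t}\int_0^t\mu_a$ bounded (resp. tending to $0$) as $t\to\infty$. $d(\mathcal A,\mathcal H_\ell,D_\ell)=\inf\{\alpha>0:|D_\ell|^{-\alpha}\in\mathcal L_0^{1,\infty}\}=\sup\{\alpha>0:|D_\ell|^{-\alpha}\notin\mathcal L^{1,\infty}\}$ (with $\inf\emptyset=\infty$, $\sup\emptyset=0$). *)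

(* Defs.v *)
From HB Require Import structures.
From mathcomp Require Import all_boot all_order all_algebra.
From mathcomp Require Import all_classical all_reals all_analysis.
From mathcomp Require Import complex.
From mathcomp Require Import ring.

Set Implicit Arguments.
Unset Strict Implicit.
Unset Printing Implicit Defensive.

Import Order.TTheory GRing.Theory Num.Theory.
Import numFieldNormedType.Exports.
Import ComplexField.Normc.

Local Open Scope classical_set_scope.
Local Open Scope ring_scope.
Local Open Scope complex_scope.

Section fractals.
Context {R : realType}.
Implicit Types F : set R.

Definition fractal F : Prop :=
  [/\ F !=set0, compact F, totally_disconnected F & isolated F = set0].

(* [a], [b] enumerate the lacunae [I_n = ]a n, b n[] of [F]. *)
Definition lacunae F (a b : nat -> R) : Prop :=
  [/\ forall n, a n < b n,
      trivIset [set: nat] (fun n => `]a n, b n[%classic)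
    & `[inf F, sup F]%classic `\` F = \bigcup_n `]a n, b n[%classic].

Definition covered_by F (e : R) (k : nat) : Prop :=
  exists c : 'I_k -> R, F `<=` \bigcup_i closed_ball (c i) e.

(* The infimum is attained: it is a minimum of natural numbers. *)
Definition covering_number F (e : R) : R :=
  inf [set (k%:R : R) | k in [set k | covered_by F e k]].

Definition upper_box_dim F : \bar R :=
  limf_esup (fun e : R => (ln (covering_number F e) / - ln e)%:E) 0^'+.

End fractals.

(* The direct sum of the spaces [l^2({a_n, b_n})] is [l^2(nat * 'I_2)]: the
   coordinate [(n, j)] stands for an endpoint of the [n]-th lacuna, the left one
   if [j = 0] and the right one if [j = 1]. *)

Definition sqsum {R : realType} (x : nat * 'I_2 -> R[i]) : \bar R :=
  (\esum_(p in [set: nat * 'I_2]) ((normc (x p)) ^+ 2)%:E)%E.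

Definition l2_pred (R : realType) : {pred (nat * 'I_2 -> R[i])} :=
  fun x => (sqsum x < +oo)%E.

Lemma l2_submod_closed (R : realType) : submod_closed (@l2_pred R).
Proof.
have sq0 (z : R[i]) : (0 <= (normc z ^+ 2)%:E)%E by rewrite lee_fin sqr_ge0.
have nM (u v : R[i]) : normc (u * v) ^+ 2 = normc u ^+ 2 * normc v ^+ 2.
  by rewrite normcM exprMn.
have nD (u v : R[i]) : normc (u + v) ^+ 2 <= 2 * normc u ^+ 2 + 2 * normc v ^+ 2.
  case: u v => [a b] [c d] /=.
  rewrite !sqr_sqrtr ?addr_ge0 ?sqr_ge0 // -subr_ge0.
  rewrite (_ : _ - _ = (a - c) ^+ 2 + (b - d) ^+ 2) ?addr_ge0 ?sqr_ge0 //.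
  by ring.
split.
  rewrite unfold_in /l2_pred /sqsum esum1 ?ltry // => p _ /=.
  by rewrite /= expr0n /= addr0 sqrtr0 expr0n.
move=> k x y; rewrite !unfold_in /l2_pred => xl yl.
pose c := 2 * normc k ^+ 2.
have c0 : 0 <= c by rewrite mulr_ge0 // sqr_ge0.
have fx : sqsum x \is a fin_num by rewrite ge0_fin_numE // esum_ge0.
have fy : sqsum y \is a fin_num by rewrite ge0_fin_numE // esum_ge0.
have fin2 : (c%:E * sqsum x + 2%:E * sqsum y < +oo)%E.
  by rewrite -(fineK fx) -(fineK fy) -!EFinM -EFinD ltry.
apply: le_lt_trans fin2; apply: ge_ereal_sup => _ [A [fA _]] <-.
apply: (@le_trans _ _ (\sum_(p \in A)
    (c%:E * (normc (x p) ^+ 2)%:E + 2%:E * (normc (y p) ^+ 2)%:E))%E).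
  apply: lee_fsum => // p _; rewrite -!EFinM -EFinD lee_fin.
  by apply: le_trans (nD _ _) _; rewrite nM mulrA.
rewrite fsbig_split //= -!ge0_mule_fsumr //.
by apply: leeD; apply: lee_wpmul2l; rewrite ?lee_fin //;
  apply: esum_ge; exists A.
Qed.

HB.instance Definition _ (R : realType) :=
  GRing.isSubmodClosed.Build R[i] (nat * 'I_2 -> R[i]) (@l2_pred R)
    (@l2_submod_closed R).

Record l2 (R : realType) := L2 {
  l2val :> nat * 'I_2 -> R[i];
  l2valP : l2val \in @l2_pred R }.

HB.instance Definition _ (R : realType) := [isSub for @l2val R].
HB.instance Definition _ (R : realType) := [Choice of l2 R by <:].
HB.instance Definition _ (R : realType) :=
  [SubChoice_isSubLmodule of l2 R by <:].

Section operators.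
Context {R : realType}.
Local Notation H := (l2 R).
Implicit Types (S T P : H -> H) (x y : H).

Definition l2norm x : R := Num.sqrt (fine (sqsum x)).

(* Linear in the first argument. The real and imaginary parts of the series are
   summed separately; both converge absolutely by Cauchy-Schwarz. *)
Definition dot x y : R[i] :=
  let u n := \sum_(j < 2) x (n, j) * (y (n, j))^* in
  limn (series (fun n => complex.Re (u n))) +i* limn (series (fun n => complex.Im (u n))).

Definition bounded_op T : Prop :=
  linear T /\ exists M : R, forall x, l2norm (T x) <= M * l2norm x.

Definition adjoint_of T S : Prop :=
  [/\ bounded_op T, bounded_op S & forall x y, dot (T x) y = dot x (S y)].

(* [0 <= z] in [R[i]] means that [z] is real and nonnegative. *)
Definition positive_op T : Prop :=
  bounded_op T /\ forall x, 0 <= dot (T x) x.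

Definition finite_dim (V : set H) (k : nat) : Prop :=
  exists v : 'I_k -> H,
    (forall c : 'I_k -> R[i], \sum_i c i *: v i = 0 -> forall i, c i = 0) /\
    V = [set \sum_i c i *: v i | c in [set: 'I_k -> R[i]]].

Definition finite_rank_projection P : Prop :=
  [/\ adjoint_of P P, P \o P = P & exists k, finite_dim (range P) k].

Definition compact_op T : Prop :=
  bounded_op T /\
  forall x : nat -> H, (exists M, forall n, l2norm (x n) <= M) ->
  exists (phi : nat -> nat) (y : H),
    {homo phi : m n / (m < n)%N} /\
    (fun n => l2norm (T (x (phi n)) - y)) @ \oo --> (0 : R).

Definition abs_of T P : Prop :=
  positive_op P /\ exists2 S, adjoint_of T S & P \o P = S \o T.

(* [mu] lists the eigenvalues of [P] in nonincreasing order with multiplicity;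
   the value 0 pads the list if there are only finitely many positive ones. *)
Definition eigenvalue_seq P (mu : nat -> R) : Prop :=
  [/\ nonincreasing_seq mu, forall n, 0 <= mu n
    & forall l : R, 0 < l -> exists k : nat,
        ([set n | mu n = l] #= `I_k)%card /\ finite_dim [set x | P x = l%:C *: x] k].

Definition singular_values T (mu : nat -> R) : Prop :=
  exists2 P, abs_of T P & eigenvalue_seq P mu.

Definition log_mean (mu : nat -> R) (t : R) : R :=
  (ln t)^-1 * \int[lebesgue_measure]_(x in `[0, t]) mu (Num.truncn x).

Definition L1inf0 T : Prop :=
  compact_op T /\
  exists2 mu, singular_values T mu & log_mean mu t @[t --> +oo] --> (0 : R).

(* The value of [tau] outside the positive bounded operators is irrelevant. *)
Definition tracial_weight (tau : (H -> H) -> \bar R) : Prop :=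
  [/\ forall T, positive_op T -> (0 <= tau T)%E,
      forall S T, positive_op S -> positive_op T ->
        tau (S + T) = (tau S + tau T)%E,
      forall (c : R) T, 0 <= c -> positive_op T ->
        tau (c%:C *: T) = (c%:E * tau T)%E
    & forall T S, adjoint_of T S -> tau (S \o T) = tau (T \o S)].

Definition singular_trace (tau : (H -> H) -> \bar R) : Prop :=
  tracial_weight tau /\ forall P, finite_rank_projection P -> tau P = 0%E.

(* [T] belongs to the domain of the linear extension of [tau], which is the
   linear span of the positive operators of finite trace, and the extension
   takes the value [z] at [T]. *)
Definition trace_value (tau : (H -> H) -> \bar R) T (z : R[i]) : Prop :=
  exists P1 P2 P3 P4 : H -> H,
    [/\ forall P, P \in [:: P1; P2; P3; P4] ->
          positive_op P /\ (tau P < +oo)%E,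
        T = (P1 - P2) + (0 +i* 1) *: (P3 - P4)
      & z = (fine (tau P1) - fine (tau P2)) +i*
            (fine (tau P3) - fine (tau P4))].

End operators.

Section lacunary.
Context {R : realType}.
Local Notation H := (l2 R).
Implicit Types (F : set R) (a b : nat -> R).

(* The direct sum of the operators [A n] on [l^2({a_n, b_n})], on its maximal
   domain (everywhere if the [A n] are uniformly bounded), and 0 elsewhere. *)
Definition dirsum (A : nat -> 'M[R[i]]_2) (x : H) : H :=
  insubd 0 (fun p => \sum_j A p.1 p.2 j * x (p.1, j)).

Definition dirac_interval (u v : R) : 'M[R[i]]_2 :=
  ((v - u)^-1)%:C *: \matrix_(i, j) (i != j)%:R.

(* [D_l] is [dirsum (dirac_blocks a b)], an unbounded operator. *)
Definition dirac_blocks a b (n : nat) : 'M[R[i]]_2 :=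
  dirac_interval (a n) (b n).

(* The functional calculus [g(A)] of a normal matrix. *)
Definition mxfun m (g : R[i] -> R[i]) (A : 'M[R[i]]_m) : 'M[R[i]]_m :=
  invmx (spectralmx A) *m diag_mx (map_mx g (spectral_diag A)) *m spectralmx A.

(* The power |D_l|^(-s): the functional calculus of a direct sum acts blockwise. *)
Definition abs_dirac_pow a b (s : R) : H -> H :=
  dirsum (fun n => mxfun (fun z => (normc z `^ (- s))%:C) (dirac_blocks a b n)).

Definition mul_op a b (f : R -> R[i]) : H -> H :=
  dirsum (fun n => diag_mx (\row_j (if j == 0 then f (a n) else f (b n)))).

Definition spectral_dimension a b : \bar R :=
  ereal_inf [set al%:E | al in
    [set al : R | 0 < al /\ L1inf0 (abs_dirac_pow a b al)]].

Definition singular_traceability_exponent a b (s : R) : Prop :=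
  0 < s /\ exists2 tau, singular_trace tau &
    (0 < tau (abs_dirac_pow a b s) < +oo)%E.

(* A Borel probability measure on [F] is a Borel probability measure on the
   line that is carried by [F]; a function in C(F) is represented by a function
   on the line whose restriction to [F] is continuous. *)
Definition represents_HB_functional F a b (tau : (H -> H) -> \bar R) (s : R)
    (mu : probability (measurableTypeR R) R) : Prop :=
  mu F = 1%E /\
  forall f : R -> R[i],
    {within F, continuous (fun x => complex.Re (f x))} ->
    {within F, continuous (fun x => complex.Im (f x))} ->
    trace_value tau (mul_op a b f \o abs_dirac_pow a b s)
      ((\int[mu]_(x in F) complex.Re (f x)) +i* (\int[mu]_(x in F) complex.Im (f x))).

End lacunary.

(* Main.v *)
Require Import Defs.
From HB Require Import structures.
From mathcomp Require Import all_boot all_order all_algebra.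
From mathcomp Require Import all_classical all_reals all_analysis.
From mathcomp Require Import measurable_realfun complex ring lra.

(* The operator |D_l|^(-s) is diagonal with entries l_n^s, each occurring twice,
   where l_n is the length of the n-th lacuna.

   For (i), a positive normalized functional on the functions of the endpoints
   suffices. G(c) = tau(1_{endpoints <= c} |D_l|^(-s)) is nondecreasing, and the
   right-continuous regularization of G is a distribution function, whose
   Lebesgue-Stieltjes measure is mu. Off F the function G is locally constant,
   so that F has full measure. As F is totally disconnected, it can be cut at
   points outside F into pieces on which f varies little; both sides of the
   integral formula agree up to the oscillation of f on the pieces.

   For (ii), the count of the lacunae longer than x is at most the covering
   number of F at radius x / 2, and conversely, if F is null, the convergence of
   the series of the l_n^al yields a covering of F by O(e^(-al)) balls of radius
   e. Hence the box dimension d is the abscissa of convergence of that series,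
   and so is the spectral dimension.

   A singular trace that is 1 on |D_l|^(-d) is a Dixmier trace along a sparse
   sequence: the limit along an ultrafilter of S_T(2^(r_k)) / w_k, where S_T are
   the Ky Fan sums of T and w_k the value for |D_l|^(-d); if the latter is trace
   class, the tails of the Ky Fan sums are used instead. This is additive if the
   increments of the sums over [2^(r_k - j), 2^(r_k + j)] are negligible with
   respect to w_k for each j. Such r_k exist since otherwise the sums (or tails)
   would grow (or decay) like a power of n, so that the abscissa of convergence
   would not be d. *)

Set Implicit Arguments.
Unset Strict Implicit.
Unset Printing Implicit Defensive.

Import Order.TTheory GRing.Theory Num.Theory.
Import numFieldNormedType.Exports.
Import ComplexField.Normc.

Local Open Scope classical_set_scope.
Local Open Scope ring_scope.
Local Open Scope complex_scope.

(** A weight has to be defined on all positive bounded operators, compact or not, so the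
    construction uses no spectral theorem. Ky Fan sums are suprema of partial traces over
    orthonormal systems, and finite-dimensional linear algebra yields all that is needed:
    [kyfan n A + kyfan n B] lies between [kyfan n (A + B)] and [kyfan (n + n) (A + B)], and [S \o T]
    and [T \o S] have the same sums if [S] is the adjoint of [T]. The only failure of additivity is
    therefore the doubling of the argument, which is one dyadic step; windows of every width [j]
    must be negligible because each addition uses up one step. In the trace class case the sums
    themselves would not vanish on finite rank projections, while their tails do. Both cases are
    treated, since nothing decides whether the series of the [l_n ^ d] converges at its abscissa
    [d]. *)

(** * Square summable families and their norms *)

Section hilbert_space.
Context {R : realType}.
Local Notation H := (l2 R).
Local Notation index := (nat * 'I_2)%type.
Implicit Types (x y z : H) (p : index) (c : R[i]).

(** Sums over [nat * 'I_2] are taken row by row: they become ordinary series over the lacunae, to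
    which the theory of real sequences applies. *)
Definition rowsum (g : index -> R) (n : nat) : R := \sum_(j < 2) g (n, j).

Lemma rowsum_ge0 g n : (forall p, 0 <= g p) -> 0 <= rowsum g n.
Proof. by move=> g0; apply: sumr_ge0. Qed.

Lemma ler_rowsum (g : index -> R) p : (forall q, 0 <= g q) -> g p <= rowsum g p.1.
Proof.
case: p => n j g0; rewrite /rowsum (bigD1 j) //= lerDl.
exact: sumr_ge0.
Qed.

Lemma esum_rows (g : index -> R) : (forall p, 0 <= g p) ->
  (\esum_(p in [set: index]) (g p)%:E = \sum_(0 <= n <oo) (rowsum g n)%:E)%E.
Proof.
move=> g0; rewrite nneseries_esumT; last first.
  by move=> n; rewrite lee_fin rowsum_ge0.
have -> : [set: index] = setT `*`` (fun=> setT) by apply/seteqP; split.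
rewrite (eq_esum (b := fun p => (g (p.1, p.2))%:E)); last by case.
rewrite -(@esum_esum _ _ _ setT (fun=> setT) (fun n j => (g (n, j))%:E)).
  apply: eq_esum => n _; rewrite esum_fset //; first last.
  - by move=> j _; rewrite lee_fin.
  - exact: finite_finset.
  rewrite /rowsum -sumEFin [RHS]fsbig_seq ?index_enum_uniq //.
  rewrite (_ : [set: 'I_2] = [set` index_enum 'I_2]) //.
  by apply/seteqP; split => j //= _; rewrite mem_index_enum.
by move=> n j _ _; rewrite lee_fin.
Qed.

Definition nsq (c : R[i]) : R := complex.Re c ^+ 2 + complex.Im c ^+ 2.

Lemma normc_sq c : normc c ^+ 2 = nsq c.
Proof. by case: c => a b /=; rewrite sqr_sqrtr ?addr_ge0 ?sqr_ge0. Qed.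

Lemma nsq_ge0 c : 0 <= nsq c.
Proof. by rewrite addr_ge0 ?sqr_ge0. Qed.
Hint Resolve nsq_ge0 : core.

Lemma nsq_eq0 c : (nsq c == 0) = (c == 0).
Proof. by rewrite -normc_sq sqrf_eq0; apply/eqP/eqP=> [/eq0_normc|->] //; rewrite normc0. Qed.

Lemma nsqM c d : nsq (c * d) = nsq c * nsq d.
Proof. by rewrite -!normc_sq normcM exprMn. Qed.

Lemma nsqN c : nsq (- c) = nsq c.
Proof. by case: c => a b; rewrite /nsq /= !sqrrN. Qed.

Lemma nsq_real (r : R) : nsq r%:C = r ^+ 2.
Proof. by rewrite /nsq /= expr0n addr0. Qed.

Lemma sqsumE (f : index -> R[i]) :
  sqsum f = (\sum_(0 <= n <oo) (rowsum (nsq \o f) n)%:E)%E.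
Proof.
rewrite /sqsum -esum_rows //; last by move=> p /=.
by apply: eq_esum => p _; rewrite /= normc_sq.
Qed.

Lemma in_l2 (f : index -> R[i]) (M : R) :
  (forall N, series (rowsum (nsq \o f)) N <= M) -> f \in @l2_pred R.
Proof.
move=> fM; rewrite unfold_in /l2_pred sqsumE.
apply: (@le_lt_trans _ _ M%:E); last exact: ltry.
apply: lime_le; first by apply: is_cvg_nneseries => n _ _; rewrite lee_fin rowsum_ge0 /=.
by apply: nearW => N; rewrite sumEFin lee_fin; exact: fM.
Qed.

Lemma sqsum_fin x : sqsum x \is a fin_num.
Proof.
rewrite ge0_fin_numE; first by have := l2valP x.
by apply: esum_ge0 => p _; rewrite lee_fin sqr_ge0.
Qed.

Lemma nsq_cvg x : series (rowsum (nsq \o x)) @ \oo --> fine (sqsum x).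
Proof.
have : (\sum_(0 <= n < N) (rowsum (nsq \o x) n)%:E)%E @[N --> \oo]
    --> (fine (sqsum x))%:E.
  rewrite fineK ?sqsum_fin // sqsumE.
  by apply: is_cvg_nneseries => n _ _; rewrite lee_fin rowsum_ge0 /=.
move=> /fine_cvg; apply: cvg_trans; apply: near_eq_cvg; apply: nearW => N /=.
by rewrite sumEFin.
Qed.

Lemma series_nd (u : nat -> R) : (forall n, 0 <= u n) -> nondecreasing_seq (series u).
Proof. by move=> u0; apply: nondecreasing_series => n _ _; exact: u0. Qed.

Lemma nsq_le x N : series (rowsum (nsq \o x)) N <= fine (sqsum x).
Proof.
rewrite -(cvg_lim _ (@nsq_cvg x)) //.
apply: nondecreasing_cvgn_le; last by apply/cvg_ex; exists (fine (sqsum x)); exact: nsq_cvg.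
by apply: series_nd => n; rewrite rowsum_ge0 /=.
Qed.

Lemma sqsum_le x (M : R) :
  (forall N, series (rowsum (nsq \o x)) N <= M) -> fine (sqsum x) <= M.
Proof.
move=> xM; rewrite -(cvg_lim _ (@nsq_cvg x)) //.
by apply: limr_le; [apply/cvg_ex; exists (fine (sqsum x)); exact: nsq_cvg | exact: nearW].
Qed.

Lemma fine_sqsum_ge0 x : 0 <= fine (sqsum x).
Proof. by apply: le_trans (nsq_le x 0); rewrite /series /= big_geq. Qed.

Lemma l2norm_ge0 x : 0 <= l2norm x.
Proof. exact: sqrtr_ge0. Qed.

Lemma l2norm_sq x : l2norm x ^+ 2 = fine (sqsum x).
Proof. by rewrite /l2norm sqr_sqrtr // fine_sqsum_ge0. Qed.

Lemma l2_eq x y : (forall p, x p = y p) -> x = y.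
Proof. by move=> xy; apply: val_inj; apply: funext. Qed.

Lemma l2addE x y p : (x + y) p = x p + y p.
Proof. by []. Qed.

Lemma l2oppE x p : (- x) p = - x p.
Proof. by []. Qed.

Lemma l2scaleE c x p : (c *: x) p = c * x p.
Proof. by []. Qed.

End hilbert_space.

(** * The inner product *)

Section inner_product.
Context {R : realType}.
Local Notation H := (l2 R).
Local Notation index := (nat * 'I_2)%type.
Implicit Types (x y z : H) (p : index) (c : R[i]).

(** [dot] is defined by [limn], which says nothing about convergence. This predicate records the
    convergence of both parts, so that algebraic identities pass from the terms to the sums. *)
Definition csum_to (u : nat -> R[i]) c : Prop :=
  series (fun n => complex.Re (u n)) @ \oo --> complex.Re c /\
  series (fun n => complex.Im (u n)) @ \oo --> complex.Im c.

Lemma csum_to_unique u c d : csum_to u c -> csum_to u d -> c = d.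
Proof.
move=> [uc vc] [ud vd]; apply/eqP; rewrite eq_complex.
rewrite -(cvg_lim _ uc) // (cvg_lim _ ud) // -(cvg_lim _ vc) // (cvg_lim _ vd) //.
by rewrite !eqxx.
Qed.

Lemma csum_to_lin u v a c d : csum_to u c -> csum_to v d ->
  csum_to (fun n => a * u n + v n) (a * c + d).
Proof.
case: a => a b; case: c => c1 c2; case: d => d1 d2 [/= u1 u2] [/= v1 v2]; split=> /=.
- have -> : series (fun n => complex.Re ((a +i* b) * u n + v n)) =
      fun n => a * series (fun n => complex.Re (u n)) n
        - b * series (fun n => complex.Im (u n)) n + series (fun n => complex.Re (v n)) n.
    apply/funext => n; rewrite /series /= !big_distrr /= -sumrB -big_split /=.
    by apply: eq_bigr => k _; case: (u k) (v k) => ? ? [? ?].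
  by apply: cvgD v1; apply: cvgB; apply: cvgMr.
- have -> : series (fun n => complex.Im ((a +i* b) * u n + v n)) =
      fun n => a * series (fun n => complex.Im (u n)) n
        + b * series (fun n => complex.Re (u n)) n + series (fun n => complex.Im (v n)) n.
    apply/funext => n; rewrite /series /= !big_distrr /= -!big_split /=.
    by apply: eq_bigr => k _; case: (u k) (v k) => ? ? [? ?].
  by apply: cvgD v2; apply: cvgD; apply: cvgMr.
Qed.

Lemma cRe_conj c : @complex.Re R (c^*)%R = complex.Re c. Proof. by case: c. Qed.

Lemma cIm_conj c : @complex.Im R (c^*)%R = - complex.Im c. Proof. by case: c. Qed.

Lemma csum_to_conj u c : csum_to u c -> csum_to (fun n => (u n)^*%R) c^*%R.
Proof.
move=> [u1 u2]; split.
- rewrite cRe_conj (_ : (fun n => _) = fun n => complex.Re (u n)) //.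
  by apply/funext => n; rewrite cRe_conj.
- rewrite cIm_conj (_ : (fun n => _) = - (fun n => complex.Im (u n))).
    by rewrite seriesN; apply: cvgN.
  by apply/funext => n; rewrite cIm_conj.
Qed.

Lemma ReD c d : complex.Re (c + d) = complex.Re c + complex.Re d.
Proof. by case: c d => ? ? []. Qed.

Lemma ReN c : complex.Re (- c) = - complex.Re c.
Proof. by case: c. Qed.

Lemma ReS (I : finType) (F : I -> R[i]) :
  complex.Re (\sum_i F i) = \sum_i complex.Re (F i).
Proof. by apply: (big_morph _ (id1 := 0)) => // -[? ?] [? ?]. Qed.

Lemma ImS (I : finType) (F : I -> R[i]) :
  complex.Im (\sum_i F i) = \sum_i complex.Im (F i).
Proof. by apply: (big_morph _ (id1 := 0)) => // -[? ?] [? ?]. Qed.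

Definition dterm x y n : R[i] := \sum_(j < 2) x (n, j) * (y (n, j))^*%R.

Lemma Re_mulconj c d : complex.Re (c * d^*%R) = complex.Re c * complex.Re d + complex.Im c * complex.Im d.
Proof. by case: c d => [a b] [a' b'] /=; ring. Qed.

Lemma Im_mulconj c d : complex.Im (c * d^*%R) = complex.Im c * complex.Re d - complex.Re c * complex.Im d.
Proof. by case: c d => [a b] [a' b'] /=; ring. Qed.

(** The inequality between arithmetic and geometric means, with a factor 2 given away; domination by
    a summable series is all that [dot] requires. *)
Lemma normr_mulD_le (a b a' b' : R) :
  `|a * a' + b * b'| <= a ^+ 2 + b ^+ 2 + (a' ^+ 2 + b' ^+ 2).
Proof.
have := (sqr_ge0 (a - a'), sqr_ge0 (b - b'), sqr_ge0 (a + a'), sqr_ge0 (b + b'),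
  sqr_ge0 a, sqr_ge0 a', sqr_ge0 b, sqr_ge0 b').
rewrite ler_norml !sqrrD !sqrrN => -[[[[[[[? ?] ?] ?] ?] ?] ?] ?].
by apply/andP; split; lra.
Qed.

Lemma Re_dterm_le x y n :
  `|complex.Re (dterm x y n)| <= rowsum (nsq \o x) n + rowsum (nsq \o y) n.
Proof.
rewrite ReS (le_trans (ler_norm_sum _ _ _)) // -big_split /=.
by apply: ler_sum => j _; rewrite Re_mulconj; exact: normr_mulD_le.
Qed.

Lemma Im_dterm_le x y n :
  `|complex.Im (dterm x y n)| <= rowsum (nsq \o x) n + rowsum (nsq \o y) n.
Proof.
rewrite ImS (le_trans (ler_norm_sum _ _ _)) // -big_split /=.
apply: ler_sum => j _; rewrite Im_mulconj -mulrN.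
by apply: le_trans (normr_mulD_le _ _ _ _) _; rewrite /nsq /= sqrrN; lra.
Qed.

Lemma cvg_dominated_series x y (u : nat -> R) :
  (forall n, `|u n| <= rowsum (nsq \o x) n + rowsum (nsq \o y) n) ->
  cvgn (series u).
Proof.
move=> uxy; apply: normed_cvg; apply: (series_le_cvg _ _ uxy) => //.
- by move=> n; apply: addr_ge0; apply: rowsum_ge0 => p /=; exact: nsq_ge0.
- rewrite (_ : series _ = series (rowsum (nsq \o x)) \+ series (rowsum (nsq \o y))).
    by apply: is_cvgD; apply/cvg_ex; eexists; exact: nsq_cvg.
  by apply/funext => n; rewrite /series /= big_split.
Qed.

Lemma dot_csum x y : csum_to (dterm x y) (dot x y).
Proof.
split; rewrite /dot /=; apply: (@cvg_dominated_series x y) => n.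
  exact: Re_dterm_le.
exact: Im_dterm_le.
Qed.

Lemma dotP x y c : csum_to (dterm x y) c -> dot x y = c.
Proof. exact/csum_to_unique/dot_csum. Qed.

Lemma dotDZl c x y z : dot (c *: x + y) z = c * dot x z + dot y z.
Proof.
apply: dotP; have := csum_to_lin c (dot_csum x z) (dot_csum y z).
congr csum_to; apply/funext => n; rewrite /dterm big_distrr -big_split /=.
by apply: eq_bigr => j _; rewrite mulrA -mulrDl.
Qed.

Lemma dotC x y : dot y x = (dot x y)^*%R.
Proof.
apply: dotP; have := csum_to_conj (dot_csum x y).
congr csum_to; apply/funext => n; rewrite /dterm raddf_sum /=.
by apply: eq_bigr => j _; rewrite rmorphM /= conjCK mulrC.
Qed.

Lemma dot0l x : dot 0 x = 0.
Proof.
have := dotDZl 1 0 0 x; rewrite scale1r addr0 mul1r => /eqP.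
by rewrite -subr_eq subrr eq_sym => /eqP.
Qed.

Lemma dotDl x y z : dot (x + y) z = dot x z + dot y z.
Proof. by rewrite -{1}(scale1r x) dotDZl mul1r. Qed.

Lemma dotZl c x z : dot (c *: x) z = c * dot x z.
Proof. by rewrite -[c *: x]addr0 dotDZl dot0l addr0. Qed.

Lemma dotNl x z : dot (- x) z = - dot x z.
Proof. by rewrite -scaleN1r dotZl mulN1r. Qed.

Lemma dotBl x y z : dot (x - y) z = dot x z - dot y z.
Proof. by rewrite dotDl dotNl. Qed.

Lemma dotDr x y z : dot z (x + y) = dot z x + dot z y.
Proof. by rewrite dotC dotDl rmorphD /= -!dotC. Qed.

Lemma dotZr c x z : dot z (c *: x) = c^*%R * dot z x.
Proof. by rewrite dotC dotZl rmorphM /= -dotC. Qed.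

Lemma dot0r x : dot x 0 = 0.
Proof. by rewrite dotC dot0l rmorph0. Qed.

Lemma dotNr x z : dot z (- x) = - dot z x.
Proof. by rewrite dotC dotNl rmorphN /= -dotC. Qed.

Lemma dot_suml (I : Type) (r : seq I) (P : pred I) (F : I -> H) y :
  dot (\sum_(i <- r | P i) F i) y = \sum_(i <- r | P i) dot (F i) y.
Proof.
by apply: (big_morph (fun x => dot x y)); [move=> ? ?; rewrite dotDl | rewrite dot0l].
Qed.

Lemma dot_sumr (I : Type) (r : seq I) (P : pred I) (F : I -> H) y :
  dot y (\sum_(i <- r | P i) F i) = \sum_(i <- r | P i) dot y (F i).
Proof.
by apply: (big_morph (fun x => dot y x)); [move=> ? ?; rewrite dotDr | rewrite dot0r].
Qed.

Lemma dotxx x : dot x x = (fine (sqsum x))%:C.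
Proof.
apply: dotP; split => /=.
  rewrite (_ : (fun n => _) = rowsum (nsq \o x)); first exact: nsq_cvg.
  apply/funext => n; rewrite ReS; apply: eq_bigr => j _.
  by rewrite Re_mulconj /nsq /= !expr2.
rewrite (_ : (fun n => _) = fun=> 0).
  rewrite (_ : series _ = fun=> 0); first exact: cvg_cst.
  by apply/funext => n; rewrite /series /= big1.
apply/funext => n; rewrite ImS big1 // => j _.
by rewrite Im_mulconj mulrC subrr.
Qed.

(** Estimates are made on the squared norm, which is expressed by [dot], so that no square roots
    occur. *)
Definition sqn x : R := fine (sqsum x).

Lemma sqn_ge0 x : 0 <= sqn x. Proof. exact: fine_sqsum_ge0. Qed.

Lemma nsq_le_sqn x p : nsq (x p) <= sqn x.
Proof.
apply: le_trans (nsq_le x p.1.+1).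
rewrite /series /= big_nat_recr //= -[leLHS]add0r lerD //.
  by apply: sumr_ge0 => n _; apply: rowsum_ge0 => q; exact: nsq_ge0.
by apply: (ler_rowsum p) => q /=; exact: nsq_ge0.
Qed.

Lemma sqn_eq0 x : sqn x = 0 -> x = 0.
Proof.
move=> x0; apply: l2_eq => p; apply/eqP; rewrite -nsq_eq0 eq_le nsq_ge0 andbT.
by rewrite -x0 nsq_le_sqn.
Qed.

End inner_product.

(** * Bounded, positive and adjoint operators *)

Section operators.
Context {R : realType}.
Local Notation H := (l2 R).
Implicit Types (x y z : H) (c : R[i]) (A B S T P : H -> H) (e f g : nat -> H).

Lemma sqn_dot x : sqn x = complex.Re (dot x x).
Proof. by rewrite dotxx. Qed.

Lemma sqn0 : sqn (0 : H) = 0.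
Proof. by rewrite sqn_dot dot0l. Qed.

Lemma sqnZ c x : sqn (c *: x) = nsq c * sqn x.
Proof.
rewrite sqn_dot dotZl dotZr dotxx mulrA /nsq /sqn.
by case: c => a b /=; ring.
Qed.

Lemma sqnN x : sqn (- x) = sqn x.
Proof. by rewrite -scaleN1r sqnZ nsqN /nsq /= expr0n expr1n addr0 mul1r. Qed.

(** The parallelogram law, with the term [sqn (x - y)] dropped. *)
Lemma sqnD_le x y : sqn (x + y) <= 2 * sqn x + 2 * sqn y.
Proof.
have := sqn_ge0 (x - y).
by rewrite !sqn_dot !(dotDl, dotDr, dotNl, dotNr) !(ReD, ReN); lra.
Qed.

Lemma Re_dot_le x y : complex.Re (dot x y) <= sqn x + sqn y.
Proof.
have := (sqn_ge0 (x - y), sqn_ge0 x, sqn_ge0 y); rewrite !sqn_dot.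
rewrite !(dotDl, dotDr, dotNl, dotNr) !(ReD, ReN) (dotC x y) cRe_conj.
by move=> [[]]; lra.
Qed.

Lemma sqn_l2norm x : sqn x = l2norm x ^+ 2.
Proof. by rewrite l2norm_sq. Qed.

Lemma bounded_opP T : bounded_op T <->
  linear T /\ exists2 M, 0 <= M & forall x, sqn (T x) <= M * sqn x.
Proof.
split=> [[Tlin [M MT]]|[Tlin [M M0 MT]]]; split => //.
  exists (M ^+ 2); rewrite ?sqr_ge0 // => x.
  rewrite !sqn_l2norm -exprMn ler_pXn2r ?nnegrE ?l2norm_ge0 //.
  exact: le_trans (l2norm_ge0 _) (MT x).
exists (Num.sqrt M) => x.
rewrite -(ler_pXn2r (n := 2)) ?nnegrE ?mulr_ge0 ?l2norm_ge0 ?sqrtr_ge0 //.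
by rewrite exprMn -!sqn_l2norm sqr_sqrtr.
Qed.

Section linear_maps.
Variables (T : H -> H) (Tlin : linear T).

Lemma lin0 : T 0 = 0.
Proof.
have := Tlin 1 0 0; rewrite !scale1r addr0 => /eqP.
by rewrite -subr_eq subrr eq_sym => /eqP.
Qed.

Lemma linD x y : T (x + y) = T x + T y.
Proof. by rewrite -{1}(scale1r x) Tlin scale1r. Qed.

Lemma linZ c x : T (c *: x) = c *: T x.
Proof. by rewrite -[c *: x]addr0 Tlin lin0 addr0. Qed.

Lemma linB x y : T (x - y) = T x - T y.
Proof. by rewrite linD -scaleN1r linZ scaleN1r. Qed.

Lemma lin_sum (I : Type) (r : seq I) (Q : pred I) (F : I -> H) :
  T (\sum_(i <- r | Q i) F i) = \sum_(i <- r | Q i) T (F i).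
Proof. by apply: (big_morph T); [exact: linD | exact: lin0]. Qed.

End linear_maps.

Definition qf A x : R := complex.Re (dot (A x) x).

Lemma posE c : (0 <= c) = (complex.Im c == 0) && (0 <= complex.Re c).
Proof. by case: c => a b; rewrite lecE /=. Qed.

Lemma qf_ge0 A x : positive_op A -> 0 <= qf A x.
Proof. by move=> [_ /(_ x)]; rewrite posE => /andP[]. Qed.

Lemma positive_opP A : positive_op A <->
  bounded_op A /\ forall x, complex.Im (dot (A x) x) = 0 /\ 0 <= qf A x.
Proof.
split=> -[Ab A0]; split => // x; have := A0 x; rewrite posE.
  by case/andP => /eqP.
by move=> [-> ->]; rewrite eqxx.
Qed.

Lemma qfD A B x : qf (A + B) x = qf A x + qf B x.
Proof. by rewrite /qf dotDl ReD. Qed.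

Lemma qfZ (c : R) A x : qf (c%:C *: A) x = c * qf A x.
Proof.
rewrite /qf dotZl; case: (dot _ _) => a b /=.
by rewrite mul0r subr0.
Qed.

Lemma bounded_opD S T : bounded_op S -> bounded_op T -> bounded_op (S + T).
Proof.
move=> /bounded_opP[Sl [M M0 SM]] /bounded_opP[Tl [N N0 TN]]; apply/bounded_opP; split.
  by move=> c x y /=; rewrite fctE Sl Tl scalerDr addrACA.
exists (2 * M + 2 * N); first by rewrite addr_ge0 ?mulr_ge0.
move=> x; apply: (le_trans (sqnD_le _ _)); have := (SM x, TN x) => -[]; lra.
Qed.

Lemma bounded_opZ c T : bounded_op T -> bounded_op (c *: T).
Proof.
move=> /bounded_opP[Tl [N N0 TN]]; apply/bounded_opP; split.
  move=> d x y /=; rewrite fctE Tl scalerDr !scalerA; congr (_ *: _ + _).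
  exact: mulrC.
exists (nsq c * N); first by rewrite mulr_ge0 ?nsq_ge0.
by move=> x; rewrite fctE sqnZ -mulrA ler_wpM2l ?nsq_ge0.
Qed.

Lemma bounded_op_comp S T : bounded_op S -> bounded_op T -> bounded_op (S \o T).
Proof.
move=> /bounded_opP[Sl [M M0 SM]] /bounded_opP[Tl [N N0 TN]]; apply/bounded_opP; split.
  by move=> c x y /=; rewrite Tl Sl.
exists (M * N); first by rewrite mulr_ge0.
by move=> x /=; apply: le_trans (SM _) _; rewrite -mulrA ler_wpM2l.
Qed.

Lemma positive_opD S T : positive_op S -> positive_op T -> positive_op (S + T).
Proof.
move=> [Sb S0] [Tb T0]; split; first exact: bounded_opD.
by move=> x; rewrite dotDl addr_ge0.
Qed.

Lemma positive_opZ (c : R) T : 0 <= c -> positive_op T -> positive_op (c%:C *: T).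
Proof.
move=> c0 [Tb T0]; split; first exact: bounded_opZ.
by move=> x; rewrite dotZl mulr_ge0 // lecR.
Qed.

Lemma adjoint_of_sym T S : adjoint_of T S -> adjoint_of S T.
Proof.
move=> [Tb Sb TS]; split => // x y.
by rewrite dotC -TS -dotC.
Qed.

Lemma qf_adjoint T S x : adjoint_of T S -> dot ((S \o T) x) x = (sqn (T x))%:C.
Proof.
move=> /adjoint_of_sym[_ _ ST] /=.
by rewrite ST dotxx.
Qed.

Lemma positive_adjoint T S : adjoint_of T S -> positive_op (S \o T).
Proof.
move=> TS; have [Tb Sb _] := TS; split; first exact: bounded_op_comp.
by move=> x; rewrite (qf_adjoint x TS) lecR sqn_ge0.
Qed.

End operators.

(** * Orthonormal systems and the Gram-Schmidt process *)

Section orthonormal.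
Context {R : realType}.
Local Notation H := (l2 R).
Implicit Types (x y z : H) (c : R[i]) (A B S T P : H -> H) (e f g : nat -> H).

(* Zero vectors are allowed, so that the Gram-Schmidt process keeps the length
   of a list even if its vectors are dependent. *)
Definition pon (n : nat) e : Prop := forall i j, (i < n)%N -> (j < n)%N ->
  dot (e i) (e j) = ((i == j) && (e i != 0))%:R.

(** For [e] as in [pon], this is membership in the span, encoded as being equal to one's own
    projection: no coefficients have to be chosen. *)
Definition spanned (n : nat) e x : Prop := x = \sum_(i < n) dot x (e i) *: e i.

Definition subspace (Q : set H) : Prop :=
  Q 0 /\ forall c x y, Q x -> Q y -> Q (c *: x + y).

Lemma subspace_sum Q (I : Type) (r : seq I) (c : I -> R[i]) (F : I -> H) :
  subspace Q -> (forall i, Q (F i)) -> Q (\sum_(i <- r) c i *: F i).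
Proof.
move=> [Q0 QS] QF; elim: r => [|i r IH]; rewrite ?big_nil ?big_cons //.
exact: QS.
Qed.

Lemma subspaceB Q x y : subspace Q -> Q x -> Q y -> Q (x - y).
Proof. by move=> [Q0 QS] Qx Qy; rewrite addrC -scaleN1r; apply: QS. Qed.

Lemma subspaceZ Q c x : subspace Q -> Q x -> Q (c *: x).
Proof. by move=> [Q0 QS] Qx; rewrite -[_ *: _]addr0; apply: QS. Qed.

Lemma spanned_subspace n e : subspace (spanned n e).
Proof.
split; first by rewrite /spanned big1 // => i _; rewrite dot0l scale0r.
move=> c x y xe ye; rewrite /spanned.
rewrite {1}xe {1}ye scaler_sumr -big_split /=; apply: eq_bigr => i _.
by rewrite dotDZl scalerDl scalerA.
Qed.

Section pon_theory.
Variables (n : nat) (e : nat -> H) (en : pon n e).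

Lemma pon_sqn i : (i < n)%N -> sqn (e i) = (e i != 0)%:R.
Proof.
by move=> i_n; rewrite sqn_dot en // eqxx; case: (_ != _).
Qed.

Lemma pon_sqn_le1 i : (i < n)%N -> sqn (e i) <= 1.
Proof. by move=> /pon_sqn ->; rewrite lern1 leq_b1. Qed.

Lemma dot_proj x j : (j < n)%N ->
  dot (\sum_(i < n) dot x (e i) *: e i) (e j) = dot x (e j).
Proof.
move=> jn; rewrite dot_suml (bigD1 (Ordinal jn)) //= big1 ?addr0 => [|i ij].
  rewrite dotZl en // eqxx /=; case: eqVneq => [->|_]; last by rewrite mulr1.
  by rewrite dot0r mul0r.
have /negbTE ij' : val i != j := ij.
by rewrite dotZl en // ij' mulr0.
Qed.

Lemma spanned_self i : (i < n)%N -> spanned n e (e i).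
Proof.
move=> i_n; rewrite /spanned (bigD1 (Ordinal i_n)) //= big1 ?addr0 => [|j ji].
  by rewrite en // eqxx /=; case: eqVneq => [->|_]; rewrite ?scaler0 ?scale1r.
have /negbTE ji' : val j != i := ji.
by rewrite en // eq_sym ji' scale0r.
Qed.

Lemma spanned_dot x y : spanned n e x ->
  dot x y = \sum_(i < n) dot x (e i) * dot (e i) y.
Proof. by move=> {1}->; rewrite dot_suml; apply: eq_bigr => i _; rewrite dotZl. Qed.

Lemma mul_conj c : c * (c^*)%R = (nsq c)%:C.
Proof.
by case: c => a b; apply/eqP; rewrite eq_complex /nsq /=; apply/andP; split;
  apply/eqP; ring.
Qed.

Lemma parseval x : spanned n e x -> sqn x = \sum_(i < n) nsq (dot x (e i)).
Proof.
move=> xe; rewrite sqn_dot (spanned_dot _ xe) ReS; apply: eq_bigr => i _.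
by rewrite [dot (e i) x]dotC mul_conj.
Qed.

Lemma spanned_proj x : spanned n e (\sum_(i < n) dot x (e i) *: e i).
Proof. by rewrite /spanned; apply: eq_bigr => i _; rewrite dot_proj. Qed.

Lemma proj_orth x j : (j < n)%N ->
  dot (x - \sum_(i < n) dot x (e i) *: e i) (e j) = 0.
Proof. by move=> jn; rewrite dotBl dot_proj ?subrr. Qed.

(** Pythagoras for [x = r + p], where [p] is the projection of [x] and [r] is orthogonal to it. *)
Lemma bessel x : \sum_(i < n) nsq (dot x (e i)) <= sqn x.
Proof.
set p := \sum_(i < n) dot x (e i) *: e i.
have pE : sqn p = \sum_(i < n) nsq (dot x (e i)).
  rewrite (parseval (spanned_proj x)); apply: eq_bigr => i _.
  by rewrite dot_proj.
pose r := x - p; have xE : x = r + p by rewrite subrK.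
have orth : dot p r = 0.
  rewrite (spanned_dot _ (spanned_proj x)) big1 // => i _.
  by rewrite [dot (e i) _]dotC proj_orth // rmorph0 mulr0.
rewrite -pE; clearbody r p; rewrite xE [sqn (_ + _)]sqn_dot dotDl !dotDr orth [dot r p]dotC orth.
by rewrite rmorph0 !(addr0, add0r) ReD -!sqn_dot lerDr sqn_ge0.
Qed.

End pon_theory.

(** One Gram-Schmidt step. The last clause expresses that the new system leaves no subspace
    containing [f] and [v]; it is used later both for spans and for the fixed vectors of a
    projection. *)
Lemma pon_extend1 n f v : pon n f -> exists g,
  [/\ pon n.+1 g, forall i, (i < n)%N -> g i = f i, spanned n.+1 g v
    & forall Q, subspace Q -> (forall i, (i < n)%N -> Q (f i)) -> Q v ->
        forall i, (i < n.+1)%N -> Q (g i)].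
Proof.
move=> fn; set r := v - \sum_(i < n) dot v (f i) *: f i.
pose a := Num.sqrt (sqn r).
(* If [v] is already in the span, then [r = 0] and the added vector is 0, which [pon] allows. *)
pose g i := if (i < n)%N then f i else ((a^-1)%:C *: r).
have a2 : a ^+ 2 = sqn r by rewrite sqr_sqrtr // sqn_ge0.
have a0 : (a == 0) = (r == 0).
  rewrite -sqrf_eq0 a2; apply/eqP/eqP => [/sqn_eq0 //|->]; exact: sqn0.
have rg : a%:C *: ((a^-1)%:C *: r) = r.
  rewrite scalerA -rmorphM /=; have [->|r0] := eqVneq r 0; first by rewrite scaler0.
  by rewrite divff ?scale1r // a0.
have gf i : (i < n)%N -> g i = f i by rewrite /g => ->.
have gn : g n = (a^-1)%:C *: r by rewrite /g ltnn.
have gn_orth i : (i < n)%N -> dot (g n) (f i) = 0.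
  by move=> i_n; rewrite gn dotZl proj_orth // mulr0.
have gnn : dot (g n) (g n) = (g n != 0)%:R.
  rewrite dotxx -/(sqn _) gn sqnZ nsq_real.
  have [r0|r0] := eqVneq r 0; first by rewrite r0 sqn0 mulr0 scaler0 eqxx.
  rewrite -a2 -exprMn mulVf ?a0 // expr1n scaler_eq0 (negbTE r0) orbF.
  by rewrite eq_complex /= eqxx andbT invr_eq0 a0 r0.
have gpon : pon n.+1 g.
  move=> i j; rewrite ltnS leq_eqVlt => /orP[/eqP->|i_n];
    rewrite ltnS leq_eqVlt => /orP[/eqP->|jn].
  - by rewrite gnn eqxx.
  - by rewrite (gf _ jn) gn_orth // gtn_eqF.
  - by rewrite (gf _ i_n) dotC gn_orth // rmorph0 ltn_eqF.
  - by rewrite !gf // fn.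
exists g; split => //.
  rewrite -[v](subrK (\sum_(i < n) dot v (f i) *: f i)) -/r.
  have [S0 SS] := spanned_subspace n.+1 g.
  rewrite -[r]rg; apply: (SS); first by rewrite -gn; apply: spanned_self.
  apply: subspace_sum => // i; rewrite -gf //; apply: spanned_self => //.
  exact: leqW.
move=> Q QS Qf Qv i; rewrite ltnS leq_eqVlt => /orP[/eqP->|i_n]; last by rewrite gf //; exact: Qf.
rewrite gn; apply: subspaceZ => //; apply: subspaceB => //.
by apply: subspace_sum => // j; apply: Qf.
Qed.

Lemma pon_extend n f m (v : nat -> H) : pon n f -> exists g,
  [/\ pon (n + m) g, forall i, (i < n)%N -> g i = f i,
      forall i, (i < m)%N -> spanned (n + m) g (v i)
    & forall Q, subspace Q -> (forall i, (i < n)%N -> Q (f i)) ->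
        (forall i, (i < m)%N -> Q (v i)) ->
        forall i, (i < n + m)%N -> Q (g i)].
Proof.
move=> fn; elim: m => [|m [g [gp gf gv gQ]]]; first by exists f; rewrite addn0; split.
have [h [hp hg hv hQ]] := pon_extend1 (v m) gp; exists h; rewrite addnS.
have hgs x : spanned (n + m) g x -> spanned (n + m).+1 h x.
  rewrite {1}/spanned => ->; apply: subspace_sum; first exact: spanned_subspace.
  by move=> i; rewrite -hg //; apply: spanned_self => //; exact: leqW.
split => //.
- by move=> i i_n; rewrite hg ?gf // (leq_trans i_n) // leq_addr.
- by move=> i; rewrite ltnS leq_eqVlt => /orP[/eqP-> //|im]; apply/hgs/gv.
- move=> Q QS Qf Qv; apply: hQ => //; last exact: Qv.
  by apply: gQ => // i im; apply: Qv; exact: leqW.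
Qed.

End orthonormal.

(** * Partial traces and Ky Fan sums of positive operators *)

Section ky_fan.
Context {R : realType}.
Local Notation H := (l2 R).
Implicit Types (x y z : H) (c : R[i]) (A B S T P : H -> H) (e f g : nat -> H).

Definition ptrace (n : nat) e A : R := \sum_(i < n) qf A (e i).

(* The Ky Fan sum: for compact A, the sum of the n largest eigenvalues. *)
Definition kyfan (n : nat) A : R := sup [set ptrace n e A | e in pon n].

(** The trace on a finite-dimensional subspace is independent of the basis: a double sum weighted by
    the transition coefficients [dot (g k) (f i)] is summed in both orders. *)
Lemma ptrace_basis m n f g A : linear A -> pon n f -> pon m g ->
  (forall i, (i < n)%N -> spanned m g (f i)) ->
  (forall j, (j < m)%N -> spanned n f (g j)) -> ptrace n f A = ptrace m g A.
Proof.
move=> Alin fn gm fg gf; rewrite /ptrace /qf -!ReS; congr complex.Re.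
transitivity (\sum_(i < n) \sum_(k < m) dot (g k) (f i) * dot (A (f i)) (g k)).
  apply: eq_bigr => i _; rewrite {2}(fg i (ltn_ord i)) dot_sumr.
  by apply: eq_bigr => k _; rewrite dotZr -dotC.
rewrite exchange_big /=; apply: eq_bigr => k _.
rewrite [RHS](congr1 (fun x => dot (A x) (g k)) (gf k (ltn_ord k))) lin_sum // dot_suml.
by apply: eq_bigr => i _; rewrite linZ // dotZl.
Qed.

(** Gram-Schmidt completes [f] to a system with the span of [g]; the diagonal entries that this adds
    are nonnegative. *)
Lemma ptrace_le m n f g A : positive_op A -> pon n f -> pon m g ->
  (forall i, (i < n)%N -> spanned m g (f i)) -> ptrace n f A <= ptrace m g A.
Proof.
move=> A0 fn gm fg; have [[Alin _] _] := A0.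
have [h [hp hf hg hQ]] := pon_extend m g fn.
rewrite (@ptrace_basis (n + m) m g h A) //; last first.
- apply: hQ => //; first exact: spanned_subspace.
  by move=> i; apply: spanned_self.
rewrite /ptrace big_split_ord /= -[leLHS]addr0 lerD //.
  by apply: ler_sum => i _; rewrite hf.
by apply: sumr_ge0 => i _; apply: qf_ge0.
Qed.

Lemma pon0 n : pon n (fun=> 0 : H).
Proof. by move=> i j _ _; rewrite dot0l eqxx andbF. Qed.

Lemma ptrace_bounded A : positive_op A -> exists2 M, 0 <= M &
  forall n e, pon n e -> ptrace n e A <= n%:R * M.
Proof.
move=> A0; have [/bounded_opP[_ [M M0 MA]] _] := A0.
(* [Re_dot_le] bounds a diagonal entry by [sqn (A e) + sqn e], with [sqn (A e) <= M] and
   [sqn e <= 1]. *)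
exists (M + 1); first by rewrite addr_ge0.
move=> n e en; rewrite mulr_natl -[n in leRHS]card_ord -sumr_const.
apply: ler_sum => i _; apply: le_trans (Re_dot_le _ _) _.
have e1 := pon_sqn_le1 en (ltn_ord i); apply: lerD => //.
by apply: le_trans (MA _) _; rewrite -[leRHS]mulr1 ler_wpM2l.
Qed.

Section positive.
Variables (A : H -> H) (A0 : positive_op A).

Lemma kyfan_has_sup n : has_sup [set ptrace n e A | e in pon n].
Proof.
split; first by exists (ptrace n (fun=> 0) A), (fun=> 0) => //; exact: pon0.
have [M _ hM] := ptrace_bounded A0; exists (n%:R * M) => _ [e en <-].
exact: hM.
Qed.

Lemma kyfan_ge n e : pon n e -> ptrace n e A <= kyfan n A.
Proof.
move=> en; apply: ub_le_sup; first by have [] := kyfan_has_sup n.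
by exists e.
Qed.

Lemma kyfan_le n (M : R) : (forall e, pon n e -> ptrace n e A <= M) -> kyfan n A <= M.
Proof.
move=> hM; apply: ge_sup; first by have [] := kyfan_has_sup n.
by move=> _ [e en <-]; exact: hM.
Qed.

Lemma kyfan_ge0 n : 0 <= kyfan n A.
Proof.
apply: le_trans (kyfan_ge (@pon0 n)); apply: sumr_ge0 => i _; exact: qf_ge0.
Qed.

Lemma kyfan_nd m n : (m <= n)%N -> kyfan m A <= kyfan n A.
Proof.
move=> mn; apply: kyfan_le => e em.
have [h [hp hf _ _]] := pon_extend (n - m) (fun=> 0) em.
rewrite subnKC // in hp; apply: le_trans (kyfan_ge hp).
rewrite -(subnKC mn) /ptrace big_split_ord /= -[leLHS]addr0 lerD //.
  by apply: ler_sum => i _; rewrite hf.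
by apply: sumr_ge0 => i _; apply: qf_ge0.
Qed.

End positive.

Lemma ptraceD n e A B : ptrace n e (A + B) = ptrace n e A + ptrace n e B.
Proof. by rewrite /ptrace -big_split; apply: eq_bigr => i _; rewrite qfD. Qed.

Lemma kyfanD_le n A B : positive_op A -> positive_op B ->
  kyfan n (A + B) <= kyfan n A + kyfan n B.
Proof.
move=> A0 B0; apply: kyfan_le => [|e en]; first exact: positive_opD.
by rewrite ptraceD lerD // kyfan_ge.
Qed.

(** A system for [A] and one for [B] are joined into a single system of length [n + n] whose span
    contains both; by positivity, each partial trace grows when the span does. *)
Lemma kyfanD_ge n A B : positive_op A -> positive_op B ->
  kyfan n A + kyfan n B <= kyfan (n + n) (A + B).
Proof.
move=> A0 B0; have AB0 := positive_opD A0 B0.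
rewrite -lerBrDr; apply: kyfan_le => // e en.
rewrite lerBrDr addrC -lerBrDr; apply: kyfan_le => // f fn; rewrite lerBrDr.
have [h [hp he hf _]] := pon_extend n f en.
apply: le_trans (kyfan_ge AB0 hp); rewrite ptraceD addrC; apply: lerD.
  apply: ptrace_le => // i i_n; rewrite -he //; apply: spanned_self => //.
  by rewrite (leq_trans i_n) // leq_addr.
by apply: ptrace_le => // i i_n; exact: hf.
Qed.

Lemma kyfanZ n (c : R) A : 0 <= c -> positive_op A ->
  kyfan n (c%:C *: A) = c * kyfan n A.
Proof.
have ptZ d e B : ptrace n e (d%:C *: B) = d * ptrace n e B.
  by rewrite /ptrace big_distrr; apply: eq_bigr => i _; rewrite qfZ.
have leZ d B : 0 <= d -> positive_op B -> kyfan n (d%:C *: B) <= d * kyfan n B.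
  move=> d0 B0; apply: kyfan_le => [|e en]; first exact: positive_opZ.
  by rewrite ptZ ler_wpM2l // kyfan_ge.
move=> c0 A0; apply/eqP; rewrite eq_le leZ //=.
have [->|cN0] := eqVneq c 0; first by rewrite mul0r kyfan_ge0 //; exact: positive_opZ.
have cp : 0 < c by rewrite lt_def cN0.
rewrite -ler_pdivlMl // -[A in leLHS](_ : c^-1%:C *: (c%:C *: A) = A).
  by apply: leZ; rewrite ?invr_ge0 //; exact: positive_opZ.
by rewrite scalerA -rmorphM /= mulVf // scale1r.
Qed.

(** Let [f] be an orthonormal basis of the span of the [T (e i)]. By Parseval, the left side is the
    sum of all [|<T e_i, f_j>|^2 = |<e_i, S f_j>|^2]; by Bessel, summing over [i] first leaves at
    most the sum of the [|S f_j|^2]. *)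
Lemma ptrace_adjoint_le n e T S : adjoint_of T S -> pon n e ->
  ptrace n e (S \o T) <= kyfan n (T \o S).
Proof.
move=> TS en; have ST := adjoint_of_sym TS.
have [f [fp _ fT _]] := pon_extend n (fun i => T (e i)) (@pon0 0).
rewrite add0n in fp fT; apply: le_trans (kyfan_ge (positive_adjoint ST) fp).
have -> : ptrace n e (S \o T) = \sum_(i < n) \sum_(j < n) nsq (dot (T (e i)) (f j)).
  apply: eq_bigr => i _; rewrite /qf (qf_adjoint _ TS) /=.
  by apply: parseval; apply: fT.
rewrite exchange_big /=; apply: ler_sum => j _.
rewrite /qf (qf_adjoint _ ST) /=; apply: le_trans (bessel en _).
apply: ler_sum => i _; have [_ _ ->] := TS.
by rewrite dotC /nsq cRe_conj cIm_conj sqrrN.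
Qed.

Lemma kyfan_adjoint n T S : adjoint_of T S -> kyfan n (S \o T) = kyfan n (T \o S).
Proof.
move=> TS; have ST := adjoint_of_sym TS; apply/eqP; rewrite eq_le.
by apply/andP; split; apply: kyfan_le => [|e en]; do ?[exact: positive_adjoint |
  exact: ptrace_adjoint_le].
Qed.

(** The given basis of the range is orthonormalized to [f]. By Bessel, every partial trace is at
    most the trace over [f], so that the Ky Fan sums do not grow beyond the rank [k]. *)
Lemma finite_rank_kyfan P : finite_rank_projection P ->
  positive_op P /\ exists k : nat, forall n, kyfan n P <= k%:R /\ kyfan n P <= kyfan k P.
Proof.
move=> [PP PoP [k [v [_ rP]]]].
have P0 : positive_op P by rewrite -PoP; exact: positive_adjoint.
have [Pb _ Psym] := PP; have [Plin _] := Pb.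
split => //; exists k => n.
pose w i := if insub i is Some j then v j else 0.
have Pw i : P (w i) = w i.
  rewrite /w; case: insubP => [j _ _|_]; last exact: lin0.
  have : range P (v j).
    rewrite rP; exists (fun i => (i == j)%:R) => //.
    rewrite (bigD1 j) //= eqxx scale1r big1 ?addr0 // => l /negbTE ->.
    by rewrite scale0r.
  by move=> [y _ <-]; rewrite -[in LHS]/((P \o P) y) PoP.
have [f [fp _ fw fQ]] := pon_extend k w (@pon0 0).
rewrite add0n in fp fw fQ.
have Pf i : (i < k)%N -> P (f i) = f i.
  have sub : subspace [set x | P x = x].
    split => /=; first exact: lin0.
    by move=> c x y Px Py; rewrite Plin Px Py.
  by apply: (fQ _ sub) => // j _; exact: Pw.
have sP x : spanned k f (P x).
  have : range P (P x) by exists x.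
  rewrite rP => -[c _ <-]; apply: subspace_sum; first exact: spanned_subspace.
  by move=> i; rewrite -[v i](_ : w i = _); [exact: fw | rewrite /w valK].
have trk e : pon n e -> ptrace n e P <= \sum_(j < k) sqn (f j).
  move=> en; have -> : ptrace n e P = \sum_(i < n) \sum_(j < k) nsq (dot (e i) (f j)).
    apply: eq_bigr => i _; rewrite /qf -{1}PoP (qf_adjoint _ PP) /=.
    rewrite (parseval (sP _)); apply: eq_bigr => j _.
    by rewrite Psym Pf.
  rewrite exchange_big /=; apply: ler_sum => j _; apply: le_trans (bessel en _).
  by apply: ler_sum => i _; rewrite dotC /nsq cRe_conj cIm_conj sqrrN.
split; apply: kyfan_le => // e /trk /le_trans; apply.
  rewrite -[k in leRHS]card_ord -sumr_const; apply: ler_sum => j _.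
  have := pon_sqn_le1 fp (ltn_ord j). by [].

rewrite (_ : \sum_(j < k) _ = ptrace k f P); first exact: kyfan_ge.
by apply: eq_bigr => j _; rewrite /qf Pf // -sqn_dot.
Qed.

End ky_fan.

(** * Generalized limits of sum sequences: additivity, homogeneity, vanishing on constants *)

Lemma ultra_cvg_bounded {R : realType} {T : Type} (W : set_system T) (u : T -> R) (M : R) :
  UltraFilter W -> W [set k | 0 <= u k <= M] -> cvg (u @ W).
Proof.
move=> WU uM; have uW : (u @ W) `[0, M]%classic.
  change (W (u @^-1` `[0, M])); apply: filterS uM => k /=.
  by rewrite in_itv.
have [p [_ clp]] := @segment_compact R 0 M (u @ W) _ uW.
apply/cvg_ex; exists p => U Up.
have [//|WC] := in_ultra_setVsetC (u @^-1` U) WU.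
have [x [/= xU Ux]] := clp (~` U) U WC Up.
by [].
Qed.

Section trace_of_sequences.
Context {R : realType}.
Variables (W : set_system nat) (WU : UltraFilter W) (Woo : \oo `<=` W).
Variables (b : bool) (r : nat -> nat) (w : nat -> R).
Hypothesis r_oo : forall N, \forall k \near \oo, (N <= r k)%N.
Hypothesis w_gt0 : forall k, 0 < w k.
Hypothesis w_oo : ~~ b -> w @ \oo --> +oo.
Implicit Types (s t u : nat -> R) (j k n : nat).

(** The flag [b] marks the trace class case, in which the sums are bounded. A bounded [w] could not
    make the sums of a finite rank operator negligible, but their tails vanish eventually. *)
Definition head_or_tail s k : R :=
  if b then sup (range s) - s (2 ^ r k)%N else s (2 ^ r k)%N.

Definition window j s k : R := s (2 ^ (r k + j))%N - s (2 ^ (r k - j))%N.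

(* The windows are negligible with respect to [w]: this is what makes the
   limit below additive, as doubling the argument of a Ky Fan sum has no
   effect on it. *)
Definition traceable s : Prop :=
  [/\ b -> has_ubound (range s),
      exists M, \forall k \near \oo, head_or_tail s k <= M * w k
    & forall j, window j s k / w k @[k --> \oo] --> 0].

(** The value +oo elsewhere is consistent with additivity, because [traceable_add] is an
    equivalence. *)
Definition seq_trace s : \bar R :=
  if `[< traceable s >] then (lim (head_or_tail s k / w k @[k --> W]))%:E else +oo%E.

Definition sumlike s : Prop := nondecreasing_seq s /\ forall n, 0 <= s n.

(* The relation between the Ky Fan sums of S, T and S + T. *)
Definition ky_fan_add s t u : Prop := forall n,
  [/\ s n <= u n, t n <= u n, u n <= s n + t n & s n + t n <= u (n + n)%N].

Lemma head_or_tail_ge0 s k : sumlike s -> (b -> has_ubound (range s)) ->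
  0 <= head_or_tail s k.
Proof.
move=> [snd s0] bs; rewrite /head_or_tail; case: b bs => [/(_ isT) ub|_]; last exact: s0.
by rewrite subr_ge0 ub_le_sup //; exists (2 ^ r k)%N.
Qed.

Lemma window_ge0 j s k : sumlike s -> 0 <= window j s k.
Proof.
move=> [snd _]; rewrite subr_ge0; apply: snd.
by rewrite leq_exp2l // (leq_trans (leq_subr _ _)) // leq_addr.
Qed.

Lemma window_le j j' s k : sumlike s -> (j <= j')%N -> window j s k <= window j' s k.
Proof.
move=> [snd _] jj'; apply: lerB; apply: snd; rewrite leq_exp2l //.
  by rewrite leq_add2l.
exact: leq_sub2l.
Qed.

Lemma seq_trace_cvg s : sumlike s -> traceable s ->
  cvg (head_or_tail s k / w k @[k --> W]).
Proof.
move=> sl [bs [M sM] _]; apply: (ultra_cvg_bounded (M := M)) => //.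
apply: Woo; move: sM; apply: filterS => k sM /=.
by rewrite divr_ge0 ?head_or_tail_ge0 ?(ltW (w_gt0 _)) //= ler_pdivrMr.
Qed.

(** The doubling of the argument disappears in the supremum; the two suprema on the right are
    approached at the common argument [maxn n m]. *)
Lemma sup_add s t u : sumlike s -> sumlike t -> sumlike u -> ky_fan_add s t u ->
  has_ubound (range u) -> sup (range u) = sup (range s) + sup (range t).
Proof.
move=> [snd s0] [tnd t0] [und u0] stu uub.
have [sub tub] : has_ubound (range s) /\ has_ubound (range t).
  have [M uM] := uub; split; exists M => _ [n _ <-]; have [su tu _ _] := stu n;
    by [apply: le_trans su _; apply: uM; exists n | apply: le_trans tu _; apply: uM; exists n].
have ne (v : nat -> R) : range v !=set0 by exists (v 0%N), 0%N.
apply/eqP; rewrite eq_le; apply/andP; split.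
  apply: ge_sup => // _ [n _ <-]; have [_ _ ust _] := stu n.
  by apply: le_trans ust _; apply: lerD; apply: ub_le_sup => //; exists n.
rewrite -lerBrDr; apply: ge_sup => // _ [n _ <-].
rewrite lerBrDr addrC -lerBrDr; apply: ge_sup => // _ [m _ <-].
rewrite lerBrDr addrC; have [_ _ _ ust] := stu (maxn n m).
apply: le_trans (_ : _ <= s (maxn n m) + t (maxn n m)) _.
  by apply: lerD; [apply: snd; rewrite leq_maxl | apply: tnd; rewrite leq_maxr].
by apply: le_trans ust _; apply: ub_le_sup => //; exists (maxn n m + maxn n m)%N.
Qed.

Section additivity.
Variables (s t u : nat -> R).
Hypotheses (sl : sumlike s) (tl : sumlike t) (ul : sumlike u).
Hypothesis stu : ky_fan_add s t u.

Lemma double_exp2 n : (2 ^ n + 2 ^ n)%N = (2 ^ n.+1)%N.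
Proof. by rewrite expnS mul2n addnn. Qed.

(** The lower end of the window is reached by doubling from one dyadic step below, hence the width
    [j.+1] on the right. As [j < r k], the truncated subtraction [r k - j.+1] is exact. *)
Lemma window_add_le j k : (j < r k)%N ->
  window j u k <= window j.+1 s k + window j.+1 t k.
Proof.
move=> jr; rewrite /window.
have [_ _ h1 _] := stu (2 ^ (r k + j))%N; have [_ _ _ h2] := stu (2 ^ (r k - j.+1))%N.
rewrite double_exp2 -subSn // subSS in h2.
have [snd _] := sl; have [tnd _] := tl.
have h3 : s (2 ^ (r k + j))%N <= s (2 ^ (r k + j.+1))%N.
  by apply: snd; rewrite leq_exp2l // leq_add2l.
have h4 : t (2 ^ (r k + j))%N <= t (2 ^ (r k + j.+1))%N.
  by apply: tnd; rewrite leq_exp2l // leq_add2l.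
by lra.
Qed.

Lemma window_add_ge j k : window j s k + window j t k <= window j.+1 u k.
Proof.
rewrite /window; have [und _] := ul.
have [_ _ _ h1] := stu (2 ^ (r k + j))%N; have [_ _ h2 _] := stu (2 ^ (r k - j))%N.
rewrite double_exp2 -addnS in h1.
have h3 : u (2 ^ (r k - j.+1))%N <= u (2 ^ (r k - j))%N.
  by apply: und; rewrite leq_exp2l // leq_sub2l.
by lra.
Qed.

(** With [n = 2 ^ r k], [s n + t n] lies between [u n] and [u (2 n)], whose difference is part of
    the window of width 1. The tails obey the same bound, since the totals add exactly by
    [sup_add]. *)
Lemma head_or_tail_add k : (b -> has_ubound (range u)) ->
  `|head_or_tail u k - (head_or_tail s k + head_or_tail t k)| <= window 1 u k.
Proof.
move=> bu; have [_ _ h1 h2] := stu (2 ^ r k)%N.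
rewrite double_exp2 -(addn1 (r k)) in h2; have [und _] := ul.
have h3 : u (2 ^ (r k - 1))%N <= u (2 ^ r k)%N.
  by apply: und; rewrite leq_exp2l // leq_subr.
rewrite /window /head_or_tail ler_norml; case: b bu => [/(_ isT) ub|_].
  by rewrite (sup_add sl tl ul stu ub); apply/andP; split; lra.
by apply/andP; split; lra.
Qed.

Lemma traceable_add : traceable u <-> traceable s /\ traceable t.
Proof.
have w0 k : 0 <= w k by exact: ltW.
split=> [[bu [M uM] uw]|[[bs [M sM] sw] [bt [N tN] tw]]].
- have bs : b -> has_ubound (range s).
    by move=> /bu[K uK]; exists K => _ [n _ <-]; have [h _ _ _] := stu n;
      apply: le_trans h _; apply: uK; exists n.
  have bt : b -> has_ubound (range t).
    by move=> /bu[K uK]; exists K => _ [n _ <-]; have [_ h _ _] := stu n;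
      apply: le_trans h _; apply: uK; exists n.
  (* The error in the additivity is eventually at most [w]; it accounts for the added 1 in the
     bounding constants. *)
  have w1 : \forall k \near \oo, window 1 u k <= w k.
    have /cvgr_le /(_ 1 ltr01) := uw 1%N; apply: filterS => k.
    by rewrite ler_pdivrMr // mul1r.
  have hM : \forall k \near \oo, head_or_tail s k + head_or_tail t k <= (M + 1) * w k.
    apply: filterS2 uM w1 => k uM w1; have := head_or_tail_add k bu.
    by rewrite ler_norml => /andP[h _]; rewrite mulrDl mul1r; lra.
  have hw j k : (window j s k + window j t k) / w k <= window j.+1 u k / w k.
    by rewrite ler_pM2r ?invr_gt0 // window_add_ge.
  split; split => //.
  + exists (M + 1); apply: filterS hM => k; apply: le_trans.
    by rewrite lerDl head_or_tail_ge0.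
  + move=> j; apply: (squeeze_cvgr _ (cvg_cst 0) (uw j.+1)); apply: nearW => k.
    rewrite divr_ge0 ?window_ge0 //=; apply: le_trans (hw j k).
    by rewrite ler_pM2r ?invr_gt0 // lerDl window_ge0.
  + exists (M + 1); apply: filterS hM => k; apply: le_trans.
    by rewrite lerDr head_or_tail_ge0.
  + move=> j; apply: (squeeze_cvgr _ (cvg_cst 0) (uw j.+1)); apply: nearW => k.
    rewrite divr_ge0 ?window_ge0 //=; apply: le_trans (hw j k).
    by rewrite ler_pM2r ?invr_gt0 // lerDr window_ge0.
- have bu : b -> has_ubound (range u).
    move=> bT; have [K sK] := bs bT; have [L tL] := bt bT; exists (K + L) => _ [n _ <-].
    have [_ _ h _] := stu n; apply: le_trans h _.
    by apply: lerD; [apply: sK | apply: tL]; exists n.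
  have uw j : window j u k / w k @[k --> \oo] --> 0.
    have h : window j.+1 s k / w k + window j.+1 t k / w k @[k --> \oo] --> 0.
      by rewrite -[X in _ --> X]addr0; apply: cvgD.
    apply: (squeeze_cvgr _ (cvg_cst 0) h); apply: filterS (r_oo j.+1) => k jr.
    rewrite divr_ge0 ?window_ge0 //= -mulrDl ler_pM2r ?invr_gt0 //.
    exact: window_add_le.
  split => //; exists (M + N + 1).
  have w1 : \forall k \near \oo, window 1 u k <= w k.
    have /cvgr_le /(_ 1 ltr01) := uw 1%N; apply: filterS => k.
    by rewrite ler_pdivrMr // mul1r.
  apply: filterS3 sM tN w1 => k sM tN w1; have := head_or_tail_add k bu.
  by rewrite ler_norml => /andP[_ h]; rewrite !mulrDl mul1r; lra.
Qed.

Lemma seq_trace_add : seq_trace u = (seq_trace s + seq_trace t)%E.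
Proof.
rewrite /seq_trace; have [ut|uNt] := asboolP (traceable u); last first.
  have [st|_] := asboolP (traceable s); last first.
    by rewrite addye //; case: ifP.
  have [tt|_] := asboolP (traceable t); last by rewrite addey.
  by case: uNt; apply/traceable_add.
have [st tt] := traceable_add.1 ut.
rewrite !asboolT // -EFinD; congr EFin; apply: cvg_lim => //.
have [bu _ uw] := ut.
have wW : window 1 u k / w k @[k --> W] --> 0.
  by apply: cvg_trans (uw 1%N); apply: cvg_app; exact: Woo.
have hd : (head_or_tail u k / w k
    - (head_or_tail s k / w k + head_or_tail t k / w k)) @[k --> W] --> 0.
  apply/norm_cvg0P; apply: (squeeze_cvgr _ (cvg_cst 0) wW).
  apply: nearW => k; rewrite normr_ge0 /= -mulrDl -mulrBl normrM.
  rewrite [`|(w k)^-1|]gtr0_norm ?invr_gt0 // ler_pM2r ?invr_gt0 //.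
  exact: head_or_tail_add.
rewrite -[X in _ --> X]add0r.
have -> : (fun k => head_or_tail u k / w k) = fun k =>
    (head_or_tail u k / w k - (head_or_tail s k / w k + head_or_tail t k / w k))
    + (head_or_tail s k / w k + head_or_tail t k / w k).
  by apply/funext => k; rewrite addrNK.
by apply: cvgD hd _; apply: cvgD; exact: seq_trace_cvg.
Qed.

End additivity.

Lemma sup_rangeZ c s : 0 < c -> has_ubound (range s) ->
  sup (range (fun n => c * s n)) = c * sup (range s).
Proof.
move=> c0 sub; have ne v : range (v : nat -> R) !=set0 by exists (v 0%N), 0%N.
have csub : has_ubound (range (fun n => c * s n)).
  by have [M sM] := sub; exists (c * M) => _ [n _ <-]; rewrite ler_pM2l // sM.
apply/eqP; rewrite eq_le; apply/andP; split.
  by apply: ge_sup => // _ [n _ <-]; rewrite ler_pM2l // ub_le_sup //; exists n.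
rewrite -ler_pdivlMl //; apply: ge_sup => // _ [n _ <-].
by rewrite ler_pdivlMl // ub_le_sup //; exists n.
Qed.

Lemma head_or_tailZ c s k : 0 < c -> (b -> has_ubound (range s)) ->
  head_or_tail (fun n => c * s n) k = c * head_or_tail s k.
Proof.
move=> c0; rewrite /head_or_tail; case: b => [/(_ isT) ub|//].
by rewrite sup_rangeZ // mulrBr.
Qed.

Lemma windowZ j c s k : window j (fun n => c * s n) k = c * window j s k.
Proof. by rewrite /window mulrBr. Qed.

Lemma traceableZ c s : 0 < c -> traceable s -> traceable (fun n => c * s n).
Proof.
move=> c0 [bs [M sM] sw]; split.
- move=> /bs[K sK]; exists (c * K) => _ [n _ <-]; rewrite ler_pM2l //.
  by apply: sK; exists n.
- exists (c * M); apply: filterS sM => k sM.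
  by rewrite head_or_tailZ // -mulrA ler_pM2l.
- move=> j; rewrite -[X in _ --> X](mulr0 c).
  under eq_cvg do rewrite windowZ -mulrA.
  exact: cvgMr.
Qed.

(** Such an [s] is constant from [m] on: its tails vanish eventually, and its heads stay below [s m]
    while [w] tends to infinity. *)
Lemma head_or_tail_negligible s (m : nat) : sumlike s -> (forall n, s n <= s m) ->
  traceable s /\ (head_or_tail s k / w k @[k --> \oo] --> 0).
Proof.
move=> [snd s0] sm.
have sub : has_ubound (range s) by exists (s m) => _ [n _ <-].
have sE n : (m <= n)%N -> s n = s m.
  by move=> mn; apply/eqP; rewrite eq_le sm snd.
have h0 : head_or_tail s k / w k @[k --> \oo] --> 0.
  case: (boolP b) => [bT|bF]; rewrite /head_or_tail ?bT ?(negbTE bF).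
    apply: cvg_near_cst; apply: filterS (r_oo m) => k mr.
    rewrite (_ : sup _ = s m) ?sE ?subrr ?mul0r //.
      by rewrite (leq_trans mr) // ltnW // ltn_expl.
    apply/eqP; rewrite eq_le ub_le_sup //.
    by rewrite andbT; apply: ge_sup; [exists (s m), m | move=> _ [n _ <-]].
  have wV : s m * (w k)^-1 @[k --> \oo] --> 0.
    rewrite -[X in _ --> X](mulr0 (s m)); apply: cvgMr.
    by apply/gtr0_cvgV0; [exact: nearW | exact: w_oo].
  apply: (squeeze_cvgr _ (cvg_cst 0) wV); apply: nearW => k.
  by rewrite divr_ge0 ?s0 ?(ltW (w_gt0 _)) //= ler_pM2r ?invr_gt0.
split => //; split => //.
  exists 1; have /cvgr_le /(_ 1 ltr01) := h0; apply: filterS => k.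
  by rewrite ler_pdivrMr // .
(* Once [m + j <= r k], both ends of the window lie where [s] is constant. *)
move=> j; apply: cvg_near_cst; apply: filterS (r_oo (m + j)%N) => k mr.
have h i : (m <= i)%N -> (m <= 2 ^ i)%N.
  by move=> mi; rewrite (leq_trans mi) // ltnW // ltn_expl.
rewrite /window !sE ?subrr ?mul0r //; apply: h.
  by rewrite leq_subRL ?(leq_trans (leq_addl _ _) mr) // addnC.
by apply: (leq_trans (leq_addr j _)); apply: leq_trans mr _; exact: leq_addr.
Qed.

Lemma seq_trace_negligible s (m : nat) : sumlike s -> (forall n, s n <= s m) ->
  seq_trace s = 0%E.
Proof.
move=> sl sm; have [st s0] := head_or_tail_negligible sl sm.
rewrite /seq_trace asboolT //; congr EFin; apply: cvg_lim => //.
by apply: cvg_trans s0; apply: cvg_app; exact: Woo.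
Qed.

Lemma seq_traceZ c s : 0 <= c -> sumlike s ->
  seq_trace (fun n => c * s n) = (c%:E * seq_trace s)%E.
Proof.
(* For [c = 0] the right side is 0 even if the trace of [s] is infinite, and the zero sequence is
   negligible. *)
rewrite le_eqVlt => /orP[/eqP <-|c0] sl.
  rewrite mul0e (@seq_trace_negligible _ 0%N) //.
    by split=> [m n _|n]; rewrite !mul0r.
  by move=> n; rewrite !mul0r.
rewrite /seq_trace; have [st|sNt] := asboolP (traceable s).
  rewrite asboolT; last exact: traceableZ.
  rewrite -EFinM; congr EFin; apply: cvg_lim => //.
  have [bs _ _] := st; under eq_cvg do rewrite head_or_tailZ // -mulrA.
  by apply: cvgMr; exact: seq_trace_cvg.
rewrite asboolF; first by rewrite gt0_muley ?lte_fin.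
move=> cst; apply: sNt; have := @traceableZ c^-1 _ _ cst.
rewrite invr_gt0 => /(_ c0); congr traceable; apply/funext => n.
by rewrite mulKf // gt_eqF.
Qed.

Lemma seq_trace_ge0 s : sumlike s -> (0 <= seq_trace s)%E.
Proof.
move=> sl; rewrite /seq_trace; have [st|//] := asboolP (traceable s); rewrite lee_fin.
apply: limr_ge; first exact: seq_trace_cvg.
have [bs _ _] := st.
by apply: nearW => k; rewrite divr_ge0 ?head_or_tail_ge0 ?(ltW (w_gt0 _)).
Qed.

End trace_of_sequences.

(** * From sum sequences to singular traces *)

Section singular_trace.
Context {R : realType}.
Local Notation H := (l2 R).
Implicit Types (A B S T P : H -> H).

Lemma kyfan_sumlike A : positive_op A -> sumlike (fun n => kyfan n A).
Proof. by move=> A0; split => [m n|n]; [exact: kyfan_nd | exact: kyfan_ge0]. Qed.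

Lemma kyfan_le_add n A B : positive_op A -> positive_op B -> kyfan n A <= kyfan n (A + B).
Proof.
move=> A0 B0; have AB0 := positive_opD A0 B0.
apply: kyfan_le => // e en; apply: le_trans (kyfan_ge AB0 en); rewrite ptraceD lerDl.
by apply: sumr_ge0 => i _; exact: qf_ge0.
Qed.

Lemma kyfan_ky_fan_add A B : positive_op A -> positive_op B ->
  ky_fan_add (fun n => kyfan n A) (fun n => kyfan n B) (fun n => kyfan n (A + B)).
Proof.
move=> A0 B0 n; split; [exact: kyfan_le_add | | exact: kyfanD_le | exact: kyfanD_ge].
by rewrite addrC; exact: kyfan_le_add.
Qed.

Lemma singular_trace_exists (T : H -> H) (b : bool) (r : nat -> nat) (w : nat -> R) :
  positive_op T ->
  (forall N, \forall k \near \oo, (N <= r k)%N) ->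
  (forall k, 0 < w k) -> (~~ b -> w @ \oo --> +oo) ->
  (b -> has_ubound (range (fun n => kyfan n T))) ->
  (forall k, head_or_tail b r (fun n => kyfan n T) k = w k) ->
  (forall j, window r j (fun n => kyfan n T) k / w k @[k --> \oo] --> 0) ->
  exists2 tau, singular_trace tau & tau T = 1%E.
Proof.
move=> T0 r_oo w0 w_oo bT Tw Twin.
have [W [WU Woo]] := ultraFilterLemma eventually_filter.
exists (fun A => seq_trace W b r w (fun n => kyfan n A)); last first.
  rewrite /seq_trace asboolT; last first.
    by split => //; exists 1; apply: nearW => k; rewrite Tw mul1r.
  congr EFin; apply: cvg_lim => //; under eq_cvg do rewrite Tw divff ?gt_eqF //.
  exact: cvg_cst.
split; first split.
- by move=> A A0; apply: seq_trace_ge0 => //; exact: kyfan_sumlike.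
- move=> A B A0 B0; apply: seq_trace_add => //; do ?exact: kyfan_sumlike.
    by apply: kyfan_sumlike; exact: positive_opD.
  exact: kyfan_ky_fan_add.
- move=> c A c0 A0; rewrite -seq_traceZ //; last exact: kyfan_sumlike.
  by congr seq_trace; apply/funext => n; exact: kyfanZ.
- by move=> A S AS; congr seq_trace; apply/funext => n; exact: kyfan_adjoint.
- move=> P /finite_rank_kyfan[P0 [m Pm]].
  have sm n : kyfan n P <= kyfan m P by have [] := Pm n.
  by apply: seq_trace_negligible sm => //; exact: kyfan_sumlike.
Qed.

End singular_trace.

(** * Existence of scales with negligible windows *)

Section windows.
Context {R : realType}.
Implicit Types (s v : nat -> R).

Lemma iter_growth (v : nat -> R) (i0 J : nat) (q : R) : 0 <= q ->
  (forall i, (i0 <= i)%N -> q * v i <= v (i + J)%N) ->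
  forall m, q ^+ m * v i0 <= v (i0 + J * m)%N.
Proof.
move=> q0 hv; elim=> [|m IH]; first by rewrite expr0 mul1r muln0 addn0.
rewrite exprS -mulrA mulnS addnCA addnC; apply: le_trans (hv _ _); last exact: leq_addr.
by rewrite ler_wpM2l.
Qed.

Lemma iter_decay (v : nat -> R) (i0 J : nat) (q : R) : 0 <= q ->
  (forall i, (i0 <= i)%N -> q * v (i + J)%N <= v i) ->
  forall m, q ^+ m * v (i0 + J * m)%N <= v i0.
Proof.
move=> q0 hv; elim=> [|m IH]; first by rewrite expr0 mul1r muln0 addn0.
rewrite exprSr -mulrA mulnS addnCA addnC; apply: le_trans IH.
by rewrite ler_wpM2l ?exprn_ge0 // hv // leq_addr.
Qed.

(** If all windows beyond [N] were large, [s] would be multiplied by [1 + e] every [2 j + 1] dyadic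
    steps, a geometric growth that the last hypothesis excludes. *)
Lemma small_window_growing s (j N : nat) (e : R) : sumlike s -> 0 < e -> 0 < s 1%N ->
  (forall (q c : R) i J, 1 < q -> 0 < c -> (0 < J)%N ->
     exists m, s (2 ^ (i + J * m))%N < c * q ^+ m) ->
  exists2 i, (N <= i)%N & s (2 ^ (i + j))%N - s (2 ^ (i - j))%N <= e * s (2 ^ i)%N.
Proof.
move=> [snd s0] e0 s1 sub; apply: contrapT => no.
(* The window is centred at [i + j.+1], so that its ends are [i + 1] and [i + 2 j + 1], and both its
   lower end and its centre are above [i]. *)
have hv i : (N <= i)%N -> (1 + e) * s (2 ^ i)%N <= s (2 ^ (i + (j + j).+1))%N.
  move=> Ni; have Nij : (N <= i + j.+1)%N by rewrite (leq_trans Ni) // leq_addr.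
  have h : e * s (2 ^ (i + j.+1))%N < s (2 ^ (i + j.+1 + j))%N - s (2 ^ (i + j.+1 - j))%N.
    by rewrite ltNge; apply/negP => h; apply: no; exists (i + j.+1)%N.
  have h1 : s (2 ^ i)%N <= s (2 ^ (i + j.+1))%N by apply: snd; rewrite leq_exp2l // leq_addr.
  have h2 : s (2 ^ i)%N <= s (2 ^ (i + j.+1 - j))%N.
    by apply: snd; rewrite leq_exp2l // -addnBA // leq_addr.
  have h3 : e * s (2 ^ i)%N <= e * s (2 ^ (i + j.+1))%N by rewrite ler_pM2l.
  by rewrite -addnA addSn in h; lra.
have sN : 0 < s (2 ^ N)%N by apply: lt_le_trans s1 _; apply: snd; rewrite expn_gt0.
have e1 : 1 < 1 + e by rewrite ltrDl.
have [m] := sub (1 + e) (s (2 ^ N)%N) N (j + j).+1 e1 sN isT.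
apply/negP; rewrite -leNgt mulrC.
apply: (iter_growth (v := fun i => s (2 ^ i)%N)) hv _.
by rewrite addr_ge0 // ltW.
Qed.

(** The same dichotomy for the distance [M - s]: large windows would divide it by [1 + e] every
    [2 j + 1] dyadic steps. *)
Lemma small_window_decaying s (M : R) (j N : nat) (e : R) : sumlike s -> 0 < e ->
  (forall n, s n < M) ->
  (forall (q C : R) i J, 1 < q -> (0 < J)%N ->
     exists m, C < q ^+ m * (M - s (2 ^ (i + J * m))%N)) ->
  exists2 i, (N <= i)%N & s (2 ^ (i + j))%N - s (2 ^ (i - j))%N <= e * (M - s (2 ^ i)%N).
Proof.
move=> [snd s0] e0 sM sub; apply: contrapT => no.
have hv i : (N <= i)%N -> (1 + e) * (M - s (2 ^ (i + (j + j).+1))%N) <= M - s (2 ^ i)%N.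
  move=> Ni; have Nij : (N <= i + j.+1)%N by rewrite (leq_trans Ni) // leq_addr.
  have h : e * (M - s (2 ^ (i + j.+1))%N) < s (2 ^ (i + j.+1 + j))%N - s (2 ^ (i + j.+1 - j))%N.
    by rewrite ltNge; apply/negP => h; apply: no; exists (i + j.+1)%N.
  have h1 : s (2 ^ (i + j.+1))%N <= s (2 ^ (i + j.+1 + j))%N.
    by apply: snd; rewrite leq_exp2l // leq_addr.
  have h2 : s (2 ^ i)%N <= s (2 ^ (i + j.+1 - j))%N.
    by apply: snd; rewrite leq_exp2l // -addnBA // leq_addr.
  have h3 : e * (M - s (2 ^ (i + j.+1 + j))%N) <= e * (M - s (2 ^ (i + j.+1))%N).
    by rewrite ler_pM2l // lerD2l lerN2.
  by rewrite -addnA addSn in h h3; lra.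
have e1 : 1 < 1 + e by rewrite ltrDl.
have [m] := sub (1 + e) (M - s (2 ^ N)%N) N (j + j).+1 e1 isT.
apply/negP; rewrite -leNgt.
apply: (iter_decay (v := fun i => M - s (2 ^ i)%N)) hv _.
by rewrite addr_ge0 // ltW.
Qed.

(** A diagonal choice: the [k]-th scale handles the width [k] with tolerance [1 / (k + 1)], hence
    all widths [j <= k] at once. *)
Lemma window_cvg0 s (w : nat -> R) (r : nat -> nat) : sumlike s -> (forall k, 0 < w k) ->
  (forall k, s (2 ^ (r k + k))%N - s (2 ^ (r k - k))%N <= k.+1%:R^-1 * w k) ->
  forall j, window r j s k / w k @[k --> \oo] --> 0.
Proof.
move=> sl w0 hr j; have harm : @harmonic R @ \oo --> 0 := cvg_harmonic.
apply: (squeeze_cvgr _ (cvg_cst 0) harm).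
apply: filterS (nbhs_infty_ge j) => k jk.
rewrite divr_ge0 ?window_ge0 ?(ltW (w0 _)) //= ler_pdivrMr //.
by apply: le_trans (hr k); apply: window_le.
Qed.

Lemma windows_growing s : sumlike s -> 0 < s 1%N -> (forall M, exists n, M < s n) ->
  (forall (q c : R) i J, 1 < q -> 0 < c -> (0 < J)%N ->
     exists m, s (2 ^ (i + J * m))%N < c * q ^+ m) ->
  exists r : nat -> nat, [/\ forall N, \forall k \near \oo, (N <= r k)%N,
    forall k, 0 < s (2 ^ r k)%N, (fun k => s (2 ^ r k)%N) @ \oo --> +oo
    & forall j, window r j s k / s (2 ^ r k)%N @[k --> \oo] --> 0].
Proof.
move=> sl s1 sub grow; have [snd s0] := sl.
have ex k : exists i, (k <= i)%N /\
    s (2 ^ (i + k))%N - s (2 ^ (i - k))%N <= k.+1%:R^-1 * s (2 ^ i)%N.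
  have k0 : 0 < k.+1%:R^-1 :> R by rewrite invr_gt0.
  by have [i ki hi] := small_window_growing k k sl k0 s1 grow; exists i.
have [r hr] := choice ex.
have rk k : (k <= r k)%N by have [] := hr k.
have w0 k : 0 < s (2 ^ r k)%N by apply: lt_le_trans s1 _; apply: snd; rewrite expn_gt0.
exists r; split => //.
- by move=> N; apply: filterS (nbhs_infty_ge N) => k Nk; exact: leq_trans (rk k).
- apply/cvgryPge => M; have [n Mn] := sub M.
  apply: filterS (nbhs_infty_ge n) => k nk; apply: le_trans (ltW Mn) _; apply: snd.
  by rewrite (leq_trans nk) // (leq_trans (rk k)) // ltnW // ltn_expl.
- by apply: window_cvg0 => // k; have [] := hr k.
Qed.

Lemma windows_decaying s (M : R) : sumlike s -> (forall n, s n < M) ->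
  (forall (q C : R) i J, 1 < q -> (0 < J)%N ->
     exists m, C < q ^+ m * (M - s (2 ^ (i + J * m))%N)) ->
  exists r : nat -> nat, [/\ forall N, \forall k \near \oo, (N <= r k)%N,
    forall k, 0 < M - s (2 ^ r k)%N
    & forall j, window r j s k / (M - s (2 ^ r k)%N) @[k --> \oo] --> 0].
Proof.
move=> sl sM decay.
have ex k : exists i, (k <= i)%N /\
    s (2 ^ (i + k))%N - s (2 ^ (i - k))%N <= k.+1%:R^-1 * (M - s (2 ^ i)%N).
  have k0 : 0 < k.+1%:R^-1 :> R by rewrite invr_gt0.
  by have [i ki hi] := small_window_decaying k k sl k0 sM decay; exists i.
have [r hr] := choice ex.
have rk k : (k <= r k)%N by have [] := hr k.
have w0 k : 0 < M - s (2 ^ r k)%N by rewrite subr_gt0.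
exists r; split => //.
- by move=> N; apply: filterS (nbhs_infty_ge N) => k Nk; exact: leq_trans (rk k).
- by apply: window_cvg0 => // k; have [] := hr k.
Qed.

End windows.

(** * Diagonal operators and bounds for their Ky Fan sums *)

Section diagonal_operators.
Context {R : realType}.
Local Notation H := (l2 R).
Local Notation index := (nat * 'I_2)%type.
Implicit Types (x y : H) (p q : index) (c : index -> R[i]) (t u : index -> R).

Lemma series_rowsum_le (g h : index -> R) N : (forall p, g p <= h p) ->
  series (rowsum g) N <= series (rowsum h) N.
Proof. by move=> gh; apply: ler_sum => n _; apply: ler_sum => j _. Qed.

Lemma series_rowsumD (g h : index -> R) N :
  series (rowsum (fun p => g p + h p)) N = series (rowsum g) N + series (rowsum h) N.
Proof.
by rewrite /series /= -big_split; apply: eq_bigr => n _; rewrite /rowsum big_split.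
Qed.

Lemma series_rowsumM (a : R) (g : index -> R) N :
  series (rowsum (fun p => a * g p)) N = a * series (rowsum g) N.
Proof.
by rewrite /series /= big_distrr; apply: eq_bigr => n _; rewrite /rowsum big_distrr.
Qed.

Lemma series_rowsum_sum m (g : nat -> index -> R) N :
  series (rowsum (fun p => \sum_(i < m) g i p)) N = \sum_(i < m) series (rowsum (g i)) N.
Proof.
rewrite /series /= [RHS]exchange_big; apply: eq_bigr => n _ /=.
by rewrite /rowsum exchange_big.
Qed.

Lemma series_rowsum_ge0 (g : index -> R) N : (forall p, 0 <= g p) ->
  0 <= series (rowsum g) N.
Proof. by move=> g0; apply: sumr_ge0 => n _; apply: rowsum_ge0. Qed.

Lemma rowsum_delta p n : rowsum (fun q => (q == p)%:R : R) n = (n == p.1)%:R.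
Proof.
case: p => m i; rewrite /rowsum /=; case: eqVneq => [->|nm].
  rewrite (bigD1 i) //= eqxx big1 ?addr0 // => j /negbTE ji.
  by rewrite xpair_eqE ji andbF.
by rewrite big1 // => j _; rewrite xpair_eqE (negbTE nm).
Qed.

Lemma delta_subproof p : (fun q => (q == p)%:R) \in @l2_pred R.
Proof.
apply: (@in_l2 _ _ 1) => N.
have -> : nsq \o (fun q => (q == p)%:R) = (fun q => (q == p)%:R) :> (index -> R).
  by apply/funext => q /=; case: eqP => _; rewrite /nsq /= ?expr1n ?expr0n ?addr0.
rewrite /series /= (eq_bigr (fun n => (n == p.1)%:R)) => [|n _]; last exact: rowsum_delta.
case: (ltnP p.1 N) => pN; last first.
  rewrite big_nat_cond big1 ?ler01 // => n /andP[/andP[_ nN] _].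
  by rewrite ltn_eqF // (leq_trans nN).
rewrite (bigD1_seq p.1) ?mem_index_iota ?iota_uniq //= eqxx big1 ?addr0 //.
by move=> n /negbTE ->.
Qed.

Definition delta p : H := L2 (delta_subproof p).

Lemma deltaE p q : delta p q = (q == p)%:R. Proof. by []. Qed.

Lemma dot_delta x p : dot x (delta p) = x p.
Proof.
have dE n : dterm x (delta p) n = if n == p.1 then x p else 0.
  case: p => m i; rewrite /dterm /=; case: eqVneq => [->|nm].
    rewrite (bigD1 i) //= eqxx rmorph1 mulr1 big1 ?addr0 // => j /negbTE ji.
    by rewrite xpair_eqE ji andbF rmorph0 mulr0.
  by rewrite big1 // => j _; rewrite xpair_eqE (negbTE nm) rmorph0 mulr0.
have cv (f : R[i] -> R) : f 0 = 0 ->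
    series (fun n => f (dterm x (delta p) n)) @ \oo --> f (x p).
  move=> f0; apply: cvg_near_cst; apply: filterS (nbhs_infty_gt p.1) => N pN.
  rewrite /series /= (bigD1_seq p.1) ?mem_index_iota ?iota_uniq //=.
  rewrite dE eqxx big1 ?addr0 // => n /negbTE np.
  by rewrite dE np f0.
by apply: dotP; split; apply: cv.
Qed.

Lemma delta_dot x p : dot (delta p) x = (x p)^*%R.
Proof. by rewrite dotC dot_delta. Qed.

Lemma dot_deltaE p q : dot (delta p) (delta q) = (q == p)%:R.
Proof. by rewrite dot_delta deltaE. Qed.

Lemma sqn_delta p : sqn (delta p) = 1.
Proof. by rewrite sqn_dot dot_deltaE eqxx. Qed.

Lemma delta_neq0 p : delta p != 0.
Proof.
by apply/eqP => d0; have := sqn_delta p; rewrite d0 sqn0 => /eqP; rewrite eq_sym oner_eq0.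
Qed.

Definition diagop c x : H := insubd 0 (fun p => c p * x p).

Lemma diagopE c (M : R) x p : (forall q, nsq (c q) <= M) -> diagop c x p = c p * x p.
Proof.
move=> cM; rewrite /diagop /insubd insubT //=.
apply: (@in_l2 _ _ (M * sqn x)) => N.
apply: le_trans (_ : M * series (rowsum (nsq \o x)) N <= _).
  rewrite -series_rowsumM; apply: series_rowsum_le => q /=.
  by rewrite nsqM ler_wpM2r // nsq_ge0.
by rewrite ler_wpM2l ?nsq_le // (le_trans (nsq_ge0 (c p))).
Qed.

Lemma diagop_bounded c (M : R) : (forall q, nsq (c q) <= M) -> bounded_op (diagop c).
Proof.
move=> cM; have M0 : 0 <= M := le_trans (nsq_ge0 _) (cM (0%N, ord0)).
apply/bounded_opP; split.
  move=> a x y; apply: l2_eq => p; rewrite l2addE l2scaleE !(diagopE _ _ cM) l2addE l2scaleE.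
  by rewrite mulrDr !mulrA [a * _]mulrC.
exists M => // x; apply: sqsum_le => N.
apply: le_trans (_ : M * series (rowsum (nsq \o x)) N <= _).
  rewrite -series_rowsumM; apply: series_rowsum_le => q /=.
  by rewrite (diagopE _ _ cM) nsqM ler_wpM2r // nsq_ge0.
by rewrite ler_wpM2l // nsq_le.
Qed.

Definition rdiag t : H -> H := diagop (fun p => (t p)%:C).

Definition bounded_coef t : Prop := exists M, forall p, 0 <= t p <= M.

Lemma nsq_bounded_coef t (M : R) : (forall p, 0 <= t p <= M) ->
  forall p, nsq ((t p)%:C) <= M ^+ 2.
Proof.
move=> tM p; have /andP[t0 tM'] := tM p.
by rewrite nsq_real ler_pXn2r // nnegrE // (le_trans t0).
Qed.

Lemma rdiagE t x p : bounded_coef t -> rdiag t x p = (t p)%:C * x p.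
Proof. by move=> [M tM]; exact: diagopE (nsq_bounded_coef tM). Qed.

Lemma dot_rdiag t x : bounded_coef t ->
  complex.Im (dot (rdiag t x) x) = 0 /\
  series (rowsum (fun p => t p * nsq (x p))) @ \oo --> qf (rdiag t) x.
Proof.
move=> tb; have [h1 h2] := dot_csum (rdiag t x) x.
have dE n : dterm (rdiag t x) x n = (rowsum (fun p => t p * nsq (x p)) n)%:C.
  rewrite /dterm /rowsum rmorph_sum /=; apply: eq_bigr => j _.
  by rewrite rdiagE // -mulrA mul_conj -rmorphM.
split.
  rewrite -(cvg_lim _ h2) //; apply/cvg_lim => //.
  apply: cvg_near_cst; apply: nearW => n.
  by rewrite /series /= big1 // => k _; rewrite dE.
have -> // : rowsum (fun p => t p * nsq (x p)) =
  fun n => complex.Re (dterm (rdiag t x) x n).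
by apply/funext => n; rewrite dE.
Qed.

Lemma rdiag_positive t : bounded_coef t -> positive_op (rdiag t).
Proof.
move=> tb; have [M tM] := tb; apply/positive_opP; split.
  exact: diagop_bounded (nsq_bounded_coef tM).
move=> x; have [im0 cv] := dot_rdiag x tb; split => //.
rewrite -(cvg_lim _ cv) //; apply: limr_ge; first by apply/cvg_ex; eexists; exact: cv.
apply: nearW => N; apply: series_rowsum_ge0 => p.
by rewrite mulr_ge0 ?nsq_ge0 //; have /andP[] := tM p.
Qed.

Lemma rdiag_adjoint t : bounded_coef t -> adjoint_of (rdiag t) (rdiag t).
Proof.
move=> tb; have [rb _] := rdiag_positive tb; split => // x y.
apply: dotP; have := dot_csum x (rdiag t y).
congr csum_to; apply/funext => n; apply: eq_bigr => j _.
rewrite !rdiagE // rmorphM /= mulrCA mulrA; congr (_ * _ * _).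
by apply/eqP; rewrite eq_complex /= oppr0 !eqxx.
Qed.

Lemma pon_mass_le1 n e p : pon n e -> \sum_(i < n) nsq ((e i : H) p) <= 1.
Proof.
move=> en; rewrite -(sqn_delta p); apply: le_trans (bessel en _).
by apply: ler_sum => i _; rewrite delta_dot /nsq cRe_conj cIm_conj sqrrN.
Qed.

Lemma pon_mass_le n e N : pon n e ->
  series (rowsum (fun p => \sum_(i < n) nsq ((e i : H) p))) N <= n%:R.
Proof.
move=> en; rewrite (series_rowsum_sum _ (fun i p => nsq (e i p))).
rewrite -[n in leRHS]card_ord -sumr_const; apply: ler_sum => i _.
apply: le_trans (nsq_le (e i) N) _.
have := pon_sqn_le1 en (ltn_ord i); by [].
Qed.

Lemma ptrace_rdiag_le t n (e : nat -> H) (K : R) : bounded_coef t ->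
  (\forall N \near \oo,
    series (rowsum (fun p => t p * \sum_(i < n) nsq ((e i : H) p))) N <= K) ->
  ptrace n e (rdiag t) <= K.
Proof.
move=> tb hK.
have cv : series (rowsum (fun p => t p * \sum_(i < n) nsq (e i p))) @ \oo
    --> ptrace n e (rdiag t).
  have -> : series (rowsum (fun p => t p * \sum_(i < n) nsq (e i p))) =
      fun N => \sum_(i < n) series (rowsum (fun p => t p * nsq (e i p))) N.
    apply/funext => N; rewrite -(series_rowsum_sum _ (fun i p => t p * nsq (e i p))).
    by congr (series (rowsum _) N); apply/funext => p; rewrite big_distrr.
  by apply: cvg_big => [|i _]; [exact: add_continuous | have [] := dot_rdiag (e i) tb].
by rewrite -(cvg_lim _ cv) //; apply: limr_le => //; apply/cvg_ex; eexists; exact: cv.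
Qed.

(** The mass that [n] orthonormal vectors put on a coordinate is at most 1, and at most [n] in
    total. Hence the level [l] is paid at most [n] times, and the excess [u] once per coordinate. *)
Lemma kyfan_rdiag_le t u (l U : R) n : bounded_coef t -> 0 <= l ->
  (forall p, 0 <= u p) -> (forall p, t p <= l + u p) ->
  (forall N, series (rowsum u) N <= U) -> kyfan n (rdiag t) <= l * n%:R + U.
Proof.
move=> tb l0 u0 tlu uU; apply: kyfan_le => [|e en]; first exact: rdiag_positive.
apply: ptrace_rdiag_le => //; apply: nearW => N.
apply: le_trans (_ : l * series (rowsum (fun p => \sum_(i < n) nsq (e i p))) N
  + series (rowsum u) N <= _); last first.
  by apply: lerD => //; rewrite ler_wpM2l // pon_mass_le.
rewrite -series_rowsumM -series_rowsumD; apply: series_rowsum_le => p.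
have m0 : 0 <= \sum_(i < n) nsq (e i p) by apply: sumr_ge0 => i _; exact: nsq_ge0.
have m1 := pon_mass_le1 p en; have := tlu p; have := u0 p; nra.
Qed.

(** Enumerates the basis row by row, so that the first [M.*2] indices are exactly the first [M]
    rows. *)
Definition index_of (i : nat) : index := (i./2, inord (i %% 2)).

Lemma index_of_inj : injective index_of.
Proof.
move=> i j [ij /(congr1 val)]; rewrite /= !inordK ?ltn_pmod //.
by rewrite !modn2 => oij; rewrite -(odd_double_half i) -(odd_double_half j) ij oij.
Qed.

Lemma pon_delta n : pon n (fun i => delta (index_of i)).
Proof.
move=> i j _ _; rewrite dot_deltaE delta_neq0 andbT eq_sym.
by rewrite (inj_eq index_of_inj).
Qed.

Lemma kyfan_rdiag_ge t M : bounded_coef t ->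
  series (rowsum t) M <= kyfan M.*2 (rdiag t).
Proof.
move=> tb; apply: le_trans (kyfan_ge (rdiag_positive tb) (@pon_delta _)).
have qE i : qf (rdiag t) (delta i) = t i.
  by rewrite /qf dot_delta rdiagE // deltaE eqxx mulr1.
rewrite /ptrace; under eq_bigr do rewrite qE.
rewrite -(big_mkord xpredT (t \o index_of)); elim: M => [|M IH].
  by rewrite /series /= !big_geq.
have h0 : index_of M.*2 = (M, ord0).
  rewrite /index_of doubleK; congr (_, _).
  by apply: val_inj; rewrite /= inordK ?ltn_pmod // -muln2 modnMl.
have h1 : index_of M.*2.+1 = (M, ord_max).
  rewrite /index_of -[_./2]/(uphalf M.*2) uphalf_double; congr (_, _).
  by apply: val_inj; rewrite /= inordK ?ltn_pmod // -addn1 -muln2 modnMDl.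
rewrite doubleS !big_nat_recr // /series /= big_nat_recr //= -addrA h0 h1.
apply: lerD => //; rewrite /rowsum !big_ord_recr big_ord0 /= add0r.
by rewrite (_ : widen_ord _ _ = ord0) //; apply: val_inj.
Qed.

Lemma kyfan_rdiag_tail t (l : R) n M : bounded_coef t -> 0 <= l ->
  has_ubound (range (fun n => kyfan n (rdiag t))) ->
  l * (series (rowsum (fun p => (l < t p)%R%:R)) M - n%:R)
    <= sup (range (fun n => kyfan n (rdiag t))) - kyfan n (rdiag t).
Proof.
move=> tb l0 ub; set Tr := sup _; have [K tK] := tb.
have TrN N : series (rowsum t) N <= Tr.
  by apply: le_trans (kyfan_rdiag_ge N tb) _; apply: ub_le_sup => //; exists N.*2.
rewrite lerBrDr -lerBrDl; apply: kyfan_le => [|e en]; first exact: rdiag_positive.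
apply: ptrace_rdiag_le => //; apply: filterS (nbhs_infty_ge M) => N MN.
pose m p := \sum_(i < n) nsq (e i p).
have m0 p : 0 <= m p by apply: sumr_ge0 => i _; exact: nsq_ge0.
have m1 p : m p <= 1 by exact: pon_mass_le1.
have hp p : t p * m p + l * (l < t p)%R%:R <= t p + l * m p.
  have /andP[t0 _] := tK p; have := m0 p; have := m1 p.
  by case: (ltP l (t p)) => lt /=; nra.
have := series_rowsum_le N hp.
rewrite !series_rowsumD !series_rowsumM -/m.
have h1 := TrN N; have h2 := pon_mass_le N en.
have h3 : l * series (rowsum m) N <= l * n%:R by rewrite ler_wpM2l.
have h4 : l * series (rowsum (fun p => (l < t p)%R%:R)) M
    <= l * series (rowsum (fun p => (l < t p)%R%:R)) N.
  rewrite ler_wpM2l //; apply: series_nd => // k.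
  exact: rowsum_ge0.
by lra.
Qed.

End diagonal_operators.

(** * Diagonal form of the powers of the Dirac operator *)

Section dirac_blocks.
Context {R : realType}.
Local Notation H := (l2 R).
Local Notation index := (nat * 'I_2)%type.
Implicit Types (a b : nat -> R).

Lemma dirsum_diag (A : nat -> 'M[R[i]]_2) (c : index -> R[i]) :
  (forall n i j, A n i j = c (n, i) *+ (i == j)) -> dirsum A = diagop c.
Proof.
move=> Ac; apply/funext => x; rewrite /dirsum /diagop; congr insubd.
apply/funext => -[n i] /=; rewrite (bigD1 i) //= Ac eqxx mulr1n.
by rewrite big1 ?addr0 // => j /negbTE ji; rewrite Ac eq_sym ji mul0r.
Qed.

Lemma dirac_intervalE (u v : R) i j :
  dirac_interval u v i j = ((v - u)^-1)%:C *+ (i != j).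
Proof. by rewrite !mxE; case: (i != j); rewrite ?mulr1 ?mulr0. Qed.

Lemma dirac_interval_sq (u v : R) :
  dirac_interval u v *m dirac_interval u v = (((v - u)^-1) ^+ 2)%:C%:M.
Proof.
apply/matrixP => i j; rewrite !mxE big_ord_recl big_ord1 !dirac_intervalE rmorphXn /=.
by case: i => -[|[|]] // ?; case: j => -[|[|]] // ?; rewrite /= ?(mulr0, mul0r, addr0, add0r).
Qed.

Lemma dirac_interval_normal (u v : R) : dirac_interval u v \is normalmx.
Proof.
apply/normalmxP; set A := dirac_interval u v; suff -> : (A ^t* )%sesqui = A by [].
apply/matrixP => i j; rewrite !mxE eq_sym rmorphM /=; congr (_ * _).
  by apply/eqP; rewrite eq_complex /= oppr0 !eqxx.
by case: (i != j); rewrite ?rmorph1 ?rmorph0.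
Qed.

(* The eigenvalues of a block are both of modulus 1 / (v - u), as its square is
   the scalar 1 / (v - u)^2. *)
Lemma mxfun_dirac (u v s : R) : u < v ->
  mxfun (fun z => (normc z `^ (- s))%:C) (dirac_interval u v) = ((v - u) `^ s)%:C%:M.
Proof.
move=> uv; have l0 : 0 < v - u by rewrite subr_gt0.
set A := dirac_interval u v; rewrite /mxfun.
have := orthomx_spectralP (dirac_interval_normal u v); rewrite -/A /=.
set P := spectralmx A; set d := spectral_diag A => AE.
have Pu : P \in unitmx by exact: spectral_unit.
have dd : diag_mx d *m diag_mx d = (((v - u)^-1) ^+ 2)%:C%:M.
  have PA : diag_mx d = P *m A *m invmx P.
    by rewrite AE !mulmxA mulmxV // mul1mx -mulmxA mulmxV // mulmx1.
  rewrite PA -!mulmxA (mulmxA (invmx P)) mulVmx // mul1mx (mulmxA A).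
  by rewrite dirac_interval_sq mul_scalar_mx -scalemxAr mulmxV // scalemx1.
have dE j : normc (d 0 j) = (v - u)^-1.
  have := congr1 (fun M : 'M[R[i]]_2 => M j j) dd; rewrite mulmx_diag !mxE eqxx mulr1n => dj.
  have : normc (d 0 j) ^+ 2 = ((v - u)^-1) ^+ 2.
    rewrite expr2 -normcM dj /= expr0n /= addr0 sqrtr_sqr ger0_norm //.
    by rewrite sqr_ge0.
  have n0 : 0 <= normc (d 0 j) by case: (d 0 j) => x y; exact: sqrtr_ge0.
  have i0 : 0 <= (v - u)^-1 by rewrite invr_ge0 ltW.
  by move=> /eqP; rewrite (eqrXn2 _ n0 i0) // => /eqP.
have -> : diag_mx (map_mx (fun z => (normc z `^ (- s))%:C) d) = ((v - u) `^ s)%:C%:M.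
  apply/matrixP => i j; rewrite !mxE dE; congr (_ *+ _).
  congr (_%:C); rewrite -powR_inv1 ?ltW // -powRrM mulN1r opprK //.
by rewrite -mulmxA mul_scalar_mx -scalemxAr mulVmx // scalemx1.
Qed.

Definition len a b (n : nat) : R := b n - a n.

Definition len_pow a b (s : R) (p : index) : R := len a b p.1 `^ s.

Lemma abs_dirac_powE a b s : (forall n, a n < b n) ->
  abs_dirac_pow a b s = rdiag (len_pow a b s).
Proof.
move=> ab; apply: dirsum_diag => n i j.
by rewrite /dirac_blocks mxfun_dirac // !mxE.
Qed.

Definition endpoint a b (p : index) : R := if p.2 == 0 then a p.1 else b p.1.

Lemma mul_opE a b f : mul_op a b f = diagop (f \o endpoint a b).
Proof.
apply: dirsum_diag => n i j; rewrite !mxE /endpoint /=.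
by case: eqP.
Qed.

End dirac_blocks.

(** * Counting functions and convergence of power series of lengths *)

Section exponents.
Context {R : realType}.
Implicit Types (l : nat -> R) (al be ga : R).

Lemma expr_unbounded (q A : R) : 1 < q -> exists m, A < q ^+ m.
Proof.
move=> q1; have q0 : 0 < q by exact: lt_trans q1.
have : geometric A q^-1 @ \oo --> 0.
  by apply: cvg_geometric; rewrite gtr0_norm ?invr_gt0 // invf_lt1.
move=> /cvgr_lt /(_ 1 ltr01) [m _ /(_ m (leqnn m))] /=.
by rewrite exprVn ltr_pdivrMr ?exprn_gt0 // mul1r; exists m.
Qed.

Definition summable_pow l al : Prop :=
  exists C, forall N, series (fun n => l n `^ al) N <= C.

Definition count_gt l (x : R) (N : nat) : R := series (fun n => (x < l n)%R%:R) N.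

(** [l] belongs to the weak sequence space of exponent [al]. *)
Definition count_bound l al : Prop :=
  exists C, forall x, 0 < x -> forall N, count_gt l x N <= C * x `^ (- al).

Lemma count_gt_ge0 l x N : 0 <= count_gt l x N.
Proof. by apply: sumr_ge0. Qed.

Lemma half_powR_lt1 (e : R) : 0 < e -> 0 < (2^-1 : R) `^ e < 1.
Proof.
move=> e0; rewrite powR_gt0 ?invr_gt0 //=.
rewrite -[X in _ < X](_ : 1 `^ e = 1); last by rewrite powR1.
apply: gt0_ltr_powR; rewrite ?nnegrE ?invr_ge0 //.
by rewrite invf_lt1 // ltr1n.
Qed.

Lemma dyadic_level (L x : R) : 0 < x -> x <= L ->
  exists k, L * 2^-1 ^+ k.+1 < x <= L * 2^-1 ^+ k.
Proof.
move=> x0 xL; have L0 : 0 < L by exact: lt_le_trans xL.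
have ex : exists k, L * 2^-1 ^+ k < x.
  have [m] := @expr_unbounded 2 (L / x) (ltr1n _ 2).
  by rewrite ltr_pdivrMr // => h; exists m; rewrite exprVn ltr_pdivrMr ?exprn_gt0 // mulrC.
have := ex_minnP ex; case: ex_minnP => -[|k] hk kmin _.
  by move: hk; rewrite expr0 mulr1 ltNge xL.
exists k; rewrite hk /= leNgt; apply/negP => /kmin; by rewrite ltnn.
Qed.

(** The terms are grouped by the dyadic levels [q i = L / 2 ^ i]. The count of the terms above
    [q i.+1], times [q i ^ be], decays geometrically in [i]. *)
Lemma count_summable_pow l (L : R) al be : 0 <= al -> al < be ->
  (forall n, 0 < l n <= L) -> count_bound l al -> summable_pow l be.
Proof.
move=> al0 albe lL [C cC].
have L0 : 0 < L by have /andP[h1 h2] := lL 0%N; exact: lt_le_trans h2.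
have C0 : 0 <= C.
  have := cC 1 ltr01 0%N; rewrite powR1 mulr1; apply: le_trans; exact: count_gt_ge0.
have ex n : exists k, L * 2^-1 ^+ k.+1 < l n <= L * 2^-1 ^+ k.
  by have /andP[h1 h2] := lL n; exact: dyadic_level.
have [k hk] := choice ex.
pose q i : R := L * 2^-1 ^+ i.
have q0 i : 0 < q i by rewrite mulr_gt0 // exprn_gt0 // invr_gt0.
set z : R := 2^-1 `^ (be - al).
have /andP[z0 z1] : 0 < z < 1 by apply: half_powR_lt1; rewrite subr_gt0.
(* Level [i] contributes at most [q_i ^ be C q_{i+1} ^ (- al) = A z ^ i]; the power of 2 comes from
   [q_{i+1} = q_i / 2]. *)
pose A := C * (L `^ (be - al) * 2 `^ al).
have A0 : 0 <= A by rewrite !mulr_ge0 ?powR_ge0.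
exists (A * (1 - z)^-1) => N.
have [K hK] : exists K, forall n, (n < N)%N -> (k n < K)%N.
  exists (\max_(n < N) k n).+1 => n nN.
  by rewrite ltnS (leq_bigmax (Ordinal nN)).
apply: le_trans (_ : series (geometric A z) K <= _); last first.
  by apply: geometric_le_lim => //; rewrite gtr0_norm.
apply: le_trans (_ : \sum_(0 <= i < K) q i `^ be * count_gt l (q i.+1) N <= _); last first.
  apply: ler_sum => i _; rewrite /geometric.
  apply: le_trans (_ : q i `^ be * (C * q i.+1 `^ (- al)) <= _).
    by rewrite ler_wpM2l ?powR_ge0 //; exact: cC.
  rewrite le_eqVlt; apply/orP; left; apply/eqP.
  have -> : q i.+1 = q i * 2^-1 by rewrite /q exprSr mulrA.
  rewrite powRM ?invr_ge0 ?(ltW (q0 _)) // [2^-1 `^ (- al)](_ : _ = 2 `^ al); last first.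
    by rewrite -powR_inv1 // -powRrM mulN1r opprK.
  have E1 : q i `^ be * q i `^ (- al) = q i `^ (be - al).
    by rewrite -powRD // (gt_eqF (q0 i)) implybT.
  have E2 : q i `^ (be - al) = L `^ (be - al) * z ^+ i.
    rewrite /q powRM ?(ltW L0) ?exprn_ge0 ?invr_ge0 //; congr (_ * _).
    by rewrite -[2^-1 ^+ i]powR_mulrn ?invr_ge0 // powRAC -/z powR_mulrn ?ltW.
  rewrite mulrCA (mulrA (q i `^ be)) E1 E2 /A /=; clearbody z.
  ring.
rewrite /count_gt /series /=.
under [leRHS]eq_bigr do rewrite big_distrr /=.
rewrite exchange_big /= big_nat_cond [leRHS]big_nat_cond.
apply: ler_sum => n /andP[/andP[_ nN] _].
have := hK n nN; have /andP[h1 h2] := hk n => kK.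
rewrite (bigD1_seq (k n)) ?mem_index_iota ?iota_uniq //= h1 mulr1 -[leLHS]addr0.
apply: lerD; last by apply: sumr_ge0 => i _; rewrite mulr_ge0 // powR_ge0.
have /andP[l0 _] := lL n.
by rewrite ge0_ler_powR ?nnegrE ?(ltW l0) ?(ltW (q0 _)) // (le_trans al0) // ltW.
Qed.

End exponents.

(** * A singular trace at the critical exponent *)

Section critical_exponent.
Context {R : realType}.
Local Notation H := (l2 R).
Local Notation index := (nat * 'I_2)%type.
Variables (l : nat -> R) (L d : R).
Hypotheses (lL : forall n, 0 < l n <= L) (d0 : 0 < d).

Let t (p : index) : R := l p.1 `^ d.
Let s (n : nat) : R := kyfan n (rdiag t).

Let l0 n : 0 < l n. Proof. by have /andP[] := lL n. Qed.
Let L0 : 0 < L. Proof. by have /andP[h1 h2] := lL 0%N; exact: lt_le_trans h2. Qed.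

Let t0 p : 0 < t p. Proof. exact: powR_gt0. Qed.

Let tb : bounded_coef t.
Proof.
exists (L `^ d) => p; rewrite ltW //=.
have /andP[_ h] := lL p.1.
by apply: ge0_ler_powR => //; rewrite ?nnegrE ltW.
Qed.

Let sl : sumlike s. Proof. by apply: kyfan_sumlike; exact: rdiag_positive. Qed.

Lemma series_rowsum_const (g : nat -> R) N :
  series (rowsum (fun p => g p.1)) N = 2 * series g N.
Proof.
rewrite /series /= big_distrr; apply: eq_bigr => n _.
by rewrite /rowsum big_ord_recl big_ord1 /= mulr_natl mulr2n.
Qed.

(** Turns a factor [q] per [J] doublings of the argument into a power law of exponent [k]. *)
Lemma root_exponent (q : R) (J : nat) : 1 < q -> (0 < J)%N ->
  exists2 k : R, 0 < k & ((2 ^ J)%:R : R) `^ k = q.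
Proof.
move=> q1 J0; have J1 : 1 < (2 ^ J)%:R :> R by rewrite ltr1n -[1%N](expn0 2) ltn_exp2l.
exists (ln q / ln (2 ^ J)%:R); first by rewrite divr_gt0 // ln_gt0.
rewrite /powR gt_eqF ?(lt_trans _ J1) // divfK ?gt_eqF ?ln_gt0 //.
by rewrite lnK // posrE (lt_trans _ q1).
Qed.

Lemma kyfan_subexponential : (forall be, d < be -> summable_pow l be) ->
  forall (q c : R) i J, 1 < q -> 0 < c -> (0 < J)%N ->
    exists m, s (2 ^ (i + J * m))%N < c * q ^+ m.
Proof.
move=> sup q c i J q1 c0 J0.
(* The Ky Fan sums will be bounded by a constant times [r ^ m]; as [q ^ m = r ^ m r ^ m], the second
   factor absorbs the constant. *)
pose r := Num.sqrt q; have q0 : 0 < q by exact: lt_trans q1.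
have r2 : r ^+ 2 = q by rewrite sqr_sqrtr // ltW.
have r0 : 0 < r by rewrite sqrtr_gt0.
have r1 : 1 < r by rewrite -(@ltr_pXn2r _ 2) ?nnegrE ?(ltW r0) // r2 expr1n.
have [k k0 kE] := root_exponent r1 J0.
have [C sC] : summable_pow l (d * (1 + k)) by apply: sup; rewrite ltr_pMr // ltrDl.
have [m hm] := expr_unbounded (((2 ^ i)%:R + 2 * C) / c) r1.
exists m; pose x : R := ((2 ^ J)%:R ^+ m)^-1.
have J00 : 0 < (2 ^ J)%:R :> R by rewrite ltr0n expn_gt0.
have x0 : 0 < x by rewrite invr_gt0 exprn_gt0.
(* Where [t p] exceeds [x], the second factor is at least 1, so that [u] dominates [t] there. The
   sum of [u] is [x ^ (- k) = r ^ m] times that of the lengths to the power [d (1 + k)], an exponent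
   above [d]. *)
pose u (p : index) := t p * (t p / x) `^ k.
have u0 p : 0 <= u p by rewrite mulr_ge0 ?powR_ge0 // ltW.
have tu p : t p <= x + u p.
  case: (leP (t p) x) => [tx|xt]; first by rewrite (le_trans tx) // lerDl.
  rewrite (@le_trans _ _ (u p)) // ?lerDr ?(ltW x0) // -[leLHS]mulr1 ler_pM2l //.
  have h : 1 <= t p / x by rewrite ler_pdivlMr // mul1r ltW.
  by rewrite -(powRr0 (t p / x)) ler_powR // ltW.
have rmE : x `^ (- k) = r ^+ m.
  rewrite /x -exprVn -powR_mulrn ?invr_ge0 ?ltW // powRAC powR_mulrn ?powR_ge0 //.
  by rewrite -powR_inv1 ?ltW // -powRrM mulrN mulN1r opprK kE.
have uU N : series (rowsum u) N <= 2 * C * r ^+ m.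
  have -> : u = fun p => r ^+ m * (l p.1 `^ (d * (1 + k))).
    apply/funext => p; have E : t p * t p `^ k = l p.1 `^ (d * (1 + k)).
      by rewrite mulrDr mulr1 powRD ?(gt_eqF (l0 _)) ?implybT // /t -powRrM.
    have E2 : x^-1 `^ k = r ^+ m by rewrite -powR_inv1 ?ltW // -powRrM mulN1r.
    by rewrite /u powRM ?invr_ge0 ?ltW // E2 mulrA E mulrC.
  rewrite series_rowsumM (series_rowsum_const (fun n => l n `^ _)) mulrC ler_wpM2r ?exprn_ge0 ?(ltW r0) //.
  by rewrite ler_pM2l.
have := @kyfan_rdiag_le _ t u x _ (2 ^ (i + J * m)) tb (ltW x0) u0 tu uU.
move=> /le_lt_trans; apply.
have -> : x * (2 ^ (i + J * m))%:R = (2 ^ i)%:R.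
  rewrite /x expnD expnM natrM [((2 ^ J) ^ m)%:R]natrX mulrCA.
  by rewrite mulVf ?mulr1 // lt0r_neq0 // exprn_gt0.
rewrite -r2 -exprM mulnC exprM expr2.
rewrite ltr_pdivrMr // in hm.
have rm1 : 1 <= r ^+ m by rewrite exprn_ege1 // ltW.
have h2 : (2 ^ i)%:R <= (2 ^ i)%:R * r ^+ m by rewrite ler_peMr.
have h3 : ((2 ^ i)%:R + 2 * C) * r ^+ m < c * (r ^+ m * r ^+ m).
  by rewrite mulrA ltr_pM2r ?exprn_gt0 // [c * _]mulrC.
by apply: le_lt_trans h3; rewrite [leRHS]mulrDl lerD.
Qed.

Lemma lt_dyadic_block (c : R) (i J : nat) : (0 < J)%N -> (2 ^ i)%:R <= c ->
  exists m, (2 ^ (i + J * m))%:R <= c < (2 ^ (i + J * m.+1))%:R.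
Proof.
move=> J0 ic; have ex : exists m, c < (2 ^ (i + J * m))%:R.
  have [m cm] := @expr_unbounded R 2 c (ltr1n _ 2); exists m.
  apply: lt_le_trans cm _; rewrite -natrX ler_nat leq_exp2l //.
  by rewrite (leq_trans _ (leq_addl _ _)) // leq_pmull.
case: (ex_minnP ex) => -[|m] cm mmin; first by move: cm; rewrite muln0 addn0 ltNge ic.
exists m; rewrite cm andbT leNgt; apply/negP => /mmin.
by rewrite ltnn.
Qed.

Lemma count_gt_pow x N : 0 < x ->
  series (rowsum (fun p => (x `^ d < t p)%R%:R)) N = 2 * count_gt l x N.
Proof.
move=> x0; rewrite -series_rowsum_const; congr (series (rowsum _) N).
apply/funext => p; rewrite /t; congr (nat_of_bool _)%:R.
apply/idP/idP => [|h]; last by apply: gt0_ltr_powR;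
  rewrite ?nnegrE ?(ltW (l0 _)) ?(ltW x0).
apply: contraTT; rewrite -!leNgt => h.
by apply: ge0_ler_powR; rewrite ?nnegrE ?(ltW (l0 _)) ?(ltW x0) ?(ltW d0).
Qed.

(** If the tails were [O (q ^ (- m))], [kyfan_rdiag_tail] would bound the counting function by a
    power [x ^ (- a)] with [a < d], and the series would converge at some exponent below [d]. *)
Lemma kyfan_tail_slow : summable_pow l d ->
  (forall be, 0 < be -> be < d -> ~ summable_pow l be) ->
  has_ubound (range s) ->
  forall (q C : R) i J, 1 < q -> (0 < J)%N ->
    exists m, C < q ^+ m * (sup (range s) - s (2 ^ (i + J * m))%N).
Proof.
move=> sd crit sub q C i J q1 J0; apply: contrapT => no.
have q0 : 0 < q by exact: lt_trans q1.
have hC m : q ^+ m * (sup (range s) - s (2 ^ (i + J * m))%N) <= C.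
  by rewrite leNgt; apply/negP => h; apply: no; exists m.
have C0 : 0 <= C.
  apply: le_trans (hC 0%N); rewrite expr0 mul1r subr_ge0.
  by apply: ub_le_sup => //; exists (2 ^ (i + J * 0))%N.
have [k k0 kE] := root_exponent q1 J0.
have k1 : 0 < 1 + k by rewrite addr_gt0.
pose a := d / (1 + k).
have a0 : 0 < a by rewrite divr_gt0.
have ad : a < d by rewrite ltr_pdivrMr // ltr_pMr // ltrDl.
pose I : R := (2 ^ i)%:R; have I0 : 0 < I by rewrite ltr0n expn_gt0.
(* For a count [c] in the [m]-th block, [(c / I) ^ k <= q ^ m.+1]; with the assumed tail bound this
   gives [x ^ d c ^ (1 + k) <= A], and the root of order [1 + k] explains the exponent [a]. *)
pose A := C * q * I `^ k.
have A0 : 0 <= A by rewrite !mulr_ge0 ?powR_ge0 // ltW.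
suff cb : count_bound l a.
  have [be abe bed] : exists2 be, a < be & be < d by exists ((a + d) / 2); lra.
  apply: (crit be) => //; first exact: lt_trans abe.
  exact: (count_summable_pow (ltW a0) abe lL cb).
(* The first term covers counts below [I], which lie in no block: there [x < L] may be assumed, so
   that [L ^ a x ^ (- a) >= 1]. *)
exists (I * L `^ a + A `^ (1 + k)^-1) => x x0 N.
set c := count_gt l x N.
have K0 : 0 <= A `^ (1 + k)^-1 by exact: powR_ge0.
have xa0 : 0 < x `^ (- a) by exact: powR_gt0.
have rhs0 : 0 <= I * L `^ a by rewrite mulr_ge0 ?powR_ge0 // ltW.
case: (leP L x) => [Lx|xL].
  have -> : c = 0.
    rewrite /c /count_gt /series /= big1 // => n _.
    have /andP[_ h] := lL n; by rewrite ltNge (le_trans h).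
  by rewrite mulr_ge0 ?addr_ge0 // ltW.
case: (ltP c I) => [cI|Ic].
  apply: le_trans (ltW cI) _; rewrite mulrDl -[leLHS]addr0; apply: lerD; last first.
    by rewrite mulr_ge0 // ltW.
  rewrite -mulrA ler_peMr ?(ltW I0) // powRN ler_pdivlMr ?powR_gt0 // mul1r.
  by apply: ge0_ler_powR; rewrite ?nnegrE ?(ltW a0) ?(ltW x0) ?(ltW L0) ?(ltW xL).
have [m /andP[mc cm]] := lt_dyadic_block J0 Ic.
have c0 : 0 < c by exact: lt_le_trans Ic.
have h1 : x `^ d * c <= sup (range s) - s (2 ^ (i + J * m))%N.
  have := @kyfan_rdiag_tail _ t (x `^ d) (2 ^ (i + J * m)) N tb (powR_ge0 _ _) sub.
  apply: le_trans; rewrite count_gt_pow // -/c ler_pM2l ?powR_gt0 //.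
  by rewrite mulr_natl mulr2n -addrA lerDl subr_ge0.
have h2 : (c / I) `^ k <= q ^+ m.+1.
  have -> : q ^+ m.+1 = ((2 ^ (J * m.+1))%:R) `^ k.
    rewrite expnM natrX -[_ ^+ m.+1 in RHS]powR_mulrn // powRAC kE powR_mulrn //.
    exact: ltW.
  apply: ge0_ler_powR; rewrite ?nnegrE ?(ltW k0) ?divr_ge0 ?(ltW c0) ?(ltW I0) //.
  by rewrite ler_pdivrMr // mulrC -natrM -expnD ltW.
have h3 : x `^ d * c `^ (1 + k) <= A.
  rewrite powRD ?(gt_eqF c0) ?implybT // powRr1 ?(ltW c0) // mulrA /A.
  have -> : c `^ k = (c / I) `^ k * I `^ k.
    by rewrite -powRM ?divr_ge0 ?(ltW c0) ?(ltW I0) // divfK // gt_eqF.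
  rewrite mulrA ler_pM2r ?powR_gt0 //.
  apply: le_trans (_ : (x `^ d * c) * q ^+ m.+1 <= _).
    by rewrite ler_pM2l // mulr_gt0 ?powR_gt0.
  rewrite exprS mulrCA [q * _]mulrC ler_pM2r // mulrC.
  by apply: le_trans (hC m); rewrite ler_pM2l // exprn_gt0.
clearbody A; have h4 : c <= A `^ (1 + k)^-1 * x `^ (- a).
  have -> : x `^ (- a) = (x `^ (- d)) `^ (1 + k)^-1 by rewrite -powRrM mulNr.
  rewrite -powRM ?powR_ge0 // -[leLHS](_ : (c `^ (1 + k)) `^ (1 + k)^-1 = c); last first.
    by rewrite -powRrM divff ?gt_eqF // powRr1 // ltW.
  apply: ge0_ler_powR; rewrite ?nnegrE ?invr_ge0 ?powR_ge0 ?mulr_ge0 ?powR_ge0 ?(ltW k1) //.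
  by rewrite powRN ler_pdivlMr ?powR_gt0 // mulrC.
apply: le_trans h4 _; rewrite mulrDl lerDr mulr_ge0 //; exact: ltW.
Qed.

Lemma critical_singular_trace :
  (forall be, d < be -> summable_pow l be) ->
  (forall be, 0 < be -> be < d -> ~ summable_pow l be) ->
  exists2 tau, singular_trace tau & tau (rdiag t) = 1%E.
Proof.
move=> sup_d inf_d; have Tp := rdiag_positive tb.
have [snd s0] := sl.
have [sd|sNd] := pselect (summable_pow l d).
  have [C sC] := sd.
  have sub : has_ubound (range s).
    exists (0 * 0 + 2 * C) => _ [n _ <-].
    apply: le_trans (_ : 0 * n%:R + 2 * C <= _); last by rewrite !mul0r.
    apply: (@kyfan_rdiag_le _ t t) => // [p|p|N]; rewrite ?add0r ?(ltW (t0 p)) //.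
    by rewrite (series_rowsum_const (fun n => l n `^ d)) ler_pM2l.
  have slow := kyfan_tail_slow sd inf_d sub.
  have sM n : s n < sup (range s).
    (* With [C = 0] the slow decay says that the tail is positive, hence that the supremum is not
       attained. *)
    have [m] := slow 2 0 n 1%N (ltr1n _ 2) isT.
    rewrite pmulr_rgt0 ?exprn_gt0 // subr_gt0; apply: le_lt_trans.
    by apply: snd; rewrite mul1n (leq_trans (leq_addr m n)) // ltnW // ltn_expl.
  have [r [r_oo w0 win]] := windows_decaying sl sM slow.
  by apply: (@singular_trace_exists _ _ true r _ Tp r_oo w0) win.
have s1 : 0 < s 1%N.
  apply: lt_le_trans (kyfan_ge Tp (@pon_delta _ 1)).
  rewrite /ptrace big_ord1 /qf dot_delta rdiagE // deltaE eqxx mulr1.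
  exact: t0.
have s_oo M : exists n, M < s n.
  apply: contrapT => no; apply: sNd; exists (M / 2) => N.
  rewrite ler_pdivlMr // mulrC -series_rowsum_const.
  apply: le_trans (kyfan_rdiag_ge N tb) _; rewrite leNgt; apply/negP => h.
  by apply: no; exists N.*2.
have [r [r_oo w0 w_oo win]] := windows_growing sl s1 s_oo (kyfan_subexponential sup_d).
by apply: (@singular_trace_exists _ _ false r _ Tp r_oo w0) win.
Qed.

End critical_exponent.

(** * Logarithmic means of singular values *)

Section log_means.
Context {R : realType}.
Implicit Types (mu : nat -> R).

Local Notation step mu := (fun x : R => mu (Num.truncn x)).

Lemma measurable_step mu (D : set R) : measurable D -> nonincreasing_seq mu ->
  measurable_fun D (step mu).
Proof.
by move=> mD mu_ni; apply: nonincreasing_measurable => // x y xy; apply/mu_ni/le_truncn.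
Qed.

Lemma integral_step mu N : nonincreasing_seq mu -> (forall n, 0 <= mu n) ->
  (\int[lebesgue_measure]_(x in `[0%R, N%:R[) (step mu x)%:E = (series mu N)%:E)%E.
Proof.
move=> mu_ni mu0; elim: N => [|N IH].
  by rewrite set_itvco0 integral_set0 /series /= big_geq.
have -> : `[0, N.+1%:R[%classic = `[0, N%:R[%classic `|` `[N%:R, N.+1%:R[%classic :> set R.
  by rewrite -itv_bndbnd_setU ?bnd_simp ?ler0n ?ler_nat.
rewrite ge0_integral_setU //=; last 3 first.
- by apply/measurable_EFinP; apply: measurable_step => //; exact: measurableU.
- by move=> x _; rewrite lee_fin.
- rewrite disj_set2E; apply/eqP/seteqP; split => // x [] /=.
  by rewrite !in_itv /= => /andP[_ h1] /andP[h2 _]; move: (lt_le_trans h1 h2); rewrite ltxx.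
rewrite IH /series /= big_nat_recr //= EFinD; congr (_ + _)%E.
rewrite (eq_integral (cst (mu N)%:E)); last first.
  move=> x; rewrite inE /= in_itv /= => h.
  by rewrite (@truncn_def _ x N).
rewrite integral_cst //= lebesgue_measure_itv /= lte_fin ltr_nat ltnSn.
by rewrite -EFinD -natr1 addrAC subrr add0r mule1.
Qed.

Lemma Rintegral_step_le mu (C t : R) : nonincreasing_seq mu -> (forall n, 0 <= mu n) ->
  (forall N, series mu N <= C) ->
  0 <= \int[lebesgue_measure]_(x in `[0, t]) step mu x <= C.
Proof.
move=> mu_ni mu0 muC; have le : (\int[lebesgue_measure]_(x in `[0%R, t]) (step mu x)%:E <= C%:E)%E.
  apply: (@le_trans _ _ (\int[lebesgue_measure]_(x in `[0%R, (Num.truncn t).+1%:R[) (step mu x)%:E)%E).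
    apply: ge0_subset_integral => //=.
    - by apply/measurable_EFinP; exact: measurable_step.
    - by move=> x _; rewrite lee_fin.
    - move=> x /=; rewrite !in_itv /= => /andP[-> xt] /=.
      by apply: le_lt_trans xt _; exact: truncnS_gt.
  by rewrite integral_step // lee_fin.
have ge : (0 <= \int[lebesgue_measure]_(x in `[0%R, t]) (step mu x)%:E)%E.
  by apply: integral_ge0 => x _; rewrite lee_fin.
rewrite /Rintegral fine_ge0 //= -lee_fin fineK // ge0_fin_numE //.
by apply: le_lt_trans le _; exact: ltry.
Qed.

Lemma cvg_ln_pinfty : ln t @[t --> +oo] --> (+oo : set_system R).
Proof.
apply/cvgryPge => A; apply: filterS (nbhs_pinfty_ge (num_real (expR A))) => t At.
by rewrite -ler_expR lnK // posrE (lt_le_trans (expR_gt0 A)).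
Qed.

Lemma log_mean_cvg0 mu (C : R) : nonincreasing_seq mu -> (forall n, 0 <= mu n) ->
  (forall N, series mu N <= C) -> log_mean mu t @[t --> +oo] --> (0 : R).
Proof.
move=> mu_ni mu0 muC.
have ln_oo : (ln t)^-1 * C @[t --> +oo] --> (0 : R).
  rewrite -[X in _ --> X](mul0r C); apply: cvgMl.
  apply/gtr0_cvgV0; last exact: cvg_ln_pinfty.
  by apply: filterS (nbhs_pinfty_gt (num_real 1)) => x x1; exact: ln_gt0.
apply: (squeeze_cvgr _ (cvg_cst 0) ln_oo).
apply: filterS (nbhs_pinfty_gt (num_real 1)) => t t1.
have /andP[h1 h2] := Rintegral_step_le t mu_ni mu0 muC.
have lt0 : 0 < ln t by exact: ln_gt0.
by rewrite /log_mean mulr_ge0 ?invr_ge0 ?(ltW lt0) //= ler_pM2l ?invr_gt0.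
Qed.

Lemma nmul_le_integral_step mu n : nonincreasing_seq mu -> (forall n, 0 <= mu n) ->
  n%:R * mu n <= \int[lebesgue_measure]_(x in `[0, n%:R]) step mu x.
Proof.
move=> mu_ni mu0; have [->|n0] := posnP n; first by rewrite mul0r Rintegral_ge0.
have fin : (\int[lebesgue_measure]_(x in `[0%R, n%:R]) (step mu x)%:E < +oo)%E.
  apply: (@le_lt_trans _ _ (\int[lebesgue_measure]_(x in `[0%R, n.+1%:R[) (step mu x)%:E)%E).
    apply: ge0_subset_integral => //=.
    - by apply/measurable_EFinP; exact: measurable_step.
    - by move=> x _; rewrite lee_fin.
    - move=> x /=; rewrite !in_itv /= => /andP[-> xt] /=.
      by apply: le_lt_trans xt _; rewrite ltr_nat.
  by rewrite integral_step // ltry.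
rewrite /Rintegral -lee_fin fineK; last first.
  by rewrite ge0_fin_numE // integral_ge0 // => x _; rewrite lee_fin.
apply: (@le_trans _ _ (\int[lebesgue_measure]_(x in `[0%R, n%:R]) (cst (mu n)%:E x))%E).
  rewrite integral_cst //= lebesgue_measure_itv /= lte_fin ltr0n n0.
  by rewrite -EFinD subr0 -EFinM mulrC.
apply: ge0_le_integral => //=.
- by move=> x _; rewrite lee_fin.
- by apply/measurable_EFinP; exact: measurable_step.
- move=> x; rewrite in_itv /= lee_fin => /andP[_ xn]; apply: mu_ni.
  by rewrite -[leqRHS](@natrK R) le_truncn.
Qed.

(** By monotonicity [n mu_n] is at most the integral up to [n], which is eventually at most [ln n],
    and [ln n <= be^-1 n ^ be] follows from [ln y <= y - 1] at [y = n ^ be]. *)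
Lemma log_mean_decay mu (be : R) : nonincreasing_seq mu -> (forall n, 0 <= mu n) ->
  log_mean mu t @[t --> +oo] --> (0 : R) -> 0 < be ->
  exists n0, forall n, (n0 <= n)%N -> n%:R * mu n <= be^-1 * n%:R `^ be.
Proof.
move=> mu_ni mu0 mu_log be0.
have /cvgr_le /(_ 1 ltr01) [M [_ hM]] := mu_log.
(* The bound 2 makes [ln n] positive, the other one places [n] beyond [M]. *)
exists (maxn 2 (Num.truncn M).+1) => n; rewrite geq_max => /andP[n2 nM].
have nM' : M < n%:R by apply: lt_le_trans (truncnS_gt M) _; rewrite ler_nat.
have ln0 : 0 < ln n%:R :> R by rewrite ln_gt0 // ltr1n.
have := hM _ nM'; rewrite /log_mean mulrC ler_pdivrMr // mul1r => h.
apply: le_trans (nmul_le_integral_step n mu_ni mu0) _; apply: le_trans h _.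
rewrite ler_pdivlMl // -ln_powR.
have p0 : 0 < n%:R `^ be :> R by rewrite powR_gt0 // ltr0n (leq_trans _ n2).
have := @le_ln1Dx R (n%:R `^ be - 1); rewrite [1 + _]addrC subrK => /(_ _)/le_trans; apply.
  by rewrite ltrBrDr addNr.
by rewrite lerBlDr lerDl.
Qed.

End log_means.

(** * Compactness of diagonal operators with vanishing entries *)

Section compact_diagonal.
Context {R : realType}.
Local Notation H := (l2 R).
Local Notation index := (nat * 'I_2)%type.
Variable t : index -> R.
Hypotheses (t0 : forall p, 0 < t p) (tb : bounded_coef t).
Hypothesis t_van : forall e, 0 < e -> exists M : nat, forall p, (M <= p.1)%N -> t p < e.

Lemma ultra_cvg_norm_le (W : set_system nat) (u : nat -> R) (M : R) :
  UltraFilter W -> (forall n, `|u n| <= M) -> cvg (u @ W).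
Proof.
move=> WU uM.
have : cvg ((fun n => u n + M) @ W).
  apply: (@ultra_cvg_bounded _ _ _ _ (M + M)) => //; apply: filterE => n /=.
  by have := uM n; rewrite ler_norml => /andP[h1 h2]; apply/andP; split; lra.
move=> /cvg_ex[l ul]; apply/cvg_ex; exists (l - M).
rewrite (_ : u = fun n => (u n + M) - M); last by apply/funext => n; rewrite addrK.
by apply: cvgB => //; exact: cvg_cst.
Qed.

Lemma abs_Re_le (c : R[i]) (M : R) : 0 <= M -> nsq c <= M ^+ 2 -> `|complex.Re c| <= M.
Proof.
move=> M0 cM; rewrite -ler_sqr ?nnegrE ?normr_ge0 //.
rewrite real_normK ?num_real //; apply: le_trans cM.
by rewrite /nsq lerDl sqr_ge0.
Qed.

Lemma abs_Im_le (c : R[i]) (M : R) : 0 <= M -> nsq c <= M ^+ 2 -> `|complex.Im c| <= M.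
Proof.
move=> M0 cM; rewrite -ler_sqr ?nnegrE ?normr_ge0 //.
rewrite real_normK ?num_real //; apply: le_trans cM.
by rewrite /nsq lerDr sqr_ge0.
Qed.

(** Rows from [M] on are damped by [e], and the others are finitely many; thus coordinatewise
    convergence of a bounded sequence becomes norm convergence of its image. *)
Lemma sqn_rdiag_le (z : H) (K e : R) M : (forall p, 0 <= t p <= K) -> 0 <= e ->
  (forall p, (M <= p.1)%N -> t p < e) ->
  sqn (rdiag t z) <= e ^+ 2 * sqn z + K ^+ 2 * series (rowsum (nsq \o z)) M.
Proof.
move=> tK e0 tM; pose g p := (p.1 < M)%N%:R * nsq (z p).
have gE N : series (rowsum g) N <= series (rowsum (nsq \o z)) M.
  apply: le_trans (_ : series (rowsum g) (maxn N M) <= _).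
    apply: series_nd; last exact: leq_maxl.
    by move=> n; apply: rowsum_ge0 => p; rewrite mulr_ge0 ?nsq_ge0.
  have tail : \sum_(M <= n < maxn N M) rowsum g n = 0.
    rewrite big_nat_cond big1 // => n /andP[/andP[Mn _] _].
    by rewrite /rowsum big1 // => j _; rewrite /g /= ltnNge Mn mul0r.
  rewrite /series /= (@big_cat_nat _ _ _ M) ?leq_maxr //= tail.
  rewrite addr0; apply: ler_sum_nat => n /andP[_ nM]; apply: ler_sum => j _.
  by rewrite /g /= nM mul1r.
apply: sqsum_le => N.
apply: le_trans (_ : e ^+ 2 * series (rowsum (nsq \o z)) N + K ^+ 2 * series (rowsum g) N <= _).
  rewrite -!series_rowsumM -series_rowsumD; apply: series_rowsum_le => p /=.
  rewrite rdiagE // nsqM nsq_real /g; have /andP[tp0 tpK] := tK p.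
  have z0 := nsq_ge0 (z p).
  case: (ltnP p.1 M) => h.
    rewrite mul1r -[leLHS]add0r lerD ?mulr_ge0 ?sqr_ge0 //.
    by rewrite ler_wpM2r // ler_sqr ?nnegrE // (le_trans tp0).
  rewrite mul0r mulr0 addr0 ler_wpM2r // ler_sqr ?nnegrE //.
  by rewrite ltW // tM.
by apply: lerD; rewrite ler_wpM2l ?sqr_ge0 // nsq_le.
Qed.

(** A free ultrafilter makes all coordinates converge at once, in place of a diagonal extraction;
    the subsequence is picked afterwards from the large sets of the ultrafilter. *)
Lemma rdiag_compact : compact_op (rdiag t).
Proof.
have [Tb _] := rdiag_positive tb; split => // x [M0 xM0].
pose M := Num.max M0 0; have M_ge0 : 0 <= M by rewrite le_max lexx orbT.
have xM n : sqn (x n) <= M ^+ 2.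
  rewrite sqn_l2norm ler_sqr ?nnegrE ?l2norm_ge0 //.
  by rewrite (le_trans (xM0 n)) // le_max lexx.
have [W [WU Woo]] := ultraFilterLemma eventually_filter.
have xpM n p : nsq (x n p) <= M ^+ 2 by apply: le_trans (xM n); exact: nsq_le_sqn.
have Rcv p : cvg ((fun n => complex.Re (x n p)) @ W).
  by apply: (@ultra_cvg_norm_le _ _ M) => n; exact: abs_Re_le.
have Icv p : cvg ((fun n => complex.Im (x n p)) @ W).
  by apply: (@ultra_cvg_norm_le _ _ M) => n; exact: abs_Im_le.
pose y0 p : R[i] := lim ((fun n => complex.Re (x n p)) @ W) +i*
  lim ((fun n => complex.Im (x n p)) @ W).
have nsq_cv (f : index -> R[i]) p : (fun n => nsq (x n p - f p)) @ W --> nsq (y0 p - f p).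
  have -> : (fun n => nsq (x n p - f p)) = fun n =>
      (complex.Re (x n p) - complex.Re (f p)) ^+ 2 + (complex.Im (x n p) - complex.Im (f p)) ^+ 2.
    by apply/funext => n; rewrite /nsq; case: (x n p) (f p) => ? ? [].
  have -> : nsq (y0 p - f p) =
      (complex.Re (y0 p) - complex.Re (f p)) ^+ 2 + (complex.Im (y0 p) - complex.Im (f p)) ^+ 2.
    by rewrite /nsq; case: (y0 p) (f p) => ? ? [].
  by apply: cvgD; rewrite ?expr2; apply: cvgM; apply: cvgB => //; exact: cvg_cst.
have series_cv (f : index -> R[i]) N :
    (fun n => series (rowsum (fun p => nsq (x n p - f p))) N) @ W -->
    series (rowsum (fun p => nsq (y0 p - f p))) N.
  rewrite /series /=; apply: cvg_big => [|n _]; first exact: add_continuous.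
  by rewrite /rowsum; apply: cvg_big => [|j _]; [exact: add_continuous | exact: nsq_cv].
have y0_l2 : y0 \in @l2_pred R.
  apply: (@in_l2 _ _ (M ^+ 2)) => N.
  have := series_cv (fun=> 0) N.
  rewrite (_ : (fun p => nsq (y0 p - 0)) = nsq \o y0); last by apply/funext => p; rewrite subr0.
  move=> cv; rewrite -(cvg_lim _ cv) //; apply: limr_le; first by apply/cvg_ex; eexists; exact: cv.
  apply: filterE => n; rewrite (_ : (fun p => nsq (x n p - 0)) = nsq \o x n).
    exact: le_trans (nsq_le _ _) (xM n).
  by apply/funext => p; rewrite subr0.
pose y : H := L2 y0_l2.
have [K tK] := tb.
have K0 : 0 <= K by have /andP[h1 h2] := tK (0%N, ord0); exact: le_trans h2.
have zM n : sqn (x n - y) <= 2 * M ^+ 2 + 2 * sqn y.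
  by apply: le_trans (sqnD_le _ _) _; rewrite sqnN lerD2r ler_pM2l.
have near_small e : 0 < e -> W [set n | sqn (rdiag t (x n) - rdiag t y) < e].
  (* [B] bounds every [sqn (x n - y)], and the added 1 makes it positive; [d] is chosen so that
     [d ^ 2 B] is half of [e]. *)
  move=> e0; pose B := 2 * M ^+ 2 + 2 * sqn y + 1.
  have B0 : 0 < B by rewrite ltr_wpDl // addr_ge0 // mulr_ge0 ?sqr_ge0 ?sqn_ge0.
  pose d := Num.sqrt (e / 2 / B).
  have d2 : d ^+ 2 * B = e / 2 by rewrite sqr_sqrtr ?divfK ?gt_eqF // !divr_ge0 // ltW.
  have d0 : 0 < d by rewrite sqrtr_gt0 !divr_gt0.
  have [N tN] := t_van d0.
  have cv0 : (fun n => K ^+ 2 * series (rowsum (nsq \o (x n - y))) N) @ W --> 0.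
    rewrite -[X in _ --> X](mulr0 (K ^+ 2)); apply: cvgMr.
    have z0 : series (rowsum (fun p => nsq (y0 p - y0 p))) N = 0.
      rewrite /series /= big1 // => n _.
      by rewrite /rowsum big1 // => j _; rewrite subrr /nsq /= expr0n addr0.
    rewrite -z0; exact: series_cv.
  have e2 : 0 < e / 2 by rewrite divr_gt0.
  have /cvgr_lt /(_ _ e2) := cv0; apply: filterS => n /= hn.
  have [lin _] := Tb; rewrite -linB //.
  apply: le_lt_trans (@sqn_rdiag_le (x n - y) K d N tK (ltW d0) tN) _.
  have h1 : d ^+ 2 * sqn (x n - y) <= e / 2.
    rewrite -d2 ler_pM2l ?exprn_gt0 // (le_trans (zM n)) // /B; lra.
  by move: hn h1; lra.
have ex (q : nat * nat) : exists n,
    (q.2 < n)%N /\ sqn (rdiag t (x n) - rdiag t y) < q.1.+1%:R^-1.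
  have k0 : 0 < q.1.+1%:R^-1 :> R by rewrite invr_gt0.
  (* [q.2] is the previously chosen index, so that the choices increase strictly. *)
  have h2 : W [set n | (q.2 < n)%N] by apply: Woo; exact: nbhs_infty_gt.
  by have [n [/= hn mn]] := filter_ex (filterI (near_small _ k0) h2); exists n.
have [pick hpick] := choice ex.
pose phi := fix phi k := if k is k'.+1 then pick (k, phi k') else pick (0%N, 0%N).
have phiS k : phi k.+1 = pick (k.+1, phi k) by [].
have phi_small k : sqn (rdiag t (x (phi k)) - rdiag t y) < k.+1%:R^-1.
  by case: k => [|k]; [have [] := hpick (0%N, 0%N) | rewrite phiS; have [] := hpick (k.+1, phi k)].
exists phi, (rdiag t y); split.
  apply: homo_ltn; first exact: ltn_trans.
  by move=> k; rewrite phiS; have [] := hpick (k.+1, phi k).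
have sq0 : (fun k => sqn (rdiag t (x (phi k)) - rdiag t y)) @ \oo --> 0.
  apply: (squeeze_cvgr _ (cvg_cst 0) (@cvg_harmonic R)); apply: nearW => k.
  by rewrite sqn_ge0 /= ltW.
have := @continuous_cvg _ _ _ _ _ _ (@Num.sqrt R) _ (@sqrt_continuous R 0) sq0.
rewrite sqrtr0; exact.
Qed.

End compact_diagonal.

(** * Eigenvalues of diagonal operators *)

Section spectrum.
Context {R : realType}.
Local Notation H := (l2 R).
Local Notation index := (nat * 'I_2)%type.

Definition prefix_index (M : nat) : seq index :=
  [seq (n, j) | n <- iota 0 M, j <- enum 'I_2].

Lemma mem_prefix_index M (p : index) : (p \in prefix_index M) = (p.1 < M)%N.
Proof.
apply/allpairsP/idP => [[[n j] /= [nM _ ->]]|pM].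
  by rewrite mem_iota in nM.
by exists p; rewrite mem_iota mem_enum; split => //; case: p pM.
Qed.

Lemma prefix_index_uniq M : uniq (prefix_index M).
Proof.
apply: allpairs_uniq; rewrite ?iota_uniq ?enum_uniq //.
by move=> [n j] [n' j'] _ _ /= [-> ->].
Qed.

Lemma size_prefix_index M : size (prefix_index M) = (M * 2)%N.
Proof. by rewrite size_allpairs size_iota size_enum_ord. Qed.

Lemma sum_prefix_index (f : index -> R) M :
  \sum_(p <- prefix_index M) f p = series (rowsum f) M.
Proof.
rewrite /prefix_index big_allpairs_dep /series /= /index_iota subn0.
by apply: eq_bigr => n _; rewrite big_enum.
Qed.

Lemma sum_uniq_le (T : eqType) (f : T -> R) (s1 s2 : seq T) : (forall x, 0 <= f x) ->
  uniq s1 -> uniq s2 -> {subset s1 <= s2} -> \sum_(x <- s1) f x <= \sum_(x <- s2) f x.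
Proof.
move=> f0 u1 u2 s12; rewrite [leRHS](bigID (mem s1)) /= -[X in _ <= X + _]big_filter.
rewrite [X in _ <= X + _](perm_big s1) /=; last first.
  apply: uniq_perm; rewrite ?filter_uniq // => x; rewrite mem_filter.
  by case: (boolP (x \in s1)) => //= /s12 ->.
by rewrite lerDl sumr_ge0.
Qed.

Lemma seq_argmax (T : eqType) (f : T -> R) (s : seq T) x0 : x0 \in s ->
  exists2 x, x \in s & forall y, y \in s -> f y <= f x.
Proof.
elim: s x0 => // a s IH x0 _; case: (eqVneq s [::]) => [->|sN].
  by exists a; rewrite ?mem_head // => y; rewrite inE => /eqP ->.
have [b bs] : exists b, b \in s by case: s sN {IH} => // b s _; exists b; exact: mem_head.
have [x xs xmax] := IH b bs; case: (leP (f a) (f x)) => [ax|xa].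
  exists x; first by rewrite inE xs orbT.
  by move=> y; rewrite inE => /orP[/eqP ->//|]; exact: xmax.
exists a; first exact: mem_head.
move=> y; rewrite inE => /orP[/eqP ->//|ys].
by apply: le_trans (xmax y ys) _; exact: ltW.
Qed.

Variable t : index -> R.
Hypotheses (t0 : forall p, 0 < t p) (tb : bounded_coef t).
Hypothesis t_van : forall e, 0 < e -> exists M : nat, forall p, (M <= p.1)%N -> t p < e.

Lemma next_largest (s : seq index) :
  exists p, p \notin s /\ forall q, q \notin s -> t q <= t p.
Proof.
pose N := (\max_(p <- s) p.1).+1.
have p0s : (N, ord0) \notin s.
  apply/negP => h; have := @leq_bigmax_seq _ s xpredT (fun p : index => p.1) _ h isT.
  by rewrite /= ltnn.
have [M tM] := t_van (t0 (N, ord0)).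
pose c := [seq p <- prefix_index (maxn M N.+1) | p \notin s].
have p0c : (N, ord0) \in c.
  by rewrite mem_filter p0s mem_prefix_index /= leq_max leqnn orbT.
have [p pc pmax] := seq_argmax t p0c; exists p; split.
  by move: pc; rewrite mem_filter => /andP[].
move=> q qs; case: (ltnP q.1 (maxn M N.+1)) => qM.
  by apply: pmax; rewrite mem_filter qs mem_prefix_index.
apply: le_trans (pmax _ p0c); apply: ltW; apply: tM.
by rewrite (leq_trans _ qM) // leq_maxl.
Qed.

(** The entries are listed by repeatedly taking the largest remaining one. An index [p] never taken
    would force all the listed entries to be at least [t p], hence to lie in finitely many rows,
    against injectivity. *)
Lemma sorted_enumeration : exists g : nat -> index,
  [/\ injective g, forall p, exists n, g n = p & nonincreasing_seq (t \o g)].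
Proof.
have [next hnext] := choice next_largest.
pose pre := fix pre n := if n is n'.+1 then rcons (pre n') (next (pre n')) else [::].
pose g n := next (pre n).
have preS n : pre n.+1 = rcons (pre n) (g n) by [].
have mem_pre m n : (m < n)%N -> g m \in pre n.
  elim: n => // n IH; rewrite ltnS leq_eqVlt preS mem_rcons inE => /orP[/eqP->|/IH ->].
    by rewrite eqxx.
  by rewrite orbT.
have gN n : g n \notin pre n by have [] := hnext (pre n).
have gmax n q : q \notin pre n -> t q <= t (g n) by have [_] := hnext (pre n); apply.
have g_inj : injective g.
  move=> m n mn; case: (ltngtP m n) => // h.
    by have := gN n; rewrite -mn mem_pre.
  by have := gN m; rewrite mn mem_pre.
exists g; split => //; last first.
  apply/nonincreasing_seqP => n /=; apply: gmax; apply: contra (gN n.+1).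
  by rewrite preS mem_rcons inE => ->; rewrite orbT.
move=> p; apply: contrapT => no.
have pN n : p \notin pre n.
  elim: n => // n IH; rewrite preS mem_rcons inE negb_or IH andbT.
  by apply/eqP => h; apply: no; exists n.
have [M tM] := t_van (t0 p).
have gM n : ((g n).1 < M)%N.
  by rewrite ltnNge; apply/negP => /tM; rewrite ltNge gmax.
have := @uniq_leq_size _ [seq g n | n <- iota 0 (M * 2).+1] (prefix_index M).
rewrite map_inj_uniq // iota_uniq size_map size_iota size_prefix_index ltnn => h.
by apply: notF; apply: h => // q /mapP[n _ ->]; rewrite mem_prefix_index.
Qed.

Lemma delta_sum (k : nat) (q : nat -> index) (c : nat -> R[i]) p :
  (\sum_(i < k) c i *: delta (q i) : H) p = \sum_(i < k) c i * (p == q i)%:R.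
Proof.
elim: k => [|k IH]; first by rewrite !big_ord0.
by rewrite big_ord_recr [RHS]big_ord_recr l2addE; congr (_ + _); exact: IH.
Qed.

Lemma rdiag_eigenspace (g : nat -> index) (l : R) : injective g ->
  (forall p, exists n, g n = p) -> 0 < l -> exists k : nat,
  ([set n | t (g n) = l] #= `I_k)%card /\ finite_dim [set x | rdiag t x = l%:C *: x] k.
Proof.
move=> g_inj g_surj l0; have [M tM] := t_van l0.
have [m hm] := choice g_surj.
(* Entries equal to [l] occur only in the first [M] rows; [Y] lists their positions in the
   enumeration [g]. *)
pose Y := [seq m p | p <- prefix_index M & t p == l].
have mg n : m (g n) = n by apply: g_inj; rewrite hm.
have m_inj : injective m by move=> p q pq; rewrite -(hm p) pq hm.
have memY n : (n \in Y) = (t (g n) == l).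
  apply/mapP/idP => [[p + ->]|/eqP tn]; first by rewrite mem_filter hm => /andP[].
  exists (g n) => //; rewrite mem_filter tn eqxx mem_prefix_index /= ltnNge.
  by apply/negP => /tM; rewrite tn ltxx.
have uY : uniq Y by rewrite map_inj_uniq // filter_uniq // prefix_index_uniq.
exists (size Y); split.
  rewrite card_eq_sym; apply/card_set_bijP; exists (nth 0%N Y); split.
  - by move=> i /= iY; apply/eqP; rewrite -memY mem_nth.
  - move=> i j; rewrite !inE /= => iY jY /eqP; rewrite nth_uniq // => /eqP //.
  - move=> n /= /eqP; rewrite -memY => nY; exists (seq.index n Y); rewrite /= ?index_mem //.
    by rewrite nth_index.
pose q i := g (nth 0%N Y i).
have tq i : (i < size Y)%N -> t (q i) = l.
  by move=> iY; apply/eqP; rewrite -memY mem_nth.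
have qE i j : (i < size Y)%N -> (j < size Y)%N -> (q i == q j) = (i == j).
  by move=> iY jY; rewrite (inj_eq g_inj) nth_uniq.
have sumq (c : nat -> R[i]) j : (j < size Y)%N ->
    (\sum_(i < size Y) c i *: delta (q i) : H) (q j) = c j.
  move=> jY; rewrite delta_sum (bigD1 (Ordinal jY)) //= eqxx mulr1 big1 ?addr0 // => i ij.
  have /negbTE ij' : val i != j := ij.
  by rewrite qE // eq_sym ij' mulr0.
exists (fun i => delta (q i)); split.
  move=> c c0 i; pose c' n := if insub n is Some j then c j else 0.
  have cE j : c j = c' j by rewrite /c' valK.
  have := sumq c' i (ltn_ord i); rewrite -cE => <-.
  rewrite (eq_bigr (fun j => c j *: delta (q j))) => [|j _]; last by rewrite -cE.
  by rewrite c0.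
apply/seteqP; split=> [x /= xl|_ [c _ <-] /=].
  exists (fun i => x (q i)) => //; apply: l2_eq => p.
  rewrite (delta_sum _ q (fun i => x (q i))).
  have [tp|tp] := eqVneq (t p) l.
    have pY : m p \in Y by rewrite memY hm tp.
    have iY : (seq.index (m p) Y < size Y)%N by rewrite index_mem.
    have pq : p = q (seq.index (m p) Y) by rewrite /q nth_index // hm.
    rewrite (bigD1 (Ordinal iY)) //= -pq eqxx mulr1 big1 ?addr0 // => i ij.
    have /negbTE ij' : val i != seq.index (m p) Y := ij.
    by rewrite {1}pq qE // eq_sym ij' mulr0.
  have x0 : x p = 0.
    have := congr1 (fun y : H => y p) xl; rewrite rdiagE // l2scaleE => /eqP.
    rewrite -subr_eq0 -mulrBl mulf_eq0 => /orP[|/eqP //].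
    by rewrite -rmorphB /= eq_complex /= eqxx andbT subr_eq0 (negbTE tp).
  rewrite big1 // => i _; case: eqVneq => [pq|_]; last by rewrite mulr0.
  by rewrite -pq x0 mul0r.
have [lin _] := (rdiag_positive tb).1.
rewrite lin_sum // scaler_sumr; apply: eq_bigr => i _; rewrite linZ // !scalerA mulrC -scalerA.
congr (_ *: _); apply: l2_eq => p; rewrite rdiagE // l2scaleE deltaE.
by case: eqVneq => [->|]; rewrite ?mulr0 // tq.
Qed.

Lemma rdiag_eigenvalue_seq (g : nat -> index) : injective g ->
  (forall p, exists n, g n = p) -> nonincreasing_seq (t \o g) ->
  eigenvalue_seq (rdiag t) (t \o g).
Proof.
move=> g_inj g_surj g_ni; split => // [n|l l0]; first exact: ltW (t0 _).
exact: rdiag_eigenspace.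
Qed.

(** The operator is its own absolute value, and bounded sums of its eigenvalues become negligible
    after division by [ln t]. *)
Lemma rdiag_L1inf0 (C : R) : (forall N, series (rowsum t) N <= C) -> L1inf0 (rdiag t).
Proof.
move=> tC; split; first exact: rdiag_compact.
have [g [g_inj g_surj g_ni]] := sorted_enumeration.
have tp := rdiag_positive tb; have ta := rdiag_adjoint tb.
exists (t \o g); first exists (rdiag t).
- by split => //; exists (rdiag t).
- exact: rdiag_eigenvalue_seq.
apply: (@log_mean_cvg0 _ _ C) => // [n|N]; first exact: ltW (t0 _).
have [M gM] : exists M, forall n, (n < N)%N -> ((g n).1 < M)%N.
  exists (\max_(n < N) (g n).1).+1 => n nN.
  by rewrite ltnS (leq_bigmax (Ordinal nN)).
apply: le_trans (tC M); rewrite -sum_prefix_index /series /= /index_iota subn0.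
rewrite -(big_map g xpredT t); apply: sum_uniq_le.
- by move=> p; exact: ltW.
- by rewrite map_inj_uniq // iota_uniq.
- exact: prefix_index_uniq.
- move=> p /mapP[n]; rewrite mem_iota add0n => /andP[_ nN] ->.
  by rewrite mem_prefix_index gM.
Qed.

End spectrum.

(** * Lower bounds for an arbitrary sequence of singular values *)

Section eigenvalue_counting.
Context {R : realType}.
Local Notation H := (l2 R).
Local Notation index := (nat * 'I_2)%type.
Variable t : index -> R.
Hypotheses (t0 : forall p, 0 < t p) (tb : bounded_coef t).
Hypothesis t_van : forall e, 0 < e -> exists M : nat, forall p, (M <= p.1)%N -> t p < e.

(* [P ^ 2 = T ^ 2] factors as [(P + t p) (P - t p)] on the basis vector [p], and
   [P + t p] is injective as [P] is positive. *)
Lemma abs_rdiag_delta P p : abs_of (rdiag t) P -> P (delta p) = (t p)%:C *: delta p.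
Proof.
move=> [Ppos [S [Tb Sb TS] PP]]; have [[Plin _] _] := Ppos.
have SE y q : S y q = (t q)%:C * y q.
  have := TS (delta q) y.
  have -> : rdiag t (delta q) = (t q)%:C *: delta q.
    apply: l2_eq => u; rewrite rdiagE // l2scaleE deltaE.
    by case: eqVneq => [->|]; rewrite ?mulr0.
  rewrite dotZl !delta_dot => /(congr1 (fun z : R[i] => z^*%R)).
  rewrite rmorphM /= !conjCK => <-; congr (_ * _).
  by apply/eqP; rewrite eq_complex /= oppr0 !eqxx.
set T2 := t p; pose z := P (delta p) - T2%:C *: delta p.
have PPd : P (P (delta p)) = (T2 ^+ 2)%:C *: delta p.
  have := congr1 (fun f => f (delta p)) PP; rewrite /= => ->; apply: l2_eq => u.
  rewrite SE rdiagE // l2scaleE deltaE /T2; case: eqVneq => [->|]; rewrite ?mulr0 //.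
  by rewrite !mulr1 rmorphXn /= expr2.
have zE : P z + T2%:C *: z = 0.
  rewrite /z (linB Plin) (linZ Plin) PPd scalerBr scalerA -rmorphM /= -expr2.
  by rewrite addrA subrK subrr.
have : qf P z + T2 * sqn z = 0.
  have := congr1 (fun y => complex.Re (dot y z)) zE.
  rewrite dotDl dot0l dotZl dotxx ReD /qf => h.
  rewrite -[RHS]/(complex.Re (0 : R[i])) -h; congr (_ + _).
  by rewrite /sqn /= mul0r subr0.
have qz := qf_ge0 z Ppos; have sz := sqn_ge0 z; have T0 : 0 < T2 := t0 p.
move=> h; have : sqn z = 0.
  have : T2 * sqn z <= 0 by move: h qz; lra.
  by rewrite pmulr_rle0 // => h2; apply/eqP; rewrite eq_le h2 sz.
by move=> /sqn_eq0 /eqP; rewrite subr_eq0 => /eqP.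
Qed.

(** Evaluating the combinations at the points of [X] factors the identity matrix of order [size X]
    through dimension [k]. *)
Lemma delta_span_size (k : nat) (v : 'I_k -> H) (X : seq index) : uniq X ->
  (forall p, p \in X -> exists c : 'I_k -> R[i], \sum_i c i *: v i = delta p) ->
  (size X <= k)%N.
Proof.
move=> uX hX; pose q (j : 'I_(size X)) := nth (0%N, ord0) X j.
have ex j : exists c : 'I_k -> R[i], \sum_i c i *: v i = delta (q j).
  by apply: hX; exact: mem_nth.
have [c hc] := choice ex.
have sumE (f : 'I_k -> R[i]) u : (\sum_i f i *: v i : H) u = \sum_i f i * v i u.
  by rewrite (big_morph (fun x : H => x u) (id1 := 0) (op1 := +%R)).
have : (\matrix_(j < size X, i < k) c j i) *m (\matrix_(i < k, j < size X) v i (q j)) = 1%:M.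
  apply/matrixP => j j'; rewrite !mxE.
  rewrite (eq_bigr (fun i => c j i * v i (q j'))) => [|i _]; last by rewrite !mxE.
  by rewrite -sumE hc deltaE /q nth_uniq // eq_sym.
exact: mulmx1_min.
Qed.

(** [L1inf0] provides some [P] and some [mu], not the sorted entries of [t]. It suffices that [mu]
    contains all the entries with multiplicity: for each value [l], the eigenspace of [P] contains
    the basis vectors with [t p = l], so that [mu] takes the value [l] often enough. *)
Lemma eigenvalue_seq_injection P (mu : nat -> R) :
  abs_of (rdiag t) P -> eigenvalue_seq P mu ->
  exists2 h : index -> nat, injective h & forall p, mu (h p) = t p.
Proof.
move=> PT [_ _ mu_eig].
have ex (l : {l : R | 0 < l}) : exists f : index -> nat,
    (forall p, t p = sval l -> mu (f p) = sval l) /\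
    (forall p q, t p = sval l -> t q = sval l -> f p = f q -> p = q).
  case: l => l l0 /=; have [k [muk [v [_ Pv]]]] := mu_eig l l0.
  have [M tM] := t_van l0.
  pose X := [seq p <- prefix_index M | t p == l].
  have memX p : (p \in X) = (t p == l).
    rewrite mem_filter mem_prefix_index; case: eqVneq => //= tp.
    by rewrite ltnNge; apply/negP => /tM; rewrite tp ltxx.
  have Xk : (size X <= k)%N.
    apply: (@delta_span_size _ v); first by rewrite filter_uniq // prefix_index_uniq.
    move=> p; rewrite memX => /eqP tp; have : [set x | P x = l%:C *: x] (delta p).
      by rewrite /= -tp; exact: abs_rdiag_delta.
    by rewrite Pv => -[c _ cp]; exists c.
  move: muk; rewrite card_eq_sym => /card_set_bijP[f [fsub finj _]].
  exists (fun p => f (seq.index p X)).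
  have iX p : t p = l -> (seq.index p X < k)%N.
    by move=> tp; apply: leq_trans Xk; rewrite index_mem memX tp.
  split=> [p tp|p q tp tq /finj]; first exact: fsub (iX p tp).
  rewrite !inE => /(_ (iX p tp) (iX q tq)) /(congr1 (nth p X)).
  by rewrite !nth_index // memX ?tp ?tq.
have [h hh] := choice ex.
exists (fun p => h (exist _ (t p) (t0 p)) p); last first.
  by move=> p; have [h1 _] := hh (exist _ (t p) (t0 p)); exact: h1.
move=> p q /= pq; have [hp hp'] := hh (exist _ (t p) (t0 p)).
have [hq _] := hh (exist _ (t q) (t0 q)).
have tpq : t p = t q.
  by have := hp p erefl; rewrite pq => h1; have := hq q erefl; rewrite h1.
have eqs : exist (fun l => is_true (0 < l)) (t p) (t0 p) = exist _ (t q) (t0 q).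
  exact: eq_exist.
by apply: hp' => //; rewrite pq -eqs.
Qed.

(** The injection sends [X] to [size X] distinct positions, one of which is at least [(size X).-1];
    [mu] is nonincreasing. *)
Lemma lt_eigenvalue_seq P (mu : nat -> R) (X : seq index) (x : R) :
  abs_of (rdiag t) P -> eigenvalue_seq P mu -> uniq X ->
  (forall p, p \in X -> x < t p) -> (0 < size X)%N -> x < mu (size X).-1.
Proof.
move=> PT mu_eig uX xX X0; have [mu_ni _ _] := mu_eig.
have [h h_inj muh] := eigenvalue_seq_injection PT mu_eig.
have uY : uniq (map h X) by rewrite map_inj_uniq.
have [n nY nX] : exists2 n, n \in map h X & ((size X).-1 <= n)%N.
  apply: contrapT => no; have := @uniq_leq_size _ (map h X) (iota 0 (size X).-1) uY.
  rewrite size_map size_iota leqNgt prednK // leqnn => H.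
  apply: notF; apply: H => n nY; rewrite mem_iota add0n leq0n /= ltnNge.
  by apply/negP => nX; apply: no; exists n.
apply: lt_le_trans (mu_ni _ _ nX).
by have /mapP[p pX ->] := nY; rewrite muh xX.
Qed.

End eigenvalue_counting.

(** * From the spectral condition to a bound on the counting function *)

Section spectral_dimension_count.
Context {R : realType}.
Local Notation H := (l2 R).
Local Notation index := (nat * 'I_2)%type.

Lemma len_pow_van (l : nat -> R) (d : R) : 0 < d -> (forall n, 0 < l n) ->
  l @ \oo --> 0 ->
  forall e, 0 < e -> exists M : nat, forall p : index, (M <= p.1)%N -> l p.1 `^ d < e.
Proof.
move=> d0 l0 l_cv e e0; have e1 : 0 < e `^ d^-1 by exact: powR_gt0.
have /cvgr_lt /(_ _ e1) [M _ hM] := l_cv; exists M => p /hM /= h.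
rewrite -[ltRHS](_ : (e `^ d^-1) `^ d = e); last first.
  by rewrite -powRrM mulVf ?gt_eqF // powRr1 // ltW.
by apply: gt0_ltr_powR; rewrite ?nnegrE ?powR_ge0 ?(ltW (l0 _)).
Qed.

Lemma L1inf0_count_bound (l : nat -> R) (L al be : R) : (forall n, 0 < l n <= L) ->
  l @ \oo --> 0 -> 0 < al -> al < be ->
  L1inf0 (rdiag (fun p : index => l p.1 `^ al)) -> count_bound l be.
Proof.
move=> lL l_cv al0 albe [_ [mu [P PT mu_eig] mu_log]].
have l0 n : 0 < l n by have /andP[] := lL n.
have L0 : 0 < L by have /andP[h1 h2] := lL 0%N; exact: lt_le_trans h2.
have be0 : 0 < be by exact: lt_trans albe.
set t := fun p : index => l p.1 `^ al in PT *.
have t0 p : 0 < t p by exact: powR_gt0.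
have tb : bounded_coef t.
  exists (L `^ al) => p; rewrite ltW //=; have /andP[_ h] := lL p.1.
  by apply: ge0_ler_powR; rewrite ?nnegrE ?(ltW al0) ?(ltW (l0 _)) ?(ltW L0).
have t_van := len_pow_van al0 l0 l_cv.
have [mu_ni mu0 _] := mu_eig.
(* For this exponent, [n mu_n <= eta^-1 n ^ eta] and [x ^ al < mu_n] give
   [n ^ (al / be) <= eta^-1 x ^ (- al)], which bounds [n] by a multiple of [x ^ (- be)]. *)
pose eta := 1 - al / be.
have eta0 : 0 < eta by rewrite subr_gt0 ltr_pdivrMr // mul1r.
have [n0 hn0] := log_mean_decay mu_ni mu0 mu_log eta0.
have C0 : 0 <= eta^-1 by rewrite invr_ge0 ltW.
(* The first term covers the levels exceeded by at most [n0.+2] entries, to which the asymptotic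
   bound does not apply. *)
exists ((n0.+2)%:R * L `^ be + (eta^-1) `^ (be / al)) => x x0 N.
set c := count_gt l x N.
have K0 : 0 <= (eta^-1) `^ (be / al) by exact: powR_ge0.
have xb0 : 0 < x `^ (- be) by exact: powR_gt0.
have rhs0 : 0 <= n0.+2%:R * L `^ be by rewrite mulr_ge0 ?powR_ge0.
case: (leP L x) => [Lx|xL].
  have -> : c = 0.
    rewrite /c /count_gt /series /= big1 // => n _.
    have /andP[_ h] := lL n; by rewrite ltNge (le_trans h).
  by rewrite mulr_ge0 ?addr_ge0 // ltW.
pose X := [seq p <- prefix_index N | x `^ al < t p].
have uX : uniq X by rewrite filter_uniq // prefix_index_uniq.
have sX : (size X)%:R = 2 * c.
  rewrite /c -(count_gt_pow lL al0 N x0) -sum_prefix_index /X size_filter -sum1_count.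
  by rewrite big_mkcond natr_sum; apply: eq_bigr => p _; case: ifP.
have LxE : 1 <= L `^ be * x `^ (- be).
  rewrite powRN ler_pdivlMr ?powR_gt0 // mul1r.
  by apply: ge0_ler_powR; rewrite ?nnegrE ?(ltW be0) ?(ltW x0) ?(ltW L0) ?(ltW xL).
have [cn|nc] := leqP (size X) n0.+2.
  have c1 : c <= n0.+2%:R.
    have : (size X)%:R <= n0.+2%:R :> R by rewrite ler_nat.
    have := count_gt_ge0 l x N; rewrite -/c sX; lra.
  apply: le_trans c1 _; rewrite mulrDl -[leLHS]addr0; apply: lerD; last first.
    by rewrite mulr_ge0 // ltW.
  by rewrite -mulrA ler_peMr.
set n := (size X).-1; have X0 : (0 < size X)%N by exact: leq_ltn_trans nc.
have xmu : x `^ al < mu n.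
  apply: (lt_eigenvalue_seq t0 tb t_van PT mu_eig) => // p.
  by rewrite mem_filter => /andP[].
have nS : n.+1 = size X by rewrite prednK.
have n0n : (n0 <= n)%N by rewrite -ltnS nS (ltn_trans _ nc).
have nn0 : 0 < n%:R :> R by rewrite ltr0n -ltnS nS (leq_trans _ nc).
have h1 : n%:R * x `^ al <= eta^-1 * n%:R `^ eta.
  by apply: le_trans (hn0 n n0n); rewrite ler_pM2l // ltW.
have h2 : n%:R `^ (al / be) <= eta^-1 * x `^ (- al).
  rewrite powRN ler_pdivlMr ?powR_gt0 //.
  have -> : al / be = 1 - eta by rewrite /eta opprB addrCA subrr addr0.
  rewrite powRB ?(gt_eqF nn0) ?implybT // powRr1 ?(ltW nn0) //.
  by rewrite mulrAC ler_pdivrMr ?powR_gt0.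
have h3 : n%:R <= (eta^-1) `^ (be / al) * x `^ (- be).
  have -> : x `^ (- be) = (x `^ (- al)) `^ (be / al).
    by rewrite -powRrM mulNr mulrCA divff ?mulr1 // gt_eqF.
  rewrite -powRM ?powR_ge0 // -[leLHS](_ : (n%:R `^ (al / be)) `^ (be / al) = n%:R); last first.
    by rewrite -powRrM mulrA divfK ?gt_eqF // divff ?gt_eqF // powRr1 // ltW.
  apply: ge0_ler_powR; rewrite ?nnegrE ?powR_ge0 ?divr_ge0 ?(ltW al0) ?(ltW be0) //.
  by rewrite mulr_ge0 ?powR_ge0.
apply: (@le_trans _ _ n%:R).
  have : n.+1%:R = 2 * c by rewrite nS.
  have : 1 <= n%:R :> R by rewrite ler1n -(ltr0n R).
  by rewrite -natr1; lra.
apply: le_trans h3 _; rewrite mulrDl lerDr mulr_ge0 //; exact: ltW.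
Qed.

End spectral_dimension_count.

(** * Geometry of the lacunae *)

Section lacunae_theory.
Context {R : realType}.
Variables (F : set R) (a b : nat -> R).
Hypotheses (F_fractal : fractal F) (F_lacunae : lacunae F a b).

Let ab n : a n < b n. Proof. by have [h _ _] := F_lacunae. Qed.

Let F_compact : compact F. Proof. by have [_ h _ _] := F_fractal. Qed.

Let F_neq0 : F !=set0. Proof. by have [h _ _ _] := F_fractal. Qed.

Let F_has_sup : has_sup F. Proof. exact: compact_has_sup. Qed.

Let F_has_inf : has_inf F.
Proof.
have cN : compact [set - x | x in F].
  apply: continuous_compact => //; apply: continuous_subspaceT => x.
  exact: opp_continuous.
split => //; have [_ [M hM]] := compact_has_sup (image_nonempty _ F_neq0) cN.
exists (- M) => x Fx; rewrite lerNl; apply: hM; by exists x.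
Qed.

Lemma fractal_bounds x : F x -> inf F <= x <= sup F.
Proof.
have [_ ub] := F_has_sup; have [_ lb] := F_has_inf.
by move=> Fx; rewrite ge_inf //= ub_le_sup.
Qed.

Lemma lacuna_disjoint m n x : a m < x < b m -> a n < x < b n -> m = n.
Proof.
move=> xm xn; have [_ tI _] := F_lacunae.
by apply: (tI m n I I); exists x; split; rewrite /= in_itv.
Qed.

Lemma in_lacuna x : inf F <= x <= sup F -> ~ F x -> exists n, a n < x < b n.
Proof.
move=> xF nFx; have [_ _ eF] := F_lacunae.
have : (`[inf F, sup F]%classic `\` F) x by split; rewrite //= in_itv.
by rewrite eF => -[n _ /=]; rewrite in_itv /=; exists n.
Qed.

Lemma lacuna_sub n x : a n < x < b n -> inf F <= x <= sup F /\ ~ F x.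
Proof.
move=> xn; have [_ _ eF] := F_lacunae.
have : (\bigcup_n `]a n, b n[%classic) x by exists n; rewrite //= in_itv.
by rewrite -eF => -[/=]; rewrite in_itv.
Qed.

Lemma lacuna_ge_inf n : inf F <= a n.
Proof.
rewrite leNgt; apply/negP => h.
pose x := (a n + Num.min (inf F) (b n)) / 2.
have mn : a n < Num.min (inf F) (b n) by rewrite lt_min h ab.
have x1 : a n < x < b n.
  have : Num.min (inf F) (b n) <= b n by rewrite ge_min lexx orbT.
  by rewrite /x; move: mn => h1 h2; apply/andP; split; lra.
have [/andP[h1 _] _] := lacuna_sub x1.
have : Num.min (inf F) (b n) <= inf F by rewrite ge_min lexx.
by move: h1 mn; rewrite /x; lra.
Qed.

Lemma lacuna_le_sup n : b n <= sup F.
Proof.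
rewrite leNgt; apply/negP => h.
pose x := (b n + Num.max (sup F) (a n)) / 2.
have mn : Num.max (sup F) (a n) < b n by rewrite gt_max h ab.
have x1 : a n < x < b n.
  have : a n <= Num.max (sup F) (a n) by rewrite le_max lexx orbT.
  by rewrite /x; move: mn => h1 h2; apply/andP; split; lra.
have [/andP[_ h1] _] := lacuna_sub x1.
have : sup F <= Num.max (sup F) (a n) by rewrite le_max lexx.
by move: h1 mn; rewrite /x; lra.
Qed.

(** Otherwise [a n] lies in some lacuna, which meets the [n]-th one just to the right of [a n]. By
    disjointness they coincide, but an open interval does not contain its left end. *)
Lemma lacuna_left_in n : F (a n).
Proof.
apply: contrapT => nFa; have an : inf F <= a n <= sup F.
  by rewrite lacuna_ge_inf (le_trans (ltW (ab n))) // lacuna_le_sup.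
have [k /andP[ka kb]] := in_lacuna an nFa.
pose x := (a n + Num.min (b n) (b k)) / 2.
have mn : a n < Num.min (b n) (b k) by rewrite lt_min ab kb.
have h1 : Num.min (b n) (b k) <= b n by rewrite ge_min lexx.
have h2 : Num.min (b n) (b k) <= b k by rewrite ge_min lexx orbT.
have xn : a n < x < b n by rewrite /x; apply/andP; split; lra.
have xk : a k < x < b k by rewrite /x; apply/andP; split; lra.
by have nk := lacuna_disjoint xn xk; move: ka; rewrite nk ltxx.
Qed.

Lemma lacuna_right_in n : F (b n).
Proof.
apply: contrapT => nFb; have bn : inf F <= b n <= sup F.
  by rewrite lacuna_le_sup (le_trans (lacuna_ge_inf n)) // ltW.
have [k /andP[ka kb]] := in_lacuna bn nFb.
pose x := (b n + Num.max (a n) (a k)) / 2.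
have mn : Num.max (a n) (a k) < b n by rewrite gt_max ab ka.
have h1 : a n <= Num.max (a n) (a k) by rewrite le_max lexx.
have h2 : a k <= Num.max (a n) (a k) by rewrite le_max lexx orbT.
have xn : a n < x < b n by rewrite /x; apply/andP; split; lra.
have xk : a k < x < b k by rewrite /x; apply/andP; split; lra.
by have nk := lacuna_disjoint xn xk; move: kb; rewrite nk ltxx.
Qed.

Lemma lacunae_order m n : m != n -> a m <= a n -> b m <= a n.
Proof.
move=> mn amn; rewrite leNgt; apply/negP => h.
pose x := (a n + Num.min (b n) (b m)) / 2.
have mx : a n < Num.min (b n) (b m) by rewrite lt_min ab h.
have h1 : Num.min (b n) (b m) <= b n by rewrite ge_min lexx.
have h2 : Num.min (b n) (b m) <= b m by rewrite ge_min lexx orbT.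
have xn : a n < x < b n by rewrite /x; apply/andP; split; lra.
have xm : a m < x < b m by rewrite /x; apply/andP; split; lra.
by move/eqP: mn; apply; exact: lacuna_disjoint xm xn.
Qed.

Lemma len_gt0 n : 0 < len a b n. Proof. by rewrite subr_gt0. Qed.

Lemma len_le n : 0 < len a b n <= sup F - inf F.
Proof.
by rewrite len_gt0 /=; have := lacuna_ge_inf n; have := lacuna_le_sup n; rewrite /len; lra.
Qed.

Lemma series_len_le N : series (len a b) N <= sup F - inf F.
Proof.
have [_ tI _] := F_lacunae.
pose I n : set R := `]a n, b n[%classic.
have mI n : measurable (I n) by exact: measurable_itv.
have : (lebesgue_measure (\big[setU/set0]_(n < N) I n) <=
    lebesgue_measure `[inf F, sup F]%classic)%E.
  apply: le_measure; rewrite ?inE //; first by apply: bigsetU_measurable => n _; exact: mI.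
  rewrite -bigcup_mkord => x [n _]; rewrite /I /= !in_itv /= => /andP[h1 h2].
  by rewrite (le_trans (lacuna_ge_inf n) (ltW h1)) (le_trans (ltW h2) (lacuna_le_sup n)).
rewrite measure_semi_additive_ord_I //; last 3 first.
- by move=> n _; exact: mI.
- by apply: sub_trivIset tI.
- by apply: bigsetU_measurable => n _; exact: mI.
rewrite lebesgue_measure_itv /= lte_fin.
have -> : inf F < sup F.
  by rewrite (le_lt_trans (lacuna_ge_inf 0)) // (lt_le_trans (ab 0)) // lacuna_le_sup.
rewrite (eq_bigr (fun n : 'I_N => (len a b n)%:E)) => [|n _]; last first.
  by rewrite /I lebesgue_measure_itv /= lte_fin ab.
by rewrite sumEFin -EFinB lee_fin /series /= big_mkord.
Qed.

Lemma summable_len : summable_pow (len a b) 1.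
Proof.
exists (sup F - inf F) => N; apply: le_trans (series_len_le N).
by apply: ler_sum => n _; rewrite powRr1 // ltW // len_gt0.
Qed.

Lemma len_cvg0 : len a b @ \oo --> 0.
Proof.
apply: cvg_series_cvg_0; apply: nondecreasing_is_cvgn.
  by apply: series_nd => n; rewrite ltW // len_gt0.
by exists (sup F - inf F) => _ [N _ <-]; exact: series_len_le.
Qed.

(* The left endpoints of the lacunae longer than 2e lie in distinct balls of
   radius e. *)
Lemma count_le_covered e k N : 0 < e -> Defs.covered_by F e k ->
  count_gt (len a b) (2 * e) N <= k%:R.
Proof.
move=> e0 [c Fc].
pose X := [seq n <- iota 0 N | 2 * e < len a b n].
have -> : count_gt (len a b) (2 * e) N = (size X)%:R.
  rewrite /count_gt /series /= /index_iota subn0 size_filter -sum1_count.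
  by rewrite [in RHS]big_mkcond natr_sum; apply: eq_bigr => p _; case: ifP.
have ex n : exists i, closed_ball (c i) e (a n).
  by have [i _ h] := Fc _ (lacuna_left_in n); exists i.
have [i hi] := choice ex.
have close m n : i m = i n -> m != n -> a m <= a n -> len a b m <= 2 * e.
  move=> imn mn amn; have := hi m; have := hi n; rewrite imn.
  rewrite !closed_ball_itv // /= !in_itv /= => /andP[h1 h2] /andP[h3 h4].
  by have := lacunae_order mn amn; rewrite /len; lra.
have uY : uniq (map i X).
  rewrite map_inj_in_uniq ?filter_uniq ?iota_uniq // => m n.
  rewrite !mem_filter => /andP[hm _] /andP[hn _] imn.
  apply/eqP; apply: contraT => mn; case: (leP (a m) (a n)) => h.
    by have := close m n imn mn h; rewrite leNgt hm.
  by have := close n m (esym imn) _ (ltW h); rewrite eq_sym mn leNgt hn => /(_ isT).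
rewrite ler_nat -(size_map i); move/card_uniqP: uY => <-.
by rewrite -[k in leqRHS]card_ord max_card.
Qed.

End lacunae_theory.

(** * Covering numbers and the upper box dimension *)

Section box_dimension.
Context {R : realType}.
Variables (F : set R) (a b : nat -> R).
Hypotheses (F_fractal : fractal F) (F_lacunae : lacunae F a b).

Let ab n : a n < b n. Proof. by have [h _ _] := F_lacunae. Qed.

Local Notation lens := (len a b).

Let F_measurable : measurable F.
Proof.
have [_ cF _ _] := F_fractal; apply: closed_measurable.
by apply: compact_closed => //; exact: Rhausdorff.
Qed.

(* Cells of size h = 2 e that meet F either contain an end of a lacuna longer
   than e, or sup F, or are covered by F and the short lacunae; the number of
   the latter ones is controlled by their total length. *)
Lemma covering_of_summable (al C e : R) : lebesgue_measure F = 0%E -> 0 < e -> e <= 1 ->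
  0 < al -> al <= 1 -> (forall N, series (fun n => lens n `^ al) N <= C) ->
  exists2 k, Defs.covered_by F e k & k%:R <= (3 * C + 1) * e `^ (- al).
Proof.
move=> F0 e0 e1 al0 al1 sC; pose m := inf F; pose M := sup F; pose h := 2 * e.
have h0 : 0 < h by rewrite mulr_gt0.
have mF x : F x -> m <= x <= M by exact: (fractal_bounds F_fractal).
have len0 n : 0 < lens n by exact: len_gt0 F_lacunae n.
pose idx x := Num.truncn ((x - m) / h).
have idx_le x y : x <= y -> (idx x <= idx y)%N.
  by move=> xy; rewrite le_truncn // ler_pM2r ?invr_gt0 // lerD2r.
pose cell k : set R := `[m + k%:R * h, m + k.+1%:R * h[%classic.
have cellP k x : cell k x <-> m <= x /\ idx x = k.
  rewrite /cell /= in_itv /=; split.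
    move=> /andP[h1 h2]; have mx : m <= x.
      by apply: le_trans h1; rewrite lerDl mulr_ge0 // ltW.
    split => //; apply/eqP; rewrite truncn_eq ?divr_ge0 ?subr_ge0 ?(ltW h0) //.
    by rewrite ler_pdivlMr // ltr_pdivrMr // lerBrDl ltrBlDl h1.
  move=> [mx /eqP]; rewrite truncn_eq ?divr_ge0 ?subr_ge0 ?(ltW h0) //.
  by rewrite ler_pdivlMr // ltr_pdivrMr // lerBrDl ltrBlDl.
pose K := (idx M).+1.
pose A := [seq k <- iota 0 K | `[< exists2 x, F x & idx x = k >]].
have uA : uniq A by rewrite filter_uniq // iota_uniq.
have memA x : F x -> idx x \in A.
  move=> Fx; rewrite mem_filter mem_iota add0n ltnS idx_le ?andbT; last first.
    by have /andP[] := mF x Fx.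
  by apply/asboolP; exists x.
exists (size A).
  exists (fun i => m + (nth 0%N A i)%:R * h + e) => x Fx.
  have iA : (seq.index (idx x) A < size A)%N by rewrite index_mem memA.
  exists (Ordinal iA) => //; rewrite closed_ball_itv //= nth_index ?memA //.
  have /cellP : m <= x /\ idx x = idx x by have /andP[] := mF x Fx.
  rewrite /cell /= !in_itv /= -natr1 => /andP[h1 h2].
  by move: h1 h2; rewrite /h; move: (idx x)%:R => z; nra.
have [N hN] : exists N, forall n, (N <= n)%N -> lens n <= e.
  have /cvgr_le /(_ _ e0) [N _ hN] := len_cvg0 F_lacunae.
  by exists N => n /hN.
pose long := [seq n <- iota 0 N | e < lens n].
have mem_long n : e < lens n -> n \in long.
  move=> en; rewrite mem_filter en mem_iota add0n /= ltnNge.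
  by apply/negP => /hN; rewrite leNgt en.
have size_long : (size long)%:R <= C * e `^ (- al).
  have -> : (size long)%:R = count_gt lens e N.
    rewrite /count_gt /series /= /index_iota subn0 size_filter -sum1_count.
    by rewrite [in LHS]big_mkcond natr_sum; apply: eq_bigr => p _; case: ifP.
  rewrite powRN ler_pdivlMr ?powR_gt0 // mulrC; apply: le_trans (sC N).
  rewrite /count_gt /series /= big_distrr; apply: ler_sum => n _ /=.
  case: ltP => [xl|_]; rewrite ?mulr0 ?powR_ge0 // mulr1.
  by apply: ge0_ler_powR; rewrite ?nnegrE ?(ltW al0) ?(ltW e0) ?(ltW (len0 _)) ?(ltW xl).
pose bad := [seq idx (a n) | n <- long] ++ [seq idx (b n) | n <- long] ++ [:: idx M].
pose good := [seq k <- A | k \notin bad].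
have size_bad : (size [seq k <- A | k \in bad] <= (size long + size long).+1)%N.
  apply: leq_trans (_ : (size bad <= _)%N); last by rewrite !size_cat !size_map addn1 addnS.
  apply: uniq_leq_size => [|k]; first exact: filter_uniq.
  by rewrite mem_filter => /andP[].
have sizeA : (size A <= size good + (size long + size long).+1)%N.
  apply: leq_trans (_ : size good + size [seq k <- A | k \in bad] <= _)%N.
    by rewrite -(count_predC (mem bad) A) addnC !size_filter.
  by rewrite leq_add2l.
(* A good cell contains a point [y] of F. A long lacuna around [x] does not contain [y], so one of
   its ends lies between [x] and [y], in the same cell, which would be bad. *)
have good_sub k x : k \in good -> cell k x -> F x \/ exists n, a n < x < b n /\ lens n <= e.
  rewrite mem_filter => /andP[kbad]; rewrite mem_filter => /andP[/asboolP[y Fy yk] _].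
  move=> /cellP[mx xk]; have [Fx|nFx] := pselect (F x); [by left | right].
  have yM : y <= M by have /andP[] := mF y Fy.
  have xM : x <= M.
    rewrite leNgt; apply/negP => /ltW/idx_le; rewrite xk -yk => hM.
    move: kbad; rewrite /bad !mem_cat !inE negb_or negb_or => /and3P[_ _].
    by rewrite -yk eqn_leq hM idx_le.
  have xmM : inf F <= x <= sup F by rewrite mx.
  have [n xn] := in_lacuna F_lacunae xmM nFx; exists n; split => //.
  rewrite leNgt; apply/negP => /mem_long nl; case/andP: xn => ax xb.
  move: kbad; rewrite /bad !mem_cat negb_or negb_or => /and3P[ka kb _].
  have [ya|ya] := leP y (a n).
    move/negP: ka; apply; apply/mapP; exists n => //; apply/eqP.
    by rewrite eqn_leq -{1}yk idx_le // -xk idx_le // ltW.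
  have [by_|yb] := leP (b n) y.
    move/negP: kb; apply; apply/mapP; exists n => //; apply/eqP.
    by rewrite eqn_leq -{1}xk idx_le ?(ltW xb) //= -yk idx_le.
  have yn : a n < y < b n by rewrite ya.
  by have [_] := lacuna_sub F_lacunae yn.
pose B k : set R := if k \in good then cell k else set0.
have mB k : measurable (B k) by rewrite /B; case: ifP => _ //; exact: measurable_itv.
pose U := \big[setU/set0]_(k < K) B k.
have mU : measurable U by apply: bigsetU_measurable => k _; exact: mB.
have goodK k : k \in good -> (k < K)%N.
  by rewrite mem_filter => /andP[_]; rewrite mem_filter mem_iota => /andP[_ /andP[]].
have UE : lebesgue_measure U = ((size good)%:R * h)%:E.
  rewrite measure_semi_additive_ord_I; last 3 first.
  - by move=> k _; exact: mB.
  - move=> i j _ _ [x []]; rewrite /B.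
    by case: ifP => // _ /cellP[_ <-]; case: ifP => // _ /cellP[_ <-].
  - by [].
  have -> : (\sum_(k < K) lebesgue_measure (B k) = \sum_(k < K) (if (k : nat) \in good then h else 0)%:E)%E.
    apply: eq_bigr => k _; rewrite /B; case: ifP => _; last by rewrite measure0.
    rewrite lebesgue_measure_itv /= lte_fin ltrD2l ltr_pM2r // ltr_nat ltnSn.
    by rewrite -EFinB -natr1 mulrDl mul1r; congr EFin; ring.
  rewrite sumEFin; congr EFin.
  rewrite -(big_mkord xpredT (fun k => if k \in good then h else 0)) -big_mkcond.
  rewrite -big_filter (perm_big good).
    by rewrite big_const_seq count_predT iter_addr_0 mulr_natl.
  apply: uniq_perm => [||k]; [by apply: filter_uniq; exact: iota_uniq | exact: filter_uniq |].
  rewrite mem_filter mem_index_iota leq0n /=; case: (boolP (k \in good)) => //= kg.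
  exact: goodK.
pose short n : set R := if lens n <= e then `]a n, b n[%classic else set0.
pose D i : set R := if i is n.+1 then short n else F.
have mD i : measurable (D i).
  case: i => [|n] //=; rewrite /short; case: ifP => _ //; exact: measurable_itv.
have UD : U `<=` \bigcup_i D i.
  rewrite /U -bigcup_mkord => x [k _]; rewrite /B; case: ifP => // kg.
  move=> /(good_sub _ _ kg)[Fx|[n [xn en]]]; first by exists 0%N.
  by exists n.+1 => //=; rewrite /short en /= in_itv.
have shortE n : lebesgue_measure (short n) = (if lens n <= e then lens n else 0)%:E.
  rewrite /short; case: ifP => _; last by rewrite measure0.
  by rewrite lebesgue_measure_itv /= lte_fin ab.
(* A short length is [lens i ^ (1 - al)] times [lens i ^ al], and the first factor is at most
   [e ^ (1 - al)] because [al <= 1]. *)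
have short_sum n : \sum_(0 <= i < n) (if lens i <= e then lens i else 0) <= C * e `^ (1 - al).
  apply: le_trans (_ : e `^ (1 - al) * series (fun n => lens n `^ al) n <= _); last first.
    by rewrite mulrC ler_wpM2r ?powR_ge0.
  rewrite /series /= big_distrr; apply: ler_sum => i _ /=.
  case: ifP => le_i; last by rewrite mulr_ge0 ?powR_ge0.
  rewrite -[leLHS](powRr1 (ltW (len0 i))) -[X in _ `^ X](subrK al).
  rewrite powRD ?(gt_eqF (len0 i)) ?implybT // ler_wpM2r ?powR_ge0 //.
  have al1' : 0 <= 1 - al by rewrite subr_ge0.
  by apply: ge0_ler_powR; rewrite ?nnegrE ?(ltW e0) ?(ltW (len0 _)).
have ULe : (lebesgue_measure U <= (C * e `^ (1 - al))%:E)%E.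
  apply: (@le_trans _ _ (\sum_(0 <= i <oo) lebesgue_measure (D i))%E).
    exact: measure_sigma_subadditive.
  apply: lime_le; first by apply: is_cvg_nneseries.
  apply: nearW => -[|n].
    rewrite big_geq // lee_fin.
    by have := short_sum 0%N; rewrite big_geq.
  rewrite big_nat_recl //= F0 add0e (eq_bigr _ (fun i _ => shortE i)) sumEFin lee_fin.
  exact: short_sum.
have size_good : (size good)%:R <= C * e `^ (- al).
  have g0 : (size good)%:R * h <= C * e `^ (1 - al) by move: ULe; rewrite UE lee_fin.
  have eE : e `^ (1 - al) = e * e `^ (- al).
    by rewrite powRD ?(gt_eqF e0) ?implybT // powRr1 // ltW.
  rewrite -(ler_pM2r e0) -mulrA [_ * e in leRHS]mulrC -eE; apply: le_trans g0.
  by rewrite ler_wpM2l // /h; lra.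
have ea1 : 1 <= e `^ (- al).
  rewrite powRN invf_ge1 ?powR_gt0 //.
  have := @ge0_ler_powR R al (ltW al0) e 1; rewrite powR1 !nnegrE.
  by apply => //; exact: ltW.
apply: le_trans (_ : (size good + (size long + size long).+1)%:R <= _); first by rewrite ler_nat.
(* In [3 C + 1], one [C] counts the good cells, two count the ends of the long lacunae, and the 1 is
   for the cell of [sup F], as [e ^ (- al) >= 1]. *)
rewrite natrD -natr1 natrD; move: (e `^ (- al)) size_good size_long ea1 => z g1 l1 z1.
by rewrite mulrDl mul1r; lra.
Qed.

Lemma covering_number_lb e (x : R) :
  (exists k, Defs.covered_by F e k) -> (forall k, Defs.covered_by F e k -> x <= k%:R) ->
  x <= covering_number F e.
Proof.
move=> [k Fk] lb; apply: lb_le_inf; first by exists k%:R, k.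
by move=> _ [j Fj <-]; exact: lb.
Qed.

Lemma covering_number_ub e k : Defs.covered_by F e k -> covering_number F e <= k%:R.
Proof.
move=> Fk; apply: ge_inf; last by exists k.
by exists 0 => _ [j _ <-].
Qed.

Lemma covered_by_exists e : 0 < e -> exists k, Defs.covered_by F e k.
Proof.
move=> e0; have [_ cF _ _] := F_fractal.
pose h := 2 * e; have h0 : 0 < h by rewrite mulr_gt0.
pose idx x := Num.truncn ((x - inf F) / h).
exists (idx (sup F)).+1, (fun i => inf F + i%:R * h + e) => x Fx.
have /andP[mx xM] := fractal_bounds F_fractal Fx.
have i_lt : (idx x < (idx (sup F)).+1)%N.
  by rewrite ltnS le_truncn // ler_pM2r ?invr_gt0 // lerD2r.
exists (Ordinal i_lt) => //; rewrite closed_ball_itv //= in_itv /=.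
have /truncn_itv : 0 <= (x - inf F) / h by rewrite divr_ge0 ?subr_ge0 // ltW.
rewrite -/(idx x) ler_pdivlMr // ltr_pdivrMr // -natr1 => /andP[].
by rewrite /h; move: (idx x)%:R => z; nra.
Qed.

Lemma covering_number_ge1 e : 0 < e -> 1 <= covering_number F e.
Proof.
move=> e0; apply: covering_number_lb; first exact: covered_by_exists.
move=> [|k] [c Fc]; last by rewrite ler1n.
have [[x Fx] _ _ _] := F_fractal.
by have [[]] := Fc x Fx.
Qed.

Lemma upper_box_dim_ge0 : (0 <= upper_box_dim F)%E.
Proof.
rewrite /upper_box_dim limf_esupE; apply: le_ereal_inf_tmp => _ [V V0 <-].
have V1 : (0 : R)^'+ (V `&` [set e | 0 < e < 1]).
  apply: filterI => //; near=> e; rewrite /=; apply/andP; split => //.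
have [e [Ve /andP[e0 e1]]] := filter_ex V1.
apply: ereal_sup_ge; exists (ln (covering_number F e) / - ln e)%:E; first by exists e.
rewrite lee_fin divr_ge0 ?ln_ge0 ?covering_number_ge1 // oppr_ge0.
by rewrite ln_le0 // ltW.
Unshelve. all: by end_near. Qed.

Lemma upper_box_dim_le (al C e0 : R) : 0 < e0 -> 0 < al ->
  (forall e, 0 < e -> e <= e0 -> covering_number F e <= C * e `^ (- al)) ->
  (upper_box_dim F <= al%:E)%E.
Proof.
move=> e0_gt0 al0 cov; apply/lee_addgt0Pr => d d0.
rewrite /upper_box_dim limf_esupE.
pose C1 := Num.max C 1; have C1_1 : 1 <= C1 by rewrite le_max lexx orbT.
have C1_0 : 0 < C1 by exact: lt_le_trans C1_1.
(* Below [e1] one has [ln C1 <= d (- ln e)], so that the constant costs at most [d] in the exponent;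
   the added 1 keeps [- ln e] positive even if [ln C1 = 0]. *)
pose e1 := Num.min e0 (expR (- (ln C1 / d + 1))).
have e1_gt0 : 0 < e1 by rewrite lt_min e0_gt0 expR_gt0.
apply: ge_ereal_inf; exists (ereal_sup ((fun e => (ln (covering_number F e) / - ln e)%:E) @` [set e | 0 < e < e1])).
  exists [set e | 0 < e < e1] => //.
  by near=> e => /=; apply/andP; split.
apply: ge_ereal_sup => _ [e /andP[e_gt0 ee1] <-]; rewrite -EFinD lee_fin.
have ee0 : e <= e0 by apply: ltW; apply: lt_le_trans ee1 _; rewrite ge_min lexx.
have lne : ln C1 / d + 1 <= - ln e.
  rewrite lerNr -ler_expR lnK ?posrE //; apply: ltW; apply: lt_le_trans ee1 _.
  by rewrite ge_min lexx orbT.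
have lnC : 0 <= ln C1 by exact: ln_ge0.
have lne0 : 0 < - ln e by apply: lt_le_trans lne; rewrite ltr_wpDl // divr_ge0 // ltW.
have N1 := covering_number_ge1 e_gt0.
have N0 : 0 < covering_number F e by exact: lt_le_trans N1.
rewrite ler_pdivrMr //.
have h1 : ln (covering_number F e) <= ln C1 + al * (- ln e).
  have -> : al * - ln e = ln (e `^ (- al)) by rewrite ln_powR; ring.
  rewrite -lnM ?posrE ?powR_gt0 //; rewrite ler_ln ?posrE ?mulr_gt0 ?powR_gt0 //.
  apply: le_trans (cov e e_gt0 ee0) _; rewrite ler_pM2r ?powR_gt0 //.
  by rewrite le_max lexx.
have h2 : ln C1 <= d * (- ln e).
  rewrite -ler_pdivrMl // mulrC; apply: le_trans lne; by rewrite lerDl.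
by apply: le_trans h1 _; rewrite mulrDl addrC lerD2l.
Unshelve. all: by end_near. Qed.

Lemma upper_box_dim_le_summable (al : R) : lebesgue_measure F = 0%E -> 0 < al ->
  summable_pow lens al -> (upper_box_dim F <= al%:E)%E.
Proof.
move=> F0 al0 sal.
have le1 (be : R) : 0 < be -> be <= 1 -> summable_pow lens be -> (upper_box_dim F <= be%:E)%E.
  move=> be0 be1 [C sC]; apply: (@upper_box_dim_le be (3 * C + 1) 1) => // e e0 e1.
  have [k Fk kC] := covering_of_summable F0 e0 e1 be0 be1 sC.
  by apply: le_trans kC; exact: covering_number_ub.
(* The covering argument applies to exponents up to 1; beyond, the convergent series of the lengths
   gives the bound 1. *)
case: (leP al 1) => [al1|/ltW al1]; first exact: le1.
apply: (@le_trans _ _ 1%:E); last by rewrite lee_fin.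
by apply: le1 => //; exact: (summable_len F_lacunae).
Qed.

Lemma count_bound_of_box_dim (al : R) : 0 < al -> (upper_box_dim F < al%:E)%E ->
  count_bound lens al.
Proof.
move=> al0; rewrite /upper_box_dim limf_esupE => /ereal_inf_lt[_ [V V0 <-] Val].
have [e1 /= e1_gt0 hV] : exists2 e1, 0 < e1 & forall e, 0 < e -> e < e1 -> V e.
  case: V0 => e1 /= e1_gt0 hV; exists e1 => // e e_gt0 ee1.
  by apply: hV => //=; rewrite sub0r normrN gtr0_norm.
pose e2 := Num.min e1 1 / 2.
have e2_gt0 : 0 < e2 by rewrite divr_gt0 // lt_min e1_gt0 ltr01.
have e2e1 : e2 < e1.
  have : Num.min e1 1 <= e1 by rewrite ge_min lexx.
  by rewrite /e2; lra.
have e21 : e2 < 1.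
  have : Num.min e1 1 <= 1 by rewrite ge_min lexx orbT.
  by rewrite /e2; lra.
have small e N : 0 < e -> e <= e2 -> count_gt lens (2 * e) N <= e `^ (- al).
  move=> e0 ee2; have Ve : V e by apply: hV => //; exact: le_lt_trans e2e1.
  have elt1 : e < 1 by exact: le_lt_trans e21.
  have lne : 0 < - ln e by rewrite oppr_gt0 ln_lt0 // e0.
  have N0 : 0 < covering_number F e by apply: lt_le_trans (covering_number_ge1 e0).
  apply: (@le_trans _ _ (covering_number F e)).
    apply: covering_number_lb; first exact: covered_by_exists.
    by move=> k Fk; exact: (count_le_covered F_lacunae N e0 Fk).
  have : ((ln (covering_number F e) / - ln e)%:E < al%:E)%E.
    apply: le_lt_trans Val; apply: ereal_sup_ubound; by exists e.
  rewrite lte_fin ltr_pdivrMr // => h; apply: ltW.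
  by rewrite -ltr_ln ?posrE ?powR_gt0 // ln_powR mulNr -mulrN.
pose L := sup F - inf F.
have lL n : 0 < lens n <= L by exact: (len_le F_lacunae).
have L0 : 0 < L by have /andP[h1 h2] := lL 0%N; exact: lt_le_trans h2.
(* The radius [x / 2] produces the factor [2 ^ al]. The second term covers [x] between [2 e2] and
   [L], where the count is at most the one at [2 e2]. *)
exists (2 `^ al + e2 `^ (- al) * L `^ al) => x x0 N.
have x20 : 0 < x / 2 by rewrite divr_gt0.
have xa0 : 0 < x `^ (- al) by exact: powR_gt0.
have c1 : 0 <= 2 `^ al :> R by exact: powR_ge0.
have c2 : 0 <= e2 `^ (- al) * L `^ al by rewrite mulr_ge0 ?powR_ge0.
case: (leP (x / 2) e2) => [xe|ex].
  have -> : x = 2 * (x / 2) by rewrite mulrCA divff ?mulr1 // pnatr_eq0.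
  apply: le_trans (small _ N x20 xe) _.
  rewrite [(2 * (x / 2)) `^ _]powRM ?(ltW x20) // mulrDl mulrA -powRD ?pnatr_eq0 ?implybT //.
  rewrite subrr powRr0 mul1r lerDl mulr_ge0 //.
  by rewrite mulr_ge0 ?powR_ge0.
case: (leP L x) => [Lx|xL].
  have -> : count_gt lens x N = 0.
    rewrite /count_gt /series /= big1 // => n _.
    have /andP[_ h] := lL n; by rewrite ltNge (le_trans h).
  by rewrite mulr_ge0 ?addr_ge0 // ltW.
apply: (@le_trans _ _ (e2 `^ (- al))).
  apply: le_trans (small _ N e2_gt0 (lexx _)); apply: ler_sum => n _.
  rewrite ler_nat; case: (ltP x (lens n)) => //= h.
  by rewrite (lt_trans _ h) //; move: ex; rewrite ltr_pdivlMr // mulrC.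
rewrite mulrDl -[leLHS]add0r lerD //; first by rewrite mulr_ge0 // ltW.
rewrite -mulrA ler_peMr ?powR_ge0 // powRN ler_pdivlMr ?powR_gt0 // mul1r.
by apply: ge0_ler_powR; rewrite ?nnegrE ?(ltW al0) ?(ltW x0) ?(ltW L0) ?(ltW xL).
Qed.

End box_dimension.

(** * Probability measures from monotone functions *)

Lemma lebesgue_stieltjes_measure_itv {R : realType} (f : cumulativeBounded (0 : R) (1 : R)) x y :
  x <= y -> lebesgue_stieltjes_measure f `]x, y]%classic = (f y - f x)%:E.
Proof.
move=> xy; rewrite /lebesgue_stieltjes_measure /measure_extension/=.
rewrite measurable_mu_extE/= ?wlength_itv_bnd//; exact: is_ocitv.
Qed.

Section right_continuous_regularization.
Context {R : realType}.
Variables (G : R -> R) (u v : R).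
Hypotheses (G_nd : {homo G : x y / x <= y}) (G_low : forall x, x < u -> G x = 0)
  (G_high : forall x, v < x -> G x = 1).

(** The right limit of a nondecreasing [G]. It replaces [cdf], which comes from a merely finitely
    additive functional and so may fail to be right continuous. *)
Definition right_reg (x : R) : R := inf [set G y | y in [set y | x < y]].

Let G_ge0 x : 0 <= G x.
Proof.
rewrite -(G_low (x := Num.min x u - 1)); last first.
  by rewrite ltrBlDr (@le_lt_trans _ _ u) ?ltrDl // ge_min lexx orbT.
by apply: G_nd; rewrite lerBlDr (@le_trans _ _ x) ?ge_min ?lexx // lerDl.
Qed.

Lemma right_reg_ge x : G x <= right_reg x.
Proof.
apply: lb_le_inf; first by exists (G (x + 1)), (x + 1) => //=; rewrite ltrDl.
by move=> _ [y /= xy <-]; apply: G_nd; exact: ltW.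
Qed.

Lemma right_reg_le x y : x < y -> right_reg x <= G y.
Proof.
by move=> xy; apply: ge_inf; [exists 0 => _ [z _ <-] | exists y].
Qed.

Lemma right_reg_nd : {homo right_reg : x y / x <= y}.
Proof.
move=> x y; rewrite le_eqVlt => /orP[/eqP-> //|xy].
by apply: le_trans (right_reg_le xy) (right_reg_ge y).
Qed.

Lemma right_reg_rc : right_continuous right_reg.
Proof.
move=> x; apply/cvgrPdist_le => e e0.
have [z [y /= xy <-] yH] : exists2 z, [set G y | y in [set y | x < y]] z & z < right_reg x + e.
  apply: inf_adherent => //; split; first by exists (G (x + 1)), (x + 1) => //=; rewrite ltrDl.
  by exists 0 => _ [z _ <-].
near=> t; rewrite distrC ger0_norm ?subr_ge0; last first.
  by apply: right_reg_nd; apply: ltW.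
rewrite lerBlDl; apply: le_trans (ltW yH); apply: right_reg_le.
by near: t; exact: nbhs_right_lt.
Unshelve. all: by end_near. Qed.

Lemma right_reg_Ny : right_reg @ -oo --> (0 : R).
Proof.
apply: cvg_near_cst; apply: filterS (nbhs_ninfty_lt (num_real u)) => x xu.
apply/eqP; rewrite eq_le (le_trans (G_ge0 x) (right_reg_ge x)) andbT.
have h : x < (x + u) / 2 < u by apply/andP; split; lra.
by case/andP: h => h1 h2; rewrite -(G_low h2); exact: right_reg_le.
Qed.

Lemma right_reg_y : right_reg @ +oo --> (1 : R).
Proof.
apply: cvg_near_cst; apply: filterS (nbhs_pinfty_gt (num_real v)) => x vx.
apply/eqP; rewrite eq_le; apply/andP; split; last by rewrite -(G_high vx) right_reg_ge.
by rewrite -(G_high (x := x + 1)) ?right_reg_le ?ltrDl // (lt_trans vx) // ltrDl.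
Qed.

Lemma right_reg_probability : exists mu : probability (measurableTypeR R) R,
  forall x y, x <= y -> mu `]x, y]%classic = (right_reg y - right_reg x)%:E.
Proof.
pose c := isCumulative.Build R _ R right_reg right_reg_nd right_reg_rc.
pose cb := isCumulativeBounded.Build R 0 1 right_reg right_reg_Ny right_reg_y.
pose H : cumulativeBounded (0 : R) (1 : R) := HB.pack right_reg c cb.
exists (lebesgue_stieltjes_measure H) => x y xy.
exact: (@lebesgue_stieltjes_measure_itv R H).
Qed.

End right_continuous_regularization.

(** * The positive functional on functions of the endpoints *)

Section weighted_functional.
Context {R : realType}.
Local Notation H := (l2 R).
Local Notation index := (nat * 'I_2)%type.
Variables (tau : (H -> H) -> \bar R) (t : index -> R).
Hypotheses (tau_w : tracial_weight tau) (tb : bounded_coef t) (tau1 : tau (rdiag t) = 1%E).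
Implicit Types (g h : index -> R).

Definition weighted g : H -> H := rdiag (fun p => g p * t p).

Definition functional g : R := fine (tau (weighted g)).

Lemma bounded_coefM g : bounded_coef g -> bounded_coef (fun p => g p * t p).
Proof.
move=> [K gK]; have [M tM] := tb; exists (K * M) => p.
have /andP[g0 gK'] := gK p; have /andP[t0 tM'] := tM p.
by rewrite mulr_ge0 //= ler_pM.
Qed.

Lemma bounded_coefD g h : bounded_coef g -> bounded_coef h ->
  bounded_coef (fun p => g p + h p).
Proof.
move=> [K gK] [M hM]; exists (K + M) => p.
have /andP[g0 gK'] := gK p; have /andP[h0 hM'] := hM p.
by rewrite addr_ge0 //= lerD.
Qed.

Lemma weighted_positive g : bounded_coef g -> positive_op (weighted g).
Proof. by move=> gb; apply: rdiag_positive; exact: bounded_coefM. Qed.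

Lemma weightedE g x p : bounded_coef g -> weighted g x p = (g p * t p)%:C * x p.
Proof. by move=> gb; rewrite /weighted rdiagE //; exact: bounded_coefM. Qed.

Lemma weightedD g h : bounded_coef g -> bounded_coef h ->
  weighted (fun p => g p + h p) = weighted g + weighted h.
Proof.
move=> gb hb; apply/funext => x; apply: l2_eq => p.
rewrite weightedE; last exact: bounded_coefD.
by rewrite fctE l2addE !weightedE // mulrDl rmorphD mulrDl.
Qed.

Lemma weightedZ (c : R) g : 0 <= c -> bounded_coef g ->
  weighted (fun p => c * g p) = c%:C *: weighted g.
Proof.
move=> c0 gb; apply/funext => x; apply: l2_eq => p; rewrite weightedE; last first.
  have [K gK] := gb; exists (c * K) => q; have /andP[g0 gK'] := gK q.
  by rewrite mulr_ge0 //= ler_wpM2l.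
by rewrite fctE l2scaleE weightedE // -mulrA rmorphM mulrA.
Qed.

Lemma weighted1 : weighted (fun=> 1) = rdiag t.
Proof. by congr rdiag; apply/funext => p; rewrite mul1r. Qed.

Lemma bounded_coef_cst (c : R) : 0 <= c -> bounded_coef (fun=> c).
Proof. by move=> c0; exists c => p; rewrite c0 lexx. Qed.

(** The values at [g] and at its complement [K - g] are nonnegative and add up to [K], so both are
    finite. *)
Lemma tau_weighted g : bounded_coef g -> tau (weighted g) = (functional g)%:E.
Proof.
move=> gb; have [K gK] := gb; have [tau0 tauD tauZ _] := tau_w.
have K0 : 0 <= K by have /andP[h1 h2] := gK (0%N, ord0); exact: le_trans h2.
have hb : bounded_coef (fun p => K - g p).
  exists K => p; have /andP[g0 gK'] := gK p.
  by rewrite subr_ge0 gK' /= lerBlDr lerDl.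
have E : (tau (weighted g) + tau (weighted (fun p => (K - g p)%R)) = K%:E)%E.
  rewrite -(tauD _ _ (weighted_positive gb) (weighted_positive hb)) -(weightedD gb hb).
  have -> : (fun p => g p + (K - g p)) = fun p => K * 1.
    by apply/funext => p; rewrite addrC subrK mulr1.
  rewrite weightedZ //; last exact: bounded_coef_cst.
  by rewrite tauZ // weighted1 ?tau1 ?mule1 //; exact: rdiag_positive.
rewrite fineK // ge0_fin_numE; last by apply: tau0; exact: weighted_positive.
apply: (@le_lt_trans _ _ K%:E); last exact: ltry.
by rewrite -E leeDl //; apply: tau0; exact: weighted_positive.
Qed.

Lemma functional_ge0 g : bounded_coef g -> 0 <= functional g.
Proof.
move=> gb; have [tau0 _ _ _] := tau_w.
by rewrite -lee_fin -tau_weighted //; apply: tau0; exact: weighted_positive.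
Qed.

Lemma functionalD g h : bounded_coef g -> bounded_coef h ->
  functional (fun p => g p + h p) = functional g + functional h.
Proof.
move=> gb hb; have [_ tauD _ _] := tau_w.
apply: EFin_inj; rewrite EFinD -!tau_weighted //; last exact: bounded_coefD.
by rewrite weightedD // tauD //; exact: weighted_positive.
Qed.

Lemma functionalZ (c : R) g : 0 <= c -> bounded_coef g ->
  functional (fun p => c * g p) = c * functional g.
Proof.
move=> c0 gb; have [_ _ tauZ _] := tau_w.
apply: EFin_inj; rewrite EFinM -(tau_weighted gb) /functional weightedZ // tauZ.
- by rewrite tau_weighted.
- by [].
- exact: weighted_positive.
Qed.

Lemma functional1 : functional (fun=> 1) = 1.
Proof. by rewrite /functional weighted1 tau1. Qed.

Lemma functional0 : functional (fun=> 0) = 0.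
Proof.
have -> : (fun=> 0 : R) = (fun p : index => 0 * 1 : R).
  by apply/funext => p; rewrite mul0r.
by rewrite functionalZ ?mul0r //; exact: bounded_coef_cst.
Qed.

Lemma functional_le g h : bounded_coef g -> bounded_coef h ->
  (forall p, g p <= h p) -> functional g <= functional h.
Proof.
move=> gb hb gh; have [K hK] := hb.
have db : bounded_coef (fun p => h p - g p).
  have [M gM] := gb; exists K => p; rewrite subr_ge0 gh /=.
  have /andP[_ h1] := hK p; have /andP[g0 _] := gM p.
  by rewrite lerBlDr (le_trans h1) // lerDl.
have -> : h = fun p => g p + (h p - g p) by apply/funext => p; rewrite addrC subrK.
by rewrite functionalD // lerDl functional_ge0.
Qed.

End weighted_functional.

(** * The representing measure and its integrals of nonnegative functions *)

Section hausdorff_besicovitch.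
Context {R : realType}.
Local Notation H := (l2 R).
Local Notation index := (nat * 'I_2)%type.
Variables (F : set R) (a b : nat -> R).
Hypotheses (F_fractal : fractal F) (F_lacunae : lacunae F a b).
Variables (tau : (H -> H) -> \bar R) (t : index -> R).
Hypotheses (tau_w : tracial_weight tau) (tb : bounded_coef t) (tau1 : tau (rdiag t) = 1%E).

Local Notation ep := (endpoint a b).
Local Notation phi := (functional tau t).

Lemma fractal_compact : compact F.
Proof. by have [] := F_fractal. Qed.

Lemma fractal_closed : closed F.
Proof. by apply: compact_closed fractal_compact; exact: Rhausdorff. Qed.

Lemma fractal_measurable : measurable F.
Proof. exact: closed_measurable fractal_closed. Qed.

Lemma endpoint_in p : F (ep p).
Proof.
rewrite /endpoint; case: ifP => _; first exact: lacuna_left_in F_lacunae _.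
exact: lacuna_right_in F_lacunae _.
Qed.

Definition cdf (c : R) : R := phi (fun p => (ep p <= c)%R%:R).

Lemma bounded_coef_ind (Q : pred index) : bounded_coef (fun p => (Q p)%:R : R).
Proof. by exists 1 => p; rewrite ler0n lern1 leq_b1. Qed.
Hint Resolve bounded_coef_ind : core.

Lemma cdf_sub c d : c <= d -> cdf d - cdf c = phi (fun p => (c < ep p <= d)%R%:R).
Proof.
move=> cd; rewrite /cdf -[X in X - _](_ : phi (fun p => (ep p <= c)%R%:R + (c < ep p <= d)%R%:R) = _).
  by rewrite functionalD // addrC addKr.
congr phi; apply/funext => p; case: (leP (ep p) c) => /= [h|h].
  by rewrite addr0 (le_trans h cd).
by rewrite add0r.
Qed.

Lemma cdf_nd : {homo cdf : x y / x <= y}.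
Proof.
by move=> x y xy; rewrite -subr_ge0 cdf_sub // functional_ge0.
Qed.

Lemma cdf_low x : x < inf F -> cdf x = 0.
Proof.
move=> xF; rewrite /cdf (_ : (fun p => _) = fun=> 0) ?functional0 //.
apply/funext => p; have /andP[h _] := fractal_bounds F_fractal (endpoint_in p).
by rewrite leNgt (lt_le_trans xF h).
Qed.

Lemma cdf_high x : sup F < x -> cdf x = 1.
Proof.
move=> xF; rewrite /cdf (_ : (fun p => _) = fun=> 1) ?functional1 //.
apply/funext => p; have /andP[_ h] := fractal_bounds F_fractal (endpoint_in p).
by rewrite (le_trans h (ltW xF)).
Qed.

Lemma notin_closed_itv x : ~ F x -> exists2 d, 0 < d & forall y, `|x - y| < d -> ~ F y.
Proof.
move=> nFx; have : nbhs x (~` F) by apply: open_nbhs_nbhs; split => //; exact: closed_openC fractal_closed.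
by move=> [d /= d0 hd]; exists d => // y xy; exact: hd.
Qed.

Lemma right_reg_cdf c : ~ F c -> right_reg cdf c = cdf c.
Proof.
move=> nFc; have [d d0 hd] := notin_closed_itv nFc.
apply/eqP; rewrite eq_le (right_reg_ge cdf_nd) andbT.
have cd : c < c + d / 2 by rewrite ltrDl divr_gt0.
have -> : cdf c = cdf (c + d / 2).
  apply/esym/eqP; rewrite -subr_eq0 cdf_sub ?(ltW cd) // -(functional0 tau_w tb tau1).
  apply/eqP; congr phi; apply/funext => p.
  case: (boolP (c < ep p <= c + d / 2)) => //= /andP[h1 h2].
  case: (hd (ep p) _ (endpoint_in p)).
  by rewrite ltr_norml; apply/andP; split; lra.
exact: (right_reg_le cdf_nd cdf_low cd).
Qed.

Lemma cut_point (u v : R) : u < v -> exists2 c, u < c < v & ~ F c.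
Proof.
move=> uv; apply: contrapT => no.
have sub : `]u, v[%classic `<=` F.
  move=> x; rewrite /= in_itv /= => xuv; apply: contrapT => nFx; apply: no.
  by exists x.
pose x := (u + v) / 2; have xuv : u < x < v by rewrite /x; apply/andP; split; lra.
pose y := (u + x) / 2; have yuv : u < y < v.
  by rewrite /y; move: xuv => /andP[h1 h2]; apply/andP; split; lra.
have [_ _ td _] := F_fractal.
have xF : F x by apply: sub; rewrite /= in_itv.
have h : connected_component F x y.
  apply: (@connected_component_max _ F `]u, v[%classic x) => //=; rewrite ?in_itv //.
  exact/connected_intervalP/interval_is_interval.
move: h; rewrite td //= => yx; move: yx xuv; rewrite /y => h /andP[h1 _].
by move: h h1; lra.
Qed.

Section representation.
Variable mu : probability (measurableTypeR R) R.
Hypothesis muE : forall x y, x <= y ->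
  mu `]x, y]%classic = (right_reg cdf y - right_reg cdf x)%:E.

Lemma mu_itv c d : ~ F c -> ~ F d -> c <= d ->
  mu `]c, d]%classic = (phi (fun p => (c < ep p <= d)%R%:R))%:E.
Proof. by move=> nc nd cd; rewrite muE // !right_reg_cdf // cdf_sub. Qed.

(** The complement of F is covered by countably many intervals with rational ends whose closures
    miss F; each contains no endpoint of a lacuna and so is null. *)
Lemma mu_F : mu F = 1%E.
Proof.
pose J (q : rat * rat) : set R :=
  if `[< (forall x, ratr q.1 <= x <= ratr q.2 -> ~ F x) /\ ratr q.1 <= ratr q.2 :> R >]
  then `]ratr q.1, ratr q.2]%classic else set0.
pose A k : set R := oapp J set0 (unpickle k).
have mA k : measurable (A k).
  rewrite /A; case: unpickle => [q|] /=; last exact: measurable0.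
  rewrite /J; case: ifP => _; [exact: measurable_itv | exact: measurable0].
have A0 k : mu (A k) = 0%E.
  rewrite /A; case: unpickle => [q|]; last exact: measure0.
  rewrite /= /J; case: ifP => [/asboolP[nq q12]|_]; last exact: measure0.
  have n1 : ~ F (ratr q.1) by apply: nq; rewrite lexx.
  have n2 : ~ F (ratr q.2) by apply: nq; rewrite lexx andbT.
  rewrite mu_itv // (_ : (fun p => _) = fun=> 0) ?functional0 //.
  apply/funext => p; case: (boolP (_ < _ <= _)) => //= /andP[h1 h2].
  by case: (nq (ep p) _ (endpoint_in p)); rewrite (ltW h1).
have FA : ~` F `<=` \bigcup_k A k.
  move=> x nFx; have [d d0 hd] := notin_closed_itv nFx.
  have [q1 /andP[q1a q1b]] : exists q : rat, x - d < ratr q < x.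
    have xd : x - d < x by rewrite ltrBlDr ltrDl.
    by have [q] := rat_in_itvoo xd; rewrite in_itv /=; exists q.
  have [q2 /andP[q2a q2b]] : exists q : rat, x < ratr q < x + d.
    have xd : x < x + d by rewrite ltrDl.
    by have [q] := rat_in_itvoo xd; rewrite in_itv /=; exists q.
  have [k kE] : exists k, unpickle k = Some (q1, q2).
    by exists (pickle (q1, q2)); rewrite pickleK.
  exists k => //; rewrite /A kE /= /J asboolT.
    by rewrite /= in_itv /= q1b ltW.
  split; last by rewrite ltW // (lt_trans q1b).
  move=> y /andP[h1 h2]; apply: hd; rewrite ltr_norml.
  by apply/andP; split; lra.
have mF := fractal_measurable.
have C0 : mu (~` F) = 0%E.
  apply/eqP; rewrite eq_le measure_ge0 andbT.
  apply: (@le_trans _ _ (\sum_(0 <= k <oo) mu (A k))%E).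
    by apply: measure_sigma_subadditive => //; exact: measurableC.
  by rewrite eseries0.
have := probability_setC mu (measurableC mF).
by rewrite setCK C0 sube0.
Qed.

Section integral.
Variable f : R -> R.
Hypothesis f_cont : {within F, continuous f}.

Lemma fractal_continuous_bounded : exists2 K, 0 <= K & forall x, F x -> `|f x| <= K.
Proof.
have /compact_bounded[M [_ hM]] := continuous_compact f_cont fractal_compact.
exists (Num.max (M + 1) 0); first by rewrite le_max lexx orbT.
by move=> x Fx; rewrite le_max; apply/orP; left; apply: hM; [rewrite ltrDl | exists x].
Qed.

Lemma uniform_continuity e : 0 < e ->
  exists2 d, 0 < d & forall x y, F x -> F y -> `|x - y| < d -> `|f x - f y| < e.
Proof.
move=> e0; have := (compact_near_coveringP F).1 fractal_compact R (0 : R)^'+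
  (fun d x => F x -> forall y, F y -> `|x - y| < d -> `|f x - f y| < e).
move=> /(_ _) [].
  move=> x Fx.
  have e2 : 0 < e / 2 by rewrite divr_gt0.
  have [r r0 hr] : exists2 r, 0 < r & forall y, F y -> `|x - y| < r -> `|f x - f y| < e / 2.
    have /cvgrPdist_lt /(_ _ e2) [r /= r0 hr] := ((subspace_continuousP F f).1 f_cont) x Fx.
    by exists r => // y Fy xy; exact: hr.
  exists (ball x (r / 2), [set d | 0 < d < r / 2]).
    split; first by apply: nbhsx_ballx; rewrite divr_gt0.
    by near=> d => /=; apply/andP; split; near: d; [exact: nbhs_right_gt | apply: nbhs_right_lt; rewrite divr_gt0].
  move=> [x' d] /= [xx' /andP[d0 dr]] Fx' y Fy x'y.
  have h1 : `|f x - f x'| < e / 2.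
    by apply: hr => //; apply: lt_le_trans xx' _; lra.
  have h2 : `|f x - f y| < e / 2.
    apply: hr => //; rewrite -(subrK x' x) -addrA; apply: le_lt_trans (ler_normD _ _) _.
    by have := xx' : `|x - x'| < r / 2; lra.
  rewrite -(subrK (f x) (f x')) -addrA; apply: le_lt_trans (ler_normD _ _) _.
  by rewrite distrC; lra.
move=> d /= d0 hd; exists (d / 2); first by rewrite divr_gt0.
move=> x y Fx Fy; apply: (hd (d / 2)) => //=.
  by rewrite sub0r normrN gtr0_norm ?divr_gt0 //; lra.
by rewrite divr_gt0.
Unshelve. all: by end_near. Qed.

Lemma fractal_integrable (E : set R) : measurable E -> E `<=` F ->
  mu.-integrable E (EFin \o f).
Proof.
move=> mE EF; apply: measurable_bounded_integrable => //.
- by apply: (@le_lt_trans _ _ 1%E); [exact: probability_le1 | exact: ltry].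
- apply: (@measurable_funS _ _ _ _ F) => //; first exact: fractal_measurable.
  exact: (subspace_continuous_measurable_fun fractal_measurable f_cont).
- have [K K0 hK] := fractal_continuous_bounded; exists K; split; first exact: num_real.
  by move=> M KM x /= /EF Fx; apply: le_trans (hK x Fx) _; exact: ltW.
Qed.

Hypothesis f0 : forall x, F x -> 0 <= f x.

Lemma bounded_coef_comp (Q : pred index) : bounded_coef (fun p => f (ep p) * (Q p)%:R).
Proof.
have [K K0 hK] := fractal_continuous_bounded; exists K => p.
case: (Q p); rewrite ?mulr1 ?mulr0 ?lexx ?K0 //.
have Fp := endpoint_in p.
by rewrite f0 // (le_trans (ler_norm _)) ?hK.
Qed.
Hint Resolve bounded_coef_comp : core.

(** Both quantities are within [e m] of [f xi m], where [xi] is a point of F in the cell and [m] its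
    mass; this explains the factor 2. A cell without points of F contains no endpoint, and both
    quantities vanish. *)
Lemma cell_estimate (e d c c' : R) : 0 < e ->
  (forall x y, F x -> F y -> `|x - y| < d -> `|f x - f y| < e) ->
  ~ F c -> ~ F c' -> c <= c' -> c' - c < d ->
  `|phi (fun p => f (ep p) * (c < ep p <= c')%R%:R)
    - \int[mu]_(x in F `&` `]c, c']%classic) f x| <= 2 * e * phi (fun p => (c < ep p <= c')%R%:R).
Proof.
move=> e0 hd nc nc' cc' cd; set E := F `&` _; set m := phi (fun p => (_ < _ <= _)%R%:R).
have mF := fractal_measurable.
have mE : measurable E by apply: measurableI => //; exact: measurable_itv.
have EF : E `<=` F by exact: subIsetl.
have m0 : 0 <= m by exact: functional_ge0.
have [[xi [Fxi]]|E0] := pselect (E !=set0); last first.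
  have E0' : E = set0 by apply/eqP; apply: contrapT => /negP/set0P.
  rewrite E0' Rintegral_set0 subr0 (_ : (fun p => _) = fun=> 0) ?functional0 //.
    by rewrite normr0 mulr_ge0 // mulr_ge0 // ltW.
  apply/funext => p; case: (boolP (c < ep p <= c')) => h; rewrite ?mulr0 //.
  by case: E0; exists (ep p); split; [exact: endpoint_in | rewrite /= in_itv].
rewrite /= in_itv /= => /andP[cxi xic].
have near_xi x : F x -> c < x <= c' -> f xi - e <= f x <= f xi + e.
  move=> Fx /andP[cx xc]; have : `|f xi - f x| < e.
    by apply: hd => //; rewrite ltr_norml; apply/andP; split; lra.
  by rewrite ltr_norml => /andP[h1 h2]; apply/andP; split; lra.
have fxi0 := f0 Fxi.
have eb : bounded_coef (fun p : index => e * (c < ep p <= c')%R%:R).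
  by exists e => p; case: (_ < _ <= _); rewrite ?mulr1 ?mulr0 ?lexx ?(ltW e0).
have ub : phi (fun p => f (ep p) * (c < ep p <= c')%R%:R) <= (f xi + e) * m.
  rewrite -functionalZ ?addr_ge0 ?(ltW e0) //; apply: functional_le => //.
    exists (f xi + e) => p; have h : 0 <= f xi + e by rewrite addr_ge0 // ltW.
    by case: (_ < _ <= _); rewrite ?mulr1 ?mulr0 ?h ?lexx.
  move=> p; case: (boolP (c < ep p <= c')) => h; rewrite ?mulr0 // !mulr1.
  by have /andP[] := near_xi _ (endpoint_in p) h.
have lb : f xi * m <= phi (fun p => f (ep p) * (c < ep p <= c')%R%:R) + e * m.
  rewrite -functionalZ // -[e * m]functionalZ ?(ltW e0) // -functionalD //.
  apply: functional_le => //.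
  - by exists (f xi) => p; case: (_ < _ <= _); rewrite ?mulr1 ?mulr0 ?lexx ?fxi0.
  - exact: bounded_coefD.
  - move=> p; case: (boolP (c < ep p <= c')) => h; rewrite ?mulr0 ?addr0 // !mulr1.
    by have /andP[h1 _] := near_xi _ (endpoint_in p) h; rewrite -lerBlDr.
have muE' : mu E = m%:E.
  rewrite -(mu_itv nc nc' cc') [in RHS](measureDI mu _ fractal_measurable) /=; last exact: measurable_itv.
  rewrite /E setIC -[LHS]add0e; congr (_ + _)%E; apply/esym/eqP; rewrite eq_le measure_ge0 andbT.
  have <- : mu (~` F) = 0%E by rewrite probability_setC // mu_F subee.
  apply: le_measure; rewrite ?inE; last by move=> x [].
    by apply: measurableD => //; exact: measurable_itv.
  exact: measurableC.
have int_cst (r : R) : \int[mu]_(x in E) r = r * m.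
  by rewrite Rintegral_cst //; congr (_ * _); exact: (congr1 fine muE').
have cst_int (r : R) : mu.-integrable E (EFin \o cst r).
  by apply: finite_measure_integrable_cst.
have fint : mu.-integrable E (EFin \o f) := fractal_integrable mE EF.
have lbI : (f xi - e) * m <= \int[mu]_(x in E) f x.
  rewrite -int_cst; apply: le_Rintegral; [exact: mE|exact: cst_int|exact: fint|].
  move=> x [Fx]; rewrite /= in_itv /= => h.
  by have /andP[] := near_xi x Fx h.
have ubI : \int[mu]_(x in E) f x <= (f xi + e) * m.
  rewrite -int_cst; apply: le_Rintegral; [exact: mE|exact: fint|exact: cst_int|].
  move=> x [Fx]; rewrite /= in_itv /= => h.
  by have /andP[] := near_xi x Fx h.
rewrite mulrDl in ub ubI; rewrite mulrBl in lbI.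
by rewrite ler_norml; apply/andP; split; lra.
Qed.

Lemma functional_integral_approx e : 0 < e ->
  `|phi (fun p => f (ep p)) - \int[mu]_(x in F) f x| <= 2 * e.
Proof.
move=> e0; have [d d0 hd] := uniform_continuity e0.
pose h := d / 2; have h0 : 0 < h by rewrite divr_gt0.
(* One cut in each interval of a grid of step [h = d / 2]: consecutive cuts are less than [d] apart,
   and the first one is to the left of F. *)
have /choice[c hc] k : exists c, inf F + k%:R * h - h < c < inf F + k%:R * h /\ ~ F c.
  have [|c cE nFc] := @cut_point (inf F + k%:R * h - h) (inf F + k%:R * h).
    by rewrite ltrBlDr ltrDl.
  by exists c.
have cS k : c k < c k.+1 < c k + d.
  have [/andP[h1 h2] _] := hc k; have [/andP[h3 h4] _] := hc k.+1.
  rewrite -natr1 mulrDl mul1r in h3 h4.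
  by apply/andP; rewrite /h in h1 h2 h3 h4 *; split; lra.
have c0k k : c 0%N <= c k.
  elim: k => // k ih; apply: le_trans ih _.
  by have /andP[/ltW] := cS k.
have mE (u v : R) : measurable (F `&` `]u, v]%classic).
  exact: measurableI fractal_measurable (measurable_itv _).
have ep_F := endpoint_in.
have main k : `|phi (fun p => f (ep p) * (c 0%N < ep p <= c k)%R%:R)
    - \int[mu]_(x in F `&` `]c 0%N, c k]%classic) f x|
    <= 2 * e * phi (fun p => (c 0%N < ep p <= c k)%R%:R).
  elim: k => [|k ih].
    rewrite set_itv_ge ?bnd_simp ?ltxx // setI0 Rintegral_set0 subr0.
    rewrite (_ : (fun p => f (ep p) * _) = fun=> 0); last first.
      by apply/funext => p; rewrite lt_le_asym mulr0.
    rewrite functional0 // normr0 mulr_ge0 ?functional_ge0 //.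
    by rewrite mulr_ge0 // ltW.
  have /andP[ck ckd] := cS k.
  have ind p : (c 0%N < ep p <= c k.+1)%R%:R =
      (c 0%N < ep p <= c k)%R%:R + (c k < ep p <= c k.+1)%R%:R :> R.
    case: (leP (ep p) (c k)) => pk; rewrite ?andbT ?andbF /= ?addr0 ?add0r.
      by rewrite (le_trans pk (ltW ck)) andbT.
    by rewrite (le_lt_trans (c0k k) pk).
  rewrite (_ : (fun p => f (ep p) * _) = fun p => f (ep p) * (c 0%N < ep p <= c k)%R%:R
      + f (ep p) * (c k < ep p <= c k.+1)%R%:R); last first.
    by apply/funext => p; rewrite ind mulrDr.
  rewrite (_ : (fun p => (c 0%N < ep p <= c k.+1)%R%:R) = fun p =>
      (c 0%N < ep p <= c k)%R%:R + (c k < ep p <= c k.+1)%R%:R); last exact/funext.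
  rewrite !functionalD // mulrDr.
  have -> : F `&` `]c 0%N, c k.+1]%classic =
      (F `&` `]c 0%N, c k]%classic) `|` (F `&` `]c k, c k.+1]%classic).
    rewrite -setIUr; congr (_ `&` _); rewrite -itv_bndbnd_setU // ?bnd_simp ?c0k //.
    exact: ltW.
  rewrite Rintegral_setU; last 4 first.
  - exact: mE.
  - exact: mE.
  - by apply: fractal_integrable; [exact: measurableU | move=> x [[]|[]]].
  - apply/disj_setPS => x [[_]]; rewrite /= !in_itv /= => /andP[_ xk] [_ /andP[kx _]].
    by move: (le_lt_trans xk kx); rewrite ltxx.
  rewrite opprD addrACA; apply: le_trans (ler_normD _ _) _.
  apply: lerD ih _; apply: (cell_estimate e0 hd) => //.
  - by have [] := hc k.
  - by have [] := hc k.+1.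
  - exact: ltW.
  - by rewrite ltrBlDr addrC.
have [N hN] : exists N, sup F < c N.
  exists (Num.truncn ((sup F - inf F) / h)).+2.
  have [/andP[h1 _] _] := hc (Num.truncn ((sup F - inf F) / h)).+2.
  apply: lt_trans h1; rewrite -natr1 mulrDl mul1r addrA addrK -ltrBlDl -ltr_pdivrMr //.
  exact: truncnS_gt.
have c0F : c 0%N < inf F by have [/andP[_]] := hc 0%N; rewrite mul0r addr0.
have inN x : F x -> c 0%N < x <= c N.
  move=> /(fractal_bounds F_fractal)/andP[h1 h2].
  by rewrite (lt_le_trans c0F h1) (le_trans h2 (ltW hN)).
have := main N.
rewrite (_ : F `&` _ = F); last first.
  by apply/setIidl => x /inN; rewrite /= in_itv.
rewrite (_ : (fun p => f (ep p) * _) = fun p => f (ep p)); last first.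
  by apply/funext => p; rewrite inN // mulr1.
rewrite (_ : (fun p => (_ < _ <= _)%R%:R) = fun=> 1); last first.
  by apply/funext => p; rewrite inN.
by rewrite functional1 ?mulr1.
Qed.

Lemma functional_integral : phi (fun p => f (ep p)) = \int[mu]_(x in F) f x.
Proof.
apply/eqP; rewrite -subr_eq0 -normr_eq0 eq_le normr_ge0 andbT.
apply/ler_addgt0Pr => e e0; rewrite add0r.
have e2 : 0 < e / 2 by rewrite divr_gt0.
by apply: le_trans (functional_integral_approx e2) _; rewrite mulrC divfK.
Qed.

End integral.
End representation.
End hausdorff_besicovitch.

(** * The integral formula for complex continuous functions *)

Section probability_measure.
Context {R : realType}.
Local Notation H := (l2 R).
Local Notation index := (nat * 'I_2)%type.
Variables (F : set R) (a b : nat -> R).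
Hypotheses (F_fractal : fractal F) (F_lacunae : lacunae F a b).
Variables (tau : (H -> H) -> \bar R) (t : index -> R).
Hypotheses (tau_w : tracial_weight tau) (tb : bounded_coef t) (tau1 : tau (rdiag t) = 1%E).
Variable mu : probability (measurableTypeR R) R.
Hypothesis muE : forall x y, x <= y ->
  mu `]x, y]%classic = (right_reg (cdf a b tau t) y - right_reg (cdf a b tau t) x)%:E.

Local Notation ep := (endpoint a b).
Local Notation phi := (functional tau t).

(** A weight is evaluated on positive operators only: adding the constant [K] makes [u] nonnegative,
    and the shift is subtracted afterwards. The two resulting terms are what [trace_value] asks
    for. *)
Lemma functional_shifted_integral (u : R -> R) : {within F, continuous u} ->
  exists K : R, [/\ 0 <= K, forall x, F x -> `|u x| <= K
    & phi (fun p => u (ep p) + K) - phi (fun=> K) = \int[mu]_(x in F) u x].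
Proof.
move=> uc; have [K K0 uK] := fractal_continuous_bounded F_fractal uc.
exists K; split => //.
have vc : {within F, continuous (fun x => u x + K)}.
  by move=> x; apply: cvgD; [exact: uc | exact: cvg_cst].
have v0 x : F x -> 0 <= u x + K.
  by move=> /uK; rewrite ler_norml => /andP[h _]; rewrite -lerBlDr sub0r.
rewrite (functional_integral F_fractal F_lacunae tau_w tb tau1 muE vc v0).
have phiK : phi (fun=> K) = K.
  rewrite -[X in phi X](_ : (fun=> K * 1) = _); last by apply/funext => p; rewrite mulr1.
  by rewrite functionalZ // ?functional1 ?mulr1 //; exact: bounded_coef_cst.
have mF := fractal_measurable F_fractal.
have cst_int : mu.-integrable F (EFin \o cst K) by exact: finite_measure_integrable_cst.
have u_int := fractal_integrable F_fractal mu uc mF (@subset_refl _ F).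
have KE : \int[mu]_(x in F) cst K x = K.
  rewrite Rintegral_cst //.
  by rewrite [X in K * X](congr1 fine (mu_F F_fractal F_lacunae tau_w tb tau1 muE)) mulr1.
have -> : \int[mu]_(x in F) (u x + K) = \int[mu]_(x in F) u x + \int[mu]_(x in F) cst K x.
  exact: RintegralD.
by rewrite KE phiK addrK.
Qed.

Lemma trace_value_integral (f : R -> R[i]) :
  {within F, continuous (fun x => complex.Re (f x))} ->
  {within F, continuous (fun x => complex.Im (f x))} ->
  trace_value tau (diagop (f \o ep) \o rdiag t)
    ((\int[mu]_(x in F) complex.Re (f x)) +i* (\int[mu]_(x in F) complex.Im (f x))).
Proof.
move=> /functional_shifted_integral[K [K0 fK KE]] /functional_shifted_integral[L [L0 fL LE]].
have shift (u : R -> R) (M : R) : (forall x, F x -> `|u x| <= M) ->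
    bounded_coef (fun p => u (ep p) + M).
  move=> uM; exists (M + M) => p; have := uM _ (endpoint_in F_lacunae p).
  by rewrite ler_norml => /andP[h1 h2]; rewrite -lerBlDr sub0r h1 lerD2r.
pose g1 p := complex.Re (f (ep p)) + K; pose g3 p := complex.Im (f (ep p)) + L.
have b1 : bounded_coef g1 by exact: (shift (fun x => complex.Re (f x))).
have b3 : bounded_coef g3 by exact: (shift (fun x => complex.Im (f x))).
have b2 : bounded_coef (fun=> K) := bounded_coef_cst K0.
have b4 : bounded_coef (fun=> L) := bounded_coef_cst L0.
exists (weighted t g1), (weighted t (fun=> K)), (weighted t g3), (weighted t (fun=> L)).
have ok g : bounded_coef g -> positive_op (weighted t g) /\ (tau (weighted t g) < +oo)%E.
  move=> gb; split; first exact: weighted_positive.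
  by rewrite (tau_weighted tau_w tb tau1 gb) ltry.
split.
- by move=> P; rewrite !inE => /or4P[] /eqP ->; exact: ok.
- have fb p : nsq (f (ep p)) <= K ^+ 2 + L ^+ 2.
    have h1 := fK _ (endpoint_in F_lacunae p); have h2 := fL _ (endpoint_in F_lacunae p).
    by rewrite /nsq; apply: lerD; rewrite -real_normK ?num_real // ler_pXn2r ?nnegrE.
  apply/funext => x; apply: l2_eq => p /=.
  rewrite (diagopE _ _ fb) rdiagE //.
  rewrite -[RHS]/((weighted t g1 x - weighted t (fun=> K) x
    + (0 +i* 1) *: (weighted t g3 x - weighted t (fun=> L) x)) p).
  rewrite !(l2addE, l2oppE, l2scaleE) !weightedE // /g1 /g3 /=.
  case: (f (ep p)) (x p) => [u v] [y z]; apply/eqP; rewrite eq_complex /=.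
  by apply/andP; split; apply/eqP; ring.
- by congr (_ +i* _); rewrite -?KE -?LE.
Qed.

End probability_measure.

Lemma bounded_coef_len_pow (R : realType) (F : set R) (a b : nat -> R) (s : R) :
  lacunae F a b -> 0 < s -> bounded_coef (len_pow a b s).
Proof.
move=> F_lacunae s0; exists ((sup F - inf F) `^ s) => p; rewrite powR_ge0 /=.
have /andP[l0 l1] := len_le F_lacunae p.1.
by apply: ge0_ler_powR; rewrite ?nnegrE ?(ltW s0) ?(ltW l0) // ltW // (lt_le_trans l0).
Qed.

Lemma singular_value_measure (R : realType) (F : set R) (a b : nat -> R) (s : R)
    (tau : (l2 R -> l2 R) -> \bar R) :
  fractal F -> lacunae F a b -> 0 < s -> tracial_weight tau ->
  tau (abs_dirac_pow a b s) = 1%E ->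
  exists mu : probability (measurableTypeR R) R, represents_HB_functional F a b tau s mu.
Proof.
move=> F_fractal F_lacunae s0 tau_w; have [ab _ _] := F_lacunae.
rewrite (abs_dirac_powE s ab) => tau1.
have tb := bounded_coef_len_pow F_lacunae s0.
have [mu muE] := right_reg_probability (cdf_nd a b tau_w tb tau1)
  (cdf_low F_fractal F_lacunae tau_w tb tau1) (cdf_high F_fractal F_lacunae tau1).
exists mu; split; first exact: (mu_F F_fractal F_lacunae tau_w tb tau1 muE).
move=> f fr fi; rewrite mul_opE (abs_dirac_powE s ab).
exact: (trace_value_integral F_fractal F_lacunae tau_w tb tau1 muE fr fi).
Qed.

(** * Spectral dimension and box dimension of null fractals *)

Section box_dimension.
Context {R : realType}.
Variables (F : set R) (a b : nat -> R).
Hypotheses (F_fractal : fractal F) (F_lacunae : lacunae F a b).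
Hypothesis F_null : lebesgue_measure F = 0%E.

Lemma upper_box_dim_real : exists2 d : R, 0 <= d & upper_box_dim F = d%:E.
Proof.
have h0 := upper_box_dim_ge0 F_fractal.
have h1 := upper_box_dim_le_summable F_fractal F_lacunae F_null ltr01 (summable_len F_lacunae).
by case: (upper_box_dim F) h0 h1 => [d| |] //= d0 _; exists d.
Qed.

Lemma summable_pow_above_box_dim (al : R) :
  (upper_box_dim F < al%:E)%E -> summable_pow (len a b) al.
Proof.
have [d d0 dE] := upper_box_dim_real; rewrite dE lte_fin => dal.
pose be := (d + al) / 2; have [be0 dbe beal] : [/\ 0 < be, d < be & be < al].
  by rewrite /be; split; lra.
apply: (count_summable_pow (ltW be0) beal (len_le F_lacunae)).
by apply: (count_bound_of_box_dim F_fractal F_lacunae be0); rewrite dE lte_fin.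
Qed.

(** Each inequality is proved up to an arbitrary [e], because every passage from a counting bound to
    a convergent series, or from a logarithmic mean to a counting bound, raises the exponent. *)
Lemma spectral_dimensionE : spectral_dimension a b = upper_box_dim F.
Proof.
have [d d0 dE] := upper_box_dim_real; have [ab _ _] := F_lacunae.
apply/eqP; rewrite eq_le; apply/andP; split.
  rewrite dE; apply/lee_addgt0Pr => e e0; apply: ereal_inf_lbound.
  have al0 : 0 < d + e by rewrite ltr_wpDl.
  exists (d + e); last by rewrite EFinD.
  split => //; rewrite abs_dirac_powE //.
  have [|C hC] := @summable_pow_above_box_dim (d + e); first by rewrite dE lte_fin ltrDl.
  apply: (@rdiag_L1inf0 _ _ _ _ _ (2 * C)).
  - by move=> p; rewrite /len_pow powR_gt0 // (len_gt0 F_lacunae).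
  - exact: bounded_coef_len_pow F_lacunae al0.
  - exact: len_pow_van al0 (len_gt0 F_lacunae) (len_cvg0 F_lacunae).
  - by move=> N; rewrite (series_rowsum_const (fun n => len a b n `^ (d + e))) ler_wpM2l.
apply: le_ereal_inf_tmp => _ [al [al0 +] <-]; rewrite abs_dirac_powE // => aL.
apply/lee_addgt0Pr => e e0; rewrite -EFinD.
have [e1 e2] : al < al + e / 2 /\ al + e / 2 < al + e by split; lra.
have cb := L1inf0_count_bound (len_le F_lacunae) (len_cvg0 F_lacunae) al0 e1 aL.
have ae0 : 0 < al + e / 2 := lt_trans al0 e1.
apply: (upper_box_dim_le_summable F_fractal F_lacunae F_null (lt_trans ae0 e2)).
exact: count_summable_pow (ltW ae0) e2 (len_le F_lacunae) cb.
Qed.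

Lemma box_dim_singular_trace (d : R) : upper_box_dim F = d%:E -> 0 < d ->
  exists2 tau, singular_trace tau & tau (abs_dirac_pow a b d) = 1%E.
Proof.
move=> dE d0; have [ab _ _] := F_lacunae.
rewrite (abs_dirac_powE d ab); apply: (critical_singular_trace (len_le F_lacunae) d0).
  by move=> be dbe; apply: summable_pow_above_box_dim; rewrite dE lte_fin.
move=> be be0 bed /(upper_box_dim_le_summable F_fractal F_lacunae F_null be0).
by rewrite dE lee_fin leNgt bed.
Qed.

End box_dimension.

Theorem theorem4p3 (R : realType) (F : set R) (a b : nat -> R)
    (F_fractal : fractal F) (F_lacunae : lacunae F a b) :
  (forall (s : R) (tau : (l2 R -> l2 R) -> \bar R),
     singular_traceability_exponent a b s ->
     singular_trace tau -> tau (abs_dirac_pow a b s) = 1%E ->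
     exists mu : probability (measurableTypeR R) R,
       represents_HB_functional F a b tau s mu) /\
  (lebesgue_measure F = 0%E ->
     spectral_dimension a b = upper_box_dim F /\
     (upper_box_dim F <> 0%E ->
      exists d : R,
        [/\ upper_box_dim F = d%:E, singular_traceability_exponent a b d
          & exists (tau : (l2 R -> l2 R) -> \bar R)
              (mu : probability (measurableTypeR R) R),
              [/\ singular_trace tau, tau (abs_dirac_pow a b d) = 1%E
                & represents_HB_functional F a b tau d mu]])).
Proof.
split.
  move=> s tau [s0 _] [tau_w _]; exact: singular_value_measure.
move=> F_null; split; first exact: spectral_dimensionE.
have [d d0 dE] := upper_box_dim_real F_fractal F_lacunae F_null.
rewrite dE => dn0; exists d.
have {dn0}d_gt0 : 0 < d by rewrite lt_def d0 andbT; apply/eqP => d00; apply: dn0; rewrite d00.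
have [tau tau_s tau1] := box_dim_singular_trace F_fractal F_lacunae F_null dE d_gt0.
split => //.
  by split => //; exists tau => //; rewrite tau1 lte01 ltry.
have [tau_w _] := tau_s.
have [mu mu_rep] := singular_value_measure F_fractal F_lacunae d_gt0 tau_w tau1.
by exists tau, mu.
Qed.
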